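(* Let $A\colon\mathcal H\to2^{\mathcal H}$ be maximally monotone. Let $\tau>0$ and let $C\colon\mathcal H\to\mathcal H$ be $\tau$-cocoercive, with $Cx=\mathbb E_{\xi\sim\mathcal D}[C_\xi x]$ for all $x\in\mathcal H$, where $C_\xi\colon\mathcal H\to\mathcal H$ is $\tau$-cocoercive for $\mathcal D$-almost all $\xi$, and $\xi\mapsto C_\xi x$ is $\mathcal D$-measurable with finite expectation for all $x\in\mathcal H$. Assume $\mathrm{Zer}(A+C)\neq\emptyset$. Let $\rho\in(0,2\tau)$, and define $T_\xi=(I-\rho C_\xi)\circ J_{\rho A}$ and $T=\mathbb E_{\xi\sim\mathcal D}[T_\xi]$. Assume that for some $p_0\in\mathrm{Fix}(T)$, $\mathbb E[\|(C-C_\xi)J_{\rho A}p_0\|^2]\le\sigma_*^2<+\infty$. Let $x_0\in\mathcal H$ and let $(x_k)$ be generated by the stochastic backward-forward iterations $$x_{k+1}=(1-\lambda_k)x_k+\lambda_k(I-\rho C_{\xi_k})J_{\rho A}x_k,\qquad\xi_k\overset{\text{iid}}{\sim}\mathcal D,\quad k\ge0.$$ Then, for any constant $\bar\lambda\in(0,1)$, $$\mathbb E[\|Tx_{N_K}-x_{N_K}\|]\le\begin{cases}\mathcal O(K^{-\frac14})&\text{if }\lambda_k\equiv\bar\lambda K^{-\frac12},\\ \mathcal O(\ln(K)^{\frac12}K^{-\frac14})&\text{if }\lambda_k=\bar\lambda(k+1)^{-\frac12}\ln(k+e)^{-1},\end{cases}$$ where $N_K$ is the random index defined in the context, and $$\mathbb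 E[\|Tx_K-x_K\|]\le\begin{cases}\mathcal O(K^{-\frac16})&\text{if }\lambda_k\equiv\bar\lambda K^{-\frac23},\\ \mathcal O(\ln(K)^{\frac12}K^{-\frac16})&\text{if }\lambda_k=\bar\lambda(k+1)^{-\frac23}.\end{cases}$$ Moreover, for each of the two schedules that do not depend on the horizon, namely $\lambda_k=\bar\lambda(k+1)^{-\frac12}\ln(k+e)^{-1}$ and $\lambda_k=\bar\lambda(k+1)^{-\frac23}$, $(x_k)$ converges weakly almost surely to a point $p\in\mathrm{Fix}(T)$ such that $J_{\rho A}p\in\mathrm{Zer}(A+C)$, and $\|Tx_k-x_k\|\to0$ almost surely.
   Context: $\mathcal H$ is a real separable Hilbert space with inner product $\langle\cdot,\cdot\rangle$ and norm $\|\cdot\|$, and $\mathcal D$ is a probability distribution. $I$ is the identity; $J_{\rho A}=(I+\rho A)^{-1}$ is the resolvent. $C$ is $\tau$-cocoercive if $\langle Cx-Cy,x-y\rangle\ge\tau\|Cx-Cy\|^2$ for all $x,y$. $\mathrm{Zer}(M)=\{x\colon0\in Mx\}$; $\mathrm{Fix}(T)=\{x\colon Tx=x\}$. Expectations of $\mathcal H$-valued maps are Bochner integrals. Define $\Lambda_k=\prod_{i=0}^{k-1}(1+2\lambda_i^2)^{-1}$. The random index $N_K\in\{0,\dots,K-1\}$ is independent of the algorithmic randomness $(\xi_k)$ and satisfies $$\mathbb P(N_K=k)=\frac{\Lambda_{k+1}\lambda_k(1-\lambda_k)}{\sum_{k'=0}^{K-1}\Lambda_{k'+1}\lambda_{k'}(1-\lambda_{k'})},\quad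 k=0,\dots,K-1.$$ $\mathbb E$ is over all sources of randomness. For the schedules $\lambda_k\equiv\bar\lambda K^{-1/2}$ and $\lambda_k\equiv\bar\lambda K^{-2/3}$, for each horizon $K$ the algorithm is run afresh for $K$ iterations with that constant parameter. $\mathcal O(\cdot)$ is understood as $K\to\infty$ with constants not depending on $K$. The starting point $x_0$ is deterministic, and the weak limit may be random. *)

(* Defs.v *)
From HB Require Import structures.
From mathcomp Require Import all_boot all_order all_algebra.
From mathcomp Require Import all_classical all_reals all_analysis.

Set Implicit Arguments.
Unset Strict Implicit.
Unset Printing Implicit Defensive.
Import Order.TTheory GRing.Theory Num.Theory.
Import numFieldNormedType.Exports.
Local Open Scope classical_set_scope.
Local Open Scope ring_scope.

Section Hilbert.
Context {R : realType} {H : completeNormedModType R}.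

(* The norm of [H] is the one induced by the inner product [dot]; completeness
   is part of the type of [H]. *)
Definition hilbert_norm (dot : {dot H for idfun}) : Prop :=
  forall x : H, `|x| ^+ 2 = dot x x.

Definition separable : Prop := exists S : set H, countable S /\ dense S.

Definition weakly_cvg (dot : {dot H for idfun}) (x : nat -> H) (p : H) : Prop :=
  forall y : H, dot (x k) y @[k --> \oo] --> dot p y.

(* A set-valued operator H -> 2^H is a function [H -> set H]. *)
Definition monotone (dot : {dot H for idfun}) (A : H -> set H) : Prop :=
  forall x y u v, A x u -> A y v -> 0 <= dot (x - y) (u - v).

Definition maximally_monotone (dot : {dot H for idfun}) (A : H -> set H) :
    Prop :=
  monotone dot A /\
  forall B : H -> set H, monotone dot B ->
    (forall x, A x `<=` B x) -> forall x, B x `<=` A x.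

Definition cocoercive (dot : {dot H for idfun}) (tau : R) (C : H -> H) : Prop :=
  forall x y, tau * `|C x - C y| ^+ 2 <= dot (C x - C y) (x - y).

Definition sum_op (A : H -> set H) (C : H -> H) : H -> set H :=
  fun x => [set u + C x | u in A x].

Definition Zer (M : H -> set H) : set H := [set x | M x 0].

Definition Fix (T : H -> H) : set H := [set x | T x = x].

Definition id_plus (rho : R) (A : H -> set H) : H -> set H :=
  fun x => [set x + rho *: u | u in A x].

Definition inverse_op (M : H -> set H) : H -> set H := fun y => [set x | M x y].

(* [(I + rho A)^-1] viewed as a function: the point of the set
   [(I + rho A)^-1 y], which is a singleton when [A] is maximally monotone and
   [rho > 0] (the default value 0 is then never used). *)
Definition resolvent (rho : R) (A : H -> set H) (y : H) : H :=
  xget 0 (inverse_op (id_plus rho A) y).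

End Hilbert.

Arguments separable {R} H.

Section Bochner.
Context {R : realType} {H : completeNormedModType R}.
Context {d : measure_display} {X : measurableType d} (mu : probability X R).

Definition is_simple (s : X -> H) : Prop :=
  finite_set (range s) /\ forall v, measurable (s @^-1` [set v]).

Definition simple_integral (s : X -> H) : H :=
  \sum_(v \in range s) fine (mu (s @^-1` [set v])) *: v.

(* [mu]-measurability in the sense of Bochner: [f] is the limit, [mu]-almost
   everywhere, of a sequence of simple functions. *)
Definition bochner_measurable (f : X -> H) : Prop :=
  exists s : nat -> X -> H, (forall n, is_simple (s n)) /\
    {ae mu, forall x, s n x @[n --> \oo] --> f x}.

(* In the third clause the integrand agrees almost everywhere with a
   measurable function, by the second one. *)
Definition is_bochner_integral (f : X -> H) (v : H) : Prop :=
  exists s : nat -> X -> H,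
    [/\ forall n, is_simple (s n),
        {ae mu, forall x, s n x @[n --> \oo] --> f x},
        (\int[mu]_x (`|f x - s n x|)%:E)%E @[n --> \oo] --> 0%E
      & simple_integral (s n) @[n --> \oo] --> v].

Definition bochner_integrable (f : X -> H) : Prop :=
  exists v, is_bochner_integral f v.

(* The value [v] above does not depend on the approximating sequence; the
   default value 0 is only used for functions that are not integrable. *)
Definition bochner_integral (f : X -> H) : H := xget 0 (is_bochner_integral f).

End Bochner.

Section BackwardForward.
Context {R : realType} {H : completeNormedModType R}.
Context {d : measure_display} {Xi : measurableType d}.

(* T_xi = (I - rho C_xi) o J_{rho A} *)
Definition bf_op (rho : R) (A : H -> set H) (Cs : Xi -> H -> H) (z : Xi)
    (x : H) : H :=
  resolvent rho A x - rho *: Cs z (resolvent rho A x).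

Definition bf_mean (D : probability Xi R) (rho : R) (A : H -> set H)
    (Cs : Xi -> H -> H) (x : H) : H :=
  bochner_integral D (fun z => bf_op rho A Cs z x).

(* [z k] is the realisation of xi_k. *)
Fixpoint bf_iter (rho : R) (A : H -> set H) (Cs : Xi -> H -> H)
    (lam : nat -> R) (x0 : H) (z : nat -> Xi) (k : nat) : H :=
  if k is j.+1 then
    (1 - lam j) *: bf_iter rho A Cs lam x0 z j
    + lam j *: bf_op rho A Cs (z j) (bf_iter rho A Cs lam x0 z j)
  else x0.

End BackwardForward.

Section Randomness.
Context {R : realType}.
Context {dX : measure_display} {Xi : measurableType dX}.
Context {dO : measure_display} {Omega : measurableType dO}.
Context (P : probability Omega R).

Definition iid (D : probability Xi R) (xi : nat -> {RV P >-> Xi}) : Prop :=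
  (forall k B, measurable B -> distribution P (xi k) B = D B) /\
  (forall (s : seq nat) (B : nat -> set Xi), uniq s ->
     (forall i, measurable (B i)) ->
     P (\bigcap_(i in [set` s]) xi i @^-1` B i)
     = (\prod_(i <- s) P (xi i @^-1` B i))%E).

Definition sigma_of (xi : nat -> {RV P >-> Xi}) : set (set Omega) :=
  <<s \bigcup_k preimage_set_system setT (xi k) measurable >>.

Definition Lambda (lam : nat -> R) (k : nat) : R :=
  \prod_(i < k) (1 + 2 * lam i ^+ 2)^-1.

Definition index_weight (lam : nat -> R) (k : nat) : R :=
  Lambda lam k.+1 * lam k * (1 - lam k).

(* [N] is an admissible random index N_K for the schedule [lam], independent of
   the sequence [xi]. *)
Definition random_index (lam : nat -> R) (K : nat) (xi : nat -> {RV P >-> Xi})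
    (N : {RV P >-> nat}) : Prop :=
  [/\ forall w, (N w < K)%N,
      forall k, (k < K)%N ->
        P (N @^-1` [set k])
        = (index_weight lam k / \sum_(j < K) index_weight lam j)%:E
    & forall (B : set nat) (E : set Omega), sigma_of xi E ->
        P (N @^-1` B `&` E) = (P (N @^-1` B) * P E)%E].

End Randomness.

(* u_K <= O(v_K) as K -> oo, for nonnegative [u] and [v]. *)
Definition le_bigO {R : realType} (u : nat -> \bar R) (v : nat -> R) : Prop :=
  exists M : R, \forall K \near \oo, (u K <= (M * v K)%:E)%E.

(* Main.v *)
Require Import Defs.
From HB Require Import structures.
From mathcomp Require Import all_boot all_order all_algebra.
From mathcomp Require Import all_classical all_reals all_analysis.
From mathcomp Require Import measurable_realfun zify ring lra.

Set Implicit Arguments.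
Unset Strict Implicit.
Unset Printing Implicit Defensive.
Import Order.TTheory GRing.Theory Num.Theory.
Import numFieldNormedType.Exports HBSimple HBNNSimple.
Local Open Scope classical_set_scope.
Local Open Scope ring_scope.

(** By Minty's theorem the resolvent J is everywhere defined and nonexpansive, so
    that T_xi = (I - rho C_xi) J and its expectation T = (I - rho C) J are
    nonexpansive, and the iteration is a stochastic Krasnoselskii-Mann iteration
    x_{k+1} = x_k + lambda_k (T x_k - x_k + e_k) whose noise e_k = T_{xi_k} x_k - T x_k
    is centred given the past and has variance at most 2 |x_k - p|^2 + 2 v.

    - Random index: E |x_{k+1} - p|^2 + v <= (1 + 2 lambda_k^2) E (|x_k - p|^2 + v)
      - lambda_k (1 - lambda_k) E |T x_k - x_k|^2; discounting by Lambda_k and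
      summing bounds the mean of |T x_k - x_k|^2 under the law of N_K.
    - Last iterate: let u_{k+1} = (1 - lambda_k) u_k + lambda_k e_k, started from 0
      at some time m. Then z = x - u follows the deterministic iteration for T
      with an error of norm at most |u|, hence |T z_{k+1} - z_{k+1}|^2 <=
      |T z_k - z_k|^2 + lambda_k / (1 - lambda_k) |u_k|^2, while E |u_k|^2 is of
      order lambda. Averaging over m gives the rate.
    - Almost sure convergence: the discounted |x_k - p|^2 + |u_k|^2 + v, with and
      without the sum of the decrements, are nonnegative supermartingales, so
      |x_k - p| and |u_k| converge and sum lambda_k (|T x_k - x_k|^2 + |u_k|^2) is
      finite. Since sum lambda_k diverges, u_k -> 0, then T z_k - z_k -> 0 by the
      monotonicity above, then T x_k - x_k -> 0. The weak limit is given by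
      Opial's lemma, proved with asymptotic centres instead of weak compactness. *)

(** * Hilbert spaces and monotone operators *)

(** Two obstacles shape the development. First, T_xi is evaluated at a random point while C_xi is
    cocoercive only almost surely: C_xi is replaced by a version that is cocoercive for every xi,
    and measurability of H-valued maps is expressed by distances to fixed points, where separability
    and continuity can act. Second, the null set outside which |x_k - p| converges depends on p.
    Finite variance at p0 gives finite variance at every fixed point, and separability reduces the
    claim to countably many of them.

    The exponents come from a balance. With steps of size l on a window of length comparable to K,
    the squared residual of the last iterate carries a noise error of order K l^2 + l and an
    averaging error of order 1/(K l). They agree at l = K^(-2/3), which gives K^(-1/3), hence
    K^(-1/6) for the residual. For the random index only 1/(K l) appears, but the discount must stay
    away from 0, so K l^2 has to be bounded: l = K^(-1/2). *)

Section InnerProduct.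
Context {R : realType} {H : completeNormedModType R}.
Context (dot : {dot H for idfun}) (hdot : hilbert_norm dot).
Implicit Types x y z u v : H.

Lemma dotC x y : dot x y = dot y x.
Proof. by rewrite hermC expr0 mul1r. Qed.

Lemma dotDl x y z : dot (x + y) z = dot x z + dot y z.
Proof. exact: linearDl. Qed.

Lemma dotDr x y z : dot x (y + z) = dot x y + dot x z.
Proof. exact: linearDr. Qed.

Lemma dotNl x y : dot (- x) y = - dot x y.
Proof. exact: linearNl. Qed.

Lemma dotNr x y : dot x (- y) = - dot x y.
Proof. exact: linearNr. Qed.

Lemma dotZl a x y : dot (a *: x) y = a * dot x y.
Proof. exact: linearZl_LR. Qed.

Lemma dotZr a x y : dot x (a *: y) = a * dot x y.
Proof. exact: linearZr_LR. Qed.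

Lemma dot0l x : dot 0 x = 0.
Proof. exact: linear0l. Qed.

Lemma dot0r x : dot x 0 = 0.
Proof. exact: linear0r. Qed.

Definition dotE := (dotDl, dotDr, dotNl, dotNr, dotZl, dotZr, dot0l, dot0r).

Lemma dot_ge0 x : 0 <= dot x x.
Proof. by rewrite -hdot sqr_ge0. Qed.

Lemma dot_le_normM x y : `|dot x y| <= `|x| * `|y|.
Proof.
have [->|x0] := eqVneq x 0; first by rewrite dot0l !normr0 mul0r.
rewrite -ler_sqr ?nnegrE ?mulr_ge0// exprMn !hdot real_normK ?num_real//.
have dx : 0 < dot x x by rewrite -hdot exprn_gt0// normr_gt0.
have := dot_ge0 (dot x x *: y - dot x y *: x).
rewrite (_ : dot _ _ = dot x x * (dot x x * dot y y - dot x y ^+ 2)).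
  by rewrite pmulr_rge0// subr_ge0.
by rewrite !dotE (dotC y x); ring.
Qed.

Lemma dot_eq0 x : (forall y, dot x y = 0) -> x = 0.
Proof.
by move=> /(_ x); rewrite -hdot => /eqP; rewrite sqrf_eq0 normr_eq0 => /eqP.
Qed.

Lemma dot_ext x y : (forall z, dot x z = dot y z) -> x = y.
Proof.
move=> xy; apply/eqP; rewrite -subr_eq0; apply/eqP/dot_eq0 => z.
by rewrite dotDl dotNl xy subrr.
Qed.

Lemma continuous_dotl y : continuous (fun x => dot x y).
Proof.
move=> x; apply/cvgrPdist_le => e e0.
near=> z; rewrite -dotNl -dotDl (le_trans (dot_le_normM _ _))//.
rewrite (@le_trans _ _ (`|x - z| * (`|y| + 1)))// ?ler_wpM2l ?lerDl//.
rewrite -ler_pdivlMr ?ltr_wpDl//.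
near: z; apply: cvgr_dist_le => //.
by rewrite divr_gt0 ?ltr_wpDl.
Unshelve. all: by end_near. Qed.

Lemma cvg_dist0 x (u : nat -> H) : u k @[k --> \oo] --> x ->
  `|u k - x| @[k --> \oo] --> 0.
Proof.
move=> ux; rewrite -(normr0 H) -(subrr x).
by apply: cvg_norm; apply: cvgB => //; exact: cvg_cst.
Qed.

Lemma dot_cvg x y (u v : nat -> H) : u k @[k --> \oo] --> x ->
  v k @[k --> \oo] --> y -> dot (u k) (v k) @[k --> \oo] --> dot x y.
Proof.
move=> ux vy.
have -> : (fun k => dot (u k) (v k)) =
  (fun k => dot (u k - x) (v k - y) + (dot x (v k) + dot (u k) y - dot x y)).
  by apply/funext => k; rewrite !dotE; ring.
rewrite -[X in _ --> X]add0r; apply: cvgD.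
  apply/norm_cvg0P.
  apply: (@squeeze_cvgr _ _ _ _ (cst 0) (fun k => `|u k - x| * `|v k - y|)).
  - by near=> k; rewrite normr_ge0 dot_le_normM.
  - exact: cvg_cst.
  - rewrite -(mulr0 0); apply: cvgM; exact: cvg_dist0.
rewrite -[X in _ --> X](addrK (dot x y)); apply: cvgB; last exact: cvg_cst.
apply: cvgD; last exact: (cvg_comp _ _ ux (@continuous_dotl y x)).
under eq_fun do rewrite dotC.
by rewrite (dotC x); exact: (cvg_comp _ _ vy (@continuous_dotl x y)).
Unshelve. all: by end_near. Qed.

Lemma cvg_sqr_norm x (u : nat -> H) : u k @[k --> \oo] --> x ->
  `|u k| ^+ 2 @[k --> \oo] --> `|x| ^+ 2.
Proof. by move=> ux; rewrite hdot; under eq_fun do rewrite hdot; exact: dot_cvg. Qed.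

Lemma sqr_normD_le x y : `|x + y| ^+ 2 <= 2 * `|x| ^+ 2 + 2 * `|y| ^+ 2.
Proof.
rewrite !hdot -subr_ge0 (_ : _ - _ = dot (x - y) (x - y)) ?dot_ge0//.
by rewrite !dotE (dotC y x); ring.
Qed.

Lemma cvg_of_dist_le (u : nat -> H) : (forall e : R, 0 < e ->
  exists N, forall m n, (N <= m)%N -> (N <= n)%N -> `|u m - u n| <= e) ->
  cvgn u.
Proof.
move=> h; apply/cauchy_cvgP/cauchy_ballP => e e0.
have [N hN] := h _ (divr_gt0 e0 (ltr0n _ 2)).
exists (u @` [set n | (N <= n)%N], u @` [set n | (N <= n)%N]).
  by split; exists N => // n /= Nn; exists n.
move=> [_ _]/= [[m /= mN <-] [n /= nN <-]]; rewrite -ball_normE/=.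
by apply: (le_lt_trans (hN _ _ mN nN)); rewrite ltr_pdivrMr// ltr_pMr// ltr1n.
Qed.

End InnerProduct.

Arguments dotC {R H dot} x y.

(* Two variables rather than one because the product of two complete normed
   modules is not available as such. *)
Lemma strongly_convex_min {R : realType} (V : completeNormedModType R)
    (Q : V -> V -> R -> Prop) (kappa : R) : 0 < kappa ->
  (exists x u s, Q x u s) -> (forall x u s, Q x u s -> 0 <= s) ->
  (forall x u s x' u' s', Q x u s -> Q x' u' s' ->
     Q (2^-1 *: (x + x')) (2^-1 *: (u + u'))
       (2^-1 * (s + s') - kappa * (`|x - x'| ^+ 2 + `|u - u'| ^+ 2))) ->
  (forall (xn un : nat -> V) (sn : nat -> R) x u s,
     (forall n, Q (xn n) (un n) (sn n)) ->
     xn n @[n --> \oo] --> x -> un n @[n --> \oo] --> u ->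
     sn n @[n --> \oo] --> s -> Q x u s) ->
  exists x u m, Q x u m /\ forall x' u' s', Q x' u' s' -> m <= s'.
Proof.
(* [Q] plays the role of an epigraph, which covers extended-valued functions; its last two
   properties are strong midpoint convexity and closedness. *)
move=> k0 [x0 [u0 [s0 Q0]]] Qge0 Qmid Qlim.
pose E := [set s | exists x u, Q x u s].
have E0 : E !=set0 by exists s0, x0, u0.
have hE : has_inf E by split => //; exists 0 => s [x [u /Qge0]].
pose m := inf E.
have mE x u s : Q x u s -> m <= s.
  by move=> Qs; apply: ge_inf; [exact: hE.2|exists x, u].
have /choice[f hf] n : exists t : V * V * R,
    Q t.1.1 t.1.2 t.2 /\ t.2 < m + n.+1%:R^-1.
  have [|s [x [u Qs]] sm] := @inf_adherent _ E (n.+1%:R^-1) _ hE.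
    by rewrite invr_gt0.
  by exists (x, u, s).
pose xn n := (f n).1.1; pose un n := (f n).1.2; pose sn n := (f n).2.
have Qn n : Q (xn n) (un n) (sn n) := (hf n).1.
have sm n : sn n < m + n.+1%:R^-1 := (hf n).2.
(* Two heights below m + kappa e^2 have a midpoint of height at least m; strong convexity then
   bounds their squared distance by e^2, so a minimising sequence is Cauchy. *)
have key (e : R) : 0 < e -> exists N, forall i j, (N <= i)%N -> (N <= j)%N ->
    `|xn i - xn j| ^+ 2 + `|un i - un j| ^+ 2 <= e ^+ 2.
  move=> e0; have ke : 0 < kappa * e ^+ 2 by rewrite mulr_gt0// exprn_gt0.
  have [N _ hN] := near_infty_natSinv_lt (PosNum ke).
  have snN n : (N <= n)%N -> sn n <= m + kappa * e ^+ 2.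
    move=> Nn; rewrite (le_trans (ltW (sm n)))// lerD2l ltW//.
    exact: (hN n).
  exists N => i j Ni Nj; rewrite -(ler_pM2l k0).
  have := mE _ _ _ (Qmid _ _ _ _ _ _ (Qn i) (Qn j)).
  by have := snN _ Ni; have := snN _ Nj; lra.
have sqr_le (a b e : R) : 0 < e -> a ^+ 2 + b ^+ 2 <= e ^+ 2 -> a <= e.
  move=> e0 h; rewrite (le_trans (ler_norm a))// -(@ler_pXn2r _ 2)//.
    by rewrite real_normK ?num_real//; have := sqr_ge0 b; lra.
  by rewrite nnegrE ltW.
have cx : cvgn xn.
  apply: cvg_of_dist_le => e e0; have [N hN] := key _ e0.
  by exists N => i j Ni Nj; apply: sqr_le e0 (hN _ _ Ni Nj).
have cu : cvgn un.
  apply: cvg_of_dist_le => e e0; have [N hN] := key _ e0.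
  by exists N => i j Ni Nj; apply: sqr_le e0 _; rewrite addrC; exact: hN.
exists (limn xn), (limn un), m; split => //.
apply: (Qlim xn un sn) => //.
apply: (@squeeze_cvgr _ _ _ _ (cst m) (fun n => m + n.+1%:R^-1)).
- by near=> n; rewrite (mE _ _ _ (Qn n)) ltW.
- exact: cvg_cst.
- rewrite -[X in _ --> X]addr0; apply: cvgD; first exact: cvg_cst.
  exact: cvg_harmonic.
Unshelve. all: by end_near. Qed.

(** * Minty's theorem by minimisation of the Fitzpatrick function *)

Section Minty.
Context {R : realType} {H : completeNormedModType R}.
Context (dot : {dot H for idfun}) (hdot : hilbert_norm dot).
Context (A : H -> set H) (hA : maximally_monotone dot A).

(** Adjoining to the graph a pair monotonically related to all of it keeps it monotone, so
    maximality forces the pair to be there already. *)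
Lemma maximally_monotoneP x u :
  (forall a b, A a b -> 0 <= dot (x - a) (u - b)) -> A x u.
Proof.
move=> h; have [mon max] := hA.
apply: (max (fun y => A y `|` [set v | y = x /\ v = u])); last by right.
- move=> y z v w [Ayv|[-> ->]] [Azw|[-> ->]].
  + exact: mon.
  + by rewrite -(opprB x) -(opprB u) dotNl dotNr opprK; exact: h.
  + exact: h.
  + by rewrite subrr dot0l.
- by move=> y v Ayv; left.
Qed.

(** To an empty graph the pair (0, 0) would be vacuously related. *)
Lemma maximally_monotone_nonempty : exists a b, A a b.
Proof.
apply: contrapT => h; apply: (h); exists 0, 0.
by apply: maximally_monotoneP => a b Aab; case: h; exists a, b.
Qed.

(* [fitz x u s] says that (x, u, s) is in the epigraph of the Fitzpatrick
   function sup_{(a, b) in A} <x, b> + <a, u> - <a, b> of A. *)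
Let fitz x u (s : R) := forall a b, A a b -> dot x b + dot a u - dot a b <= s.

(** If s were below <x, u>, the pair (x, u) would be monotonically related to A, hence in A, and the
    bound tested on that very pair would give <x, u> <= s. *)
Let fitz_ge x u s : fitz x u s -> dot x u <= s.
Proof.
move=> h; rewrite leNgt; apply/negP => sx.
have Axu : A x u.
  apply: maximally_monotoneP => a b Aab.
  by have := h _ _ Aab; rewrite !dotE; lra.
by have := h _ _ Axu; lra.
Qed.

Let fitz_A a b : A a b -> fitz a b (dot a b).
Proof.
by move=> Aab a' b' Aab'; have := hA.1 _ _ _ _ Aab Aab'; rewrite !dotE; lra.
Qed.

(** Let (x, u) minimise the Fitzpatrick function plus (|x|^2 + |u|^2) / 2. By [fitz_ge], optimality
    makes (-u, -x) monotonically related to A, hence a point of its graph; tested at this point,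
    optimality gives |x + u|^2 <= 0. *)
Lemma minty0 : exists x u, A x u /\ x + u = 0.
Proof.
pose Q x u t := fitz x u (t - 2^-1 * (`|x| ^+ 2 + `|u| ^+ 2)).
have [x [u [m [Qm mmin]]]] : exists x u m,
    Q x u m /\ forall x' u' s', Q x' u' s' -> m <= s'.
  (* 1/8 is the factor 1/2 of the quadratic term times the 1/4 of the parallelogram law. *)
  apply: (@strongly_convex_min _ _ _ (8^-1)); first by rewrite invr_gt0.
  - have [a [b Aab]] := maximally_monotone_nonempty.
    exists a, b, (dot a b + 2^-1 * (`|a| ^+ 2 + `|b| ^+ 2)).
    by rewrite /Q addrK; exact: fitz_A.
  - move=> x u s /fitz_ge; have := dot_ge0 hdot (x + u).
    by rewrite !hdot !dotE (dotC u x); lra.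
  - move=> x u s x' u' s' hx hx' a b Aab.
    have := hx _ _ Aab; have := hx' _ _ Aab.
    by rewrite !hdot !dotE (dotC x' x) (dotC u' u); lra.
  - move=> xn un sn x u s hn cx cu cs a b Aab.
    have cl : dot (xn n) b + dot a (un n) - dot a b @[n --> \oo] -->
        dot x b + dot a u - dot a b.
      apply: cvgB; last exact: cvg_cst.
      by apply: cvgD; apply: dot_cvg => //; exact: cvg_cst.
    have cr : sn n - 2^-1 * (`|xn n| ^+ 2 + `|un n| ^+ 2) @[n --> \oo] -->
        s - 2^-1 * (`|x| ^+ 2 + `|u| ^+ 2).
      apply: cvgB => //; apply: cvgM; first exact: cvg_cst.
      by apply: cvgD; exact: cvg_sqr_norm.
    apply: (ler_cvg_to cl cr); near=> n; exact: hn.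
have ms : dot x u + 2^-1 * (`|x| ^+ 2 + `|u| ^+ 2) <= m.
  by have := fitz_ge Qm; lra.
(* First-order optimality of (x, u), tested in the direction of (a, b) in A. *)
have opt a b : A a b ->
    dot x u + `|x| ^+ 2 + `|u| ^+ 2 <= dot a b + dot x a + dot u b.
  move=> Aab; apply/ler_addgt0Pl => e e0.
  pose G := `|a - x| ^+ 2 + `|b - u| ^+ 2.
  have G0 : 0 <= G by rewrite addr_ge0 ?sqr_ge0.
  (* Moving by t towards (a, b) costs a second-order term t^2 G / 2, which this t keeps below e
     after division by t. *)
  pose t := Num.min 1 (e / (G + 1)).
  have t0 : 0 < t by rewrite lt_min ltr01 divr_gt0// ltr_wpDl.
  have t1 : t <= 1 by rewrite ge_min lexx.
  have tG : t * G <= e.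
    have : t <= e / (G + 1) by rewrite ge_min lexx orbT.
    rewrite ler_pdivlMr ?ltr_wpDl// mulrDr mulr1; lra.
  (* Convexity of the Fitzpatrick function between (x, u) and the graph point (a, b), where it is at
     most <a, b>. *)
  have Qt : Q (x + t *: (a - x)) (u + t *: (b - u))
     ((1 - t) * (m - 2^-1 * (`|x| ^+ 2 + `|u| ^+ 2)) + t * dot a b +
       2^-1 * (`|x + t *: (a - x)| ^+ 2 + `|u + t *: (b - u)| ^+ 2)).
    move=> a' b' Aab'; rewrite addrK.
    have t10 : 0 <= 1 - t by rewrite subr_ge0.
    have := ler_wpM2l t10 (Qm _ _ Aab').
    have := ler_wpM2l (ltW t0) (fitz_A Aab Aab').
    by rewrite !dotE; lra.
  have := mmin _ _ _ Qt.
  have -> : `|x + t *: (a - x)| ^+ 2 =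
      `|x| ^+ 2 + 2 * t * dot x (a - x) + t * (t * `|a - x| ^+ 2).
    by rewrite !hdot !dotE (dotC a x); ring.
  have -> : `|u + t *: (b - u)| ^+ 2 =
      `|u| ^+ 2 + 2 * t * dot u (b - u) + t * (t * `|b - u| ^+ 2).
    by rewrite !hdot !dotE (dotC b u); ring.
  move=> hm.
  have {hm} : 0 <= t * (dot a b - (m - 2^-1 * (`|x| ^+ 2 + `|u| ^+ 2))
      + dot x (a - x) + dot u (b - u)
      + 2^-1 * (t * (`|a - x| ^+ 2 + `|b - u| ^+ 2))) by lra.
  rewrite pmulr_rge0// !dotE -!hdot.
  have : 2^-1 * (t * (`|a - x| ^+ 2 + `|b - u| ^+ 2)) <= e by rewrite /G in tG; lra.
  lra.
have Aux : A (- u) (- x).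
  apply: maximally_monotoneP => a b Aab; have := opt _ _ Aab.
  have := dot_ge0 hdot (x + u).
  by rewrite !hdot !dotE (dotC u x) (dotC a x); lra.
exists (- u), (- x); split => //; apply/eqP; rewrite -normr_eq0 -sqrf_eq0.
rewrite eq_le sqr_ge0 andbT hdot; have := opt _ _ Aux.
by rewrite !hdot !dotE (dotC u x); lra.
Unshelve. all: by end_near. Qed.

End Minty.

Definition nonexpansive {R : realType} {H : normedModType R} (T : H -> H) :=
  forall x y, `|T x - T y| <= `|x - y|.

Lemma nonexpansive_continuous {R : realType} {H : normedModType R}
    (S : H -> H) : nonexpansive S -> continuous S.
Proof.
move=> hS y; apply/cvgrPdist_lt => e e0; near=> t.
by rewrite (le_lt_trans (hS _ _))//; near: t; exact: cvgr_dist_lt.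
Unshelve. all: by end_near. Qed.

(** * Nonexpansive operators and the deterministic inequalities of the iteration *)

Section Operators.
Context {R : realType} {H : completeNormedModType R}.
Context (dot : {dot H for idfun}) (hdot : hilbert_norm dot).

Lemma ler_norm_dot (x y : H) : dot x x <= dot y y -> `|x| <= `|y|.
Proof. by move=> h; rewrite -(@ler_pXn2r _ 2) ?nnegrE// !hdot. Qed.

(** Apply [minty0] to z -> rho A (z + y), again maximally monotone: z + w = 0 becomes (z + y) + w =
    y with w in rho A (z + y). *)
Lemma minty (A : H -> set H) (rho : R) (y : H) :
  maximally_monotone dot A -> 0 < rho -> exists x u, A x u /\ x + rho *: u = y.
Proof.
move=> hA r0; pose A' z := [set w | A (z + y) (rho^-1 *: w)].
have rn0 : rho != 0 by rewrite gt_eqF.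
have A'max : maximally_monotone dot A'.
  split=> [x z u v Au Av|B Bmon A'B x u Bxu].
    have := hA.1 _ _ _ _ Au Av; rewrite opprD addrACA subrr addr0 -scalerBr dotZr.
    by rewrite pmulr_rge0// invr_gt0.
  pose B' z := [set w | B (z - y) (rho *: w)].
  have B'mon : Defs.monotone dot B'.
    move=> a b v w Bv Bw; have := Bmon _ _ _ _ Bv Bw.
    rewrite opprB addrA subrK -scalerBr dotZr.
    by rewrite pmulr_rge0.
  have AB' z : A z `<=` B' z.
    by move=> w Azw; apply: A'B; rewrite /A' /= subrK scalerA mulVf// scale1r.
  apply: (hA.2 B' B'mon AB').
  by rewrite /B' /= addrK scalerA divff// scale1r.
have [z [w [Azw zw0]]] := minty0 hdot A'max.
exists (z + y), (rho^-1 *: w); split => //.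
by rewrite scalerA divff// scale1r addrAC zw0 add0r.
Qed.

Lemma resolventP (A : H -> set H) (rho : R) (y : H) :
  maximally_monotone dot A -> 0 < rho ->
  exists2 u, A (resolvent rho A y) u & resolvent rho A y + rho *: u = y.
Proof.
move=> hA r0; have [x [u [Axu xuy]]] := minty y hA r0.
suff: inverse_op (id_plus rho A) y (resolvent rho A y) by [].
by apply: xgetPex; exists x, u.
Qed.

(** Monotonicity makes the cross term of |(a - b) + rho (u - v)|^2 nonnegative. *)
Lemma resolvent_nonexpansive (A : H -> set H) (rho : R) :
  maximally_monotone dot A -> 0 < rho -> nonexpansive (resolvent rho A).
Proof.
move=> hA r0 x y; have [u Au xu] := resolventP x hA r0.
have [v Av yv] := resolventP y hA r0.
set a := resolvent rho A x in Au xu *; set b := resolvent rho A y in Av yv *.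
apply: ler_norm_dot; rewrite -xu -yv opprD addrACA -scalerBr.
have := mulr_ge0 (ltW r0) (hA.1 _ _ _ _ Au Av).
have := mulr_ge0 (sqr_ge0 rho) (dot_ge0 hdot (u - v)).
move: (a - b) (u - v) => p q; rewrite !dotE (dotC q p); lra.
Qed.

(** By cocoercivity, |p - rho q|^2 is at most |p|^2 - rho (2 tau - rho) |q|^2; this is where rho < 2
    tau enters. *)
Lemma forward_nonexpansive (tau rho : R) (C : H -> H) :
  0 < rho < 2 * tau -> cocoercive dot tau C ->
  nonexpansive (fun x => x - rho *: C x).
Proof.
move=> /andP[r0 r2] hC x y; apply: ler_norm_dot.
have -> : x - rho *: C x - (y - rho *: C y) = (x - y) - rho *: (C x - C y).
  by apply: (dot_ext hdot) => z; rewrite !dotE; ring.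
have := ler_wpM2l (ltW r0) (hC x y); rewrite hdot.
have r2' : 0 <= rho * (2 * tau - rho) by rewrite mulr_ge0 ?ltW// subr_gt0.
have := mulr_ge0 r2' (dot_ge0 hdot (C x - C y)).
move: (x - y) (C x - C y) => p q; rewrite !dotE (dotC q p); lra.
Qed.

Lemma cocoercive_lipschitz (tau : R) (C : H -> H) x y : 0 < tau ->
  cocoercive dot tau C -> `|C x - C y| <= tau^-1 * `|x - y|.
Proof.
move=> t0 hC; have := hC x y; have := dot_le_normM hdot (C x - C y) (x - y).
have [->|n0] := eqVneq (`|C x - C y|) 0.
  by rewrite mulr_ge0// invr_ge0 ltW.
move=> h1 h2; rewrite ler_pdivlMl// -(@ler_pM2l _ `|C x - C y|); last first.
  by rewrite lt_neqAle eq_sym n0/=.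
by rewrite mulrCA -expr2; apply: (le_trans h2); apply: le_trans h1; exact: ler_norm.
Qed.

(** With p = J p + rho u and u in A (J p), the fixed-point equation reads u = - C (J p). *)
Lemma fix_backward_forward (A : H -> set H) (C : H -> H) (rho : R) (p : H) :
  maximally_monotone dot A -> 0 < rho ->
  resolvent rho A p - rho *: C (resolvent rho A p) = p ->
  Zer (sum_op A C) (resolvent rho A p).
Proof.
move=> hA r0 hp; have [u Au pu] := resolventP p hA r0.
exists u => //.
have : rho *: (u + C (resolvent rho A p)) = 0.
  move: pu hp; set a := resolvent rho A p => pu hp.
  have -> : rho *: (u + C a) = (a + rho *: u) - (a - rho *: C a).
    by apply: (dot_ext hdot) => z; rewrite !dotE; ring.
  by rewrite pu hp subrr.
by move/eqP; rewrite scaler_eq0 gt_eqF//= => /eqP.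
Qed.

Section Nonexpansive.
Context (T : H -> H) (hT : nonexpansive T).

(** This is the identity |(1 - l) a + l b|^2 = (1 - l) |a|^2 + l |b|^2 - l (1 - l) |a - b|^2 with a
    = x - p and b = T x - p. *)
Lemma km_step (x p : H) (l : R) : T p = p -> 0 <= l ->
  `|x + l *: (T x - x) - p| ^+ 2 <=
  `|x - p| ^+ 2 - l * (1 - l) * `|T x - x| ^+ 2.
Proof.
move=> Tp l0; have h : `|T x - p| ^+ 2 <= `|x - p| ^+ 2.
  by rewrite ler_pXn2r ?nnegrE// -{1}Tp; exact: hT.
have := ler_wpM2l l0 h; rewrite !hdot !dotE.
rewrite (dotC p x) (dotC p (T x)) (dotC (T x) x); lra.
Qed.

(** An exact step from z cannot increase the residual; evaluating T at x instead of z is the only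
    source of the error term. *)
Lemma residual_step (x z : H) (l : R) : 0 < l < 1 ->
  `|T ((1 - l) *: z + l *: T x) - ((1 - l) *: z + l *: T x)| ^+ 2 <=
  `|T z - z| ^+ 2 + l / (1 - l) * `|x - z| ^+ 2.
Proof.
move=> /andP[l0 l1]; set z' := (1 - l) *: z + l *: T x.
have l10 : 0 < 1 - l by rewrite subr_gt0.
pose d := (z' - T z') - (z - T z); pose eta := T x - T z.
pose f := z - T z.
have h1 : `|eta| ^+ 2 <= `|x - z| ^+ 2.
  by rewrite ler_pXn2r ?nnegrE//; exact: hT.
have zz : z' - z = l *: (eta - f).
  by apply: (dot_ext hdot) => y; rewrite /z' /eta /f !dotE; ring.
(* Nonexpansiveness of T amounts to 1/2-cocoercivity of I - T, which is applied here between z' and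
   z. *)
have h2 : dot d d <= 2 * (l * (dot d eta - dot d f)).
  have : `|T z' - T z| ^+ 2 <= `|z' - z| ^+ 2.
    by rewrite ler_pXn2r ?nnegrE//; exact: hT.
  have -> : T z' - T z = (z' - z) - d.
    by apply: (dot_ext hdot) => y; rewrite /d !dotE; ring.
  rewrite zz !hdot; move: (d) (eta) (f) => a b c.
  by rewrite !dotE (dotC b a) (dotC c a); lra.
(* Young's inequality with weights 1 - l and l absorbs <d, eta>, and is the origin of the factor l /
   (1 - l). *)
have h3 := dot_ge0 hdot ((1 - l) *: d - l *: eta).
have -> : T z' - z' = - (f + d).
  by apply: (dot_ext hdot) => y; rewrite /d /f !dotE; ring.
rewrite normrN -/(f) -[T z - z]opprB normrN -/f.
rewrite -(ler_pM2l (mulr_gt0 l0 l10)) [leRHS]mulrDr.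
have -> : l * (1 - l) * (l / (1 - l) * `|x - z| ^+ 2) = l ^+ 2 * `|x - z| ^+ 2.
  by field; rewrite gt_eqF.
apply: (@le_trans _ _ (l * (1 - l) * `|f| ^+ 2 + l ^+ 2 * `|eta| ^+ 2)); last first.
  by rewrite lerD2l ler_wpM2l ?sqr_ge0.
have {}h2 := ler_wpM2l (ltW l10) h2.
move: h3 h2; rewrite !hdot; move: (d) (eta) (f) => a b c.
rewrite !dotE (dotC b a) (dotC c a).
lra.
Qed.

(** The two corrections T (x - u) - T x and u both have norm at most |u|; splitting squares twice
    gives 2 * (2 + 2) = 8. Applied with -u it also gives the converse comparison. *)
Lemma residual_perturbation (x u : H) :
  `|T (x - u) - (x - u)| ^+ 2 <= 2 * `|T x - x| ^+ 2 + 8 * `|u| ^+ 2.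
Proof.
have -> : T (x - u) - (x - u) = (T x - x) + ((T (x - u) - T x) + u).
  by apply: (dot_ext hdot) => y; rewrite !dotE; ring.
have h1 : `|T (x - u) - T x| ^+ 2 <= `|u| ^+ 2.
  rewrite ler_pXn2r ?nnegrE// (le_trans (hT _ _))//.
  by rewrite addrAC subrr add0r normrN.
have h2 := sqr_normD_le hdot (T x - x) ((T (x - u) - T x) + u).
have h3 := sqr_normD_le hdot (T (x - u) - T x) u.
lra.
Qed.

End Nonexpansive.
End Operators.

(** * Opial's lemma *)

Section Opial.
Context {R : realType} {H : completeNormedModType R}.
Context (dot : {dot H for idfun}) (hdot : hilbert_norm dot).
Implicit Types u : nat -> H.

(** A bound on limsup |u_n - w|^2 stated as a relation, so that it is directly an epigraph for
    [strongly_convex_min]. *)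
Definition limsup_dist_le u (w : H) (s : R) :=
  forall e, 0 < e -> \forall n \near \oo, `|u n - w| ^+ 2 <= s + e.

Lemma limsup_dist_le_ge0 u w s : limsup_dist_le u w s -> 0 <= s.
Proof.
move=> h; apply/ler_addgt0Pr => e e0; have [N _ hN] := h e e0.
exact: le_trans (sqr_ge0 _) (hN N (leqnn _)).
Qed.

Lemma limsup_dist_le_mid u w s w' s' :
  limsup_dist_le u w s -> limsup_dist_le u w' s' ->
  limsup_dist_le u (2^-1 *: (w + w')) (2^-1 * (s + s') - 4^-1 * `|w - w'| ^+ 2).
Proof.
move=> h h' e e0; near=> n.
have hn : `|u n - w| ^+ 2 <= s + e by near: n; exact: h.
have hn' : `|u n - w'| ^+ 2 <= s' + e by near: n; exact: h'.
move: hn hn'; rewrite !hdot !dotE (dotC w (u n)) (dotC w' (u n)) (dotC w' w); lra.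
Unshelve. all: by end_near. Qed.

Lemma limsup_dist_le_lim u (wn : nat -> H) (sn : nat -> R) w s :
  (forall n, limsup_dist_le u (wn n) (sn n)) ->
  wn n @[n --> \oo] --> w -> sn n @[n --> \oo] --> s -> limsup_dist_le u w s.
Proof.
move=> h cw cs e e0.
pose dn n := `|wn n - w|.
(* With S = sn + e/2, this bounds (a + d)^2 = a^2 + d (2 a + d) when a^2 <= S, since then a <= S +
   1. *)
pose g n := (sn n + e / 2) + dn n * (2 * (sn n + e / 2 + 1) + dn n).
have cd : dn n @[n --> \oo] --> 0 := cvg_dist0 cw.
have cg : g n @[n --> \oo] --> (s + e / 2) + 0 * (2 * (s + e / 2 + 1) + 0).
  have cs2 : sn n + e / 2 @[n --> \oo] --> s + e / 2.
    by apply: cvgD; [exact: cs|exact: cvg_cst].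
  apply: cvgD => //; apply: cvgM => //; apply: cvgD => //.
  by apply: cvgM; [exact: cvg_cst|apply: cvgD; [exact: cs2|exact: cvg_cst]].
have [n gn] : exists n, g n < s + e.
  suff [N _ hN] : \forall n \near \oo, g n < s + e by exists N; exact: (hN N (leqnn N)).
  by apply: cvgr_lt cg _ _; rewrite mul0r addr0 ltrD2l; lra.
have e2 : 0 < e / 2 by rewrite divr_gt0.
near=> k.
have hk : `|u k - wn n| ^+ 2 <= sn n + e / 2 by near: k; exact: h.
apply: le_trans (ltW gn).
have t : `|u k - w| <= `|u k - wn n| + dn n.
  by rewrite /dn (le_trans _ (ler_normD _ _))// addrA subrK.
have d0 : 0 <= dn n by rewrite /dn.
rewrite (@le_trans _ _ ((`|u k - wn n| + dn n) ^+ 2))//.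
  by rewrite ler_pXn2r ?nnegrE// addr_ge0.
rewrite /g; move: (`|u k - wn n|) hk (normr_ge0 (u k - wn n)) => a a2 a0.
have : a <= sn n + e / 2 + 1 by have := sqr_ge0 (a - 1); lra.
move=> /(ler_wpM2l d0); lra.
Unshelve. all: by end_near. Qed.

(** The parallelogram law makes the limsup of squared distances strongly convex in the centre. The
    second variable of [strongly_convex_min] is pinned to 0. *)
Lemma asymptotic_center u : (exists w s, limsup_dist_le u w s) ->
  exists c m, limsup_dist_le u c m /\
    forall w s, limsup_dist_le u w s -> m <= s.
Proof.
move=> [w0 [s0 h0]].
have [|||||c [v [m [[hm _] mmin]]]] :=
    @strongly_convex_min _ H (fun x v s => limsup_dist_le u x s /\ v = 0) 4^-1.
- by rewrite invr_gt0.
- by exists w0, 0, s0.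
- by move=> x v s [/limsup_dist_le_ge0].
- move=> x v s x' v' s' [hx ->] [hx' ->]; rewrite addr0 scaler0 subrr normr0.
  by rewrite expr0n addr0; split => //; exact: limsup_dist_le_mid.
- move=> xn vn sn x v s hn cx cv cs; split.
    by apply: limsup_dist_le_lim cx cs => n; have [] := hn n.
  suff <- : lim (vn n @[n --> \oo]) = v.
    rewrite (_ : vn = cst 0) ?lim_cst//.
    by apply/funext => n; have [] := hn n.
  exact/cvg_lim.
exists c, m; split => // w s hw; exact: (mmin w 0 s).
Qed.

Lemma asymptotic_center_unique u c c' m :
  limsup_dist_le u c m -> limsup_dist_le u c' m ->
  (forall w s, limsup_dist_le u w s -> m <= s) -> c = c'.
Proof.
move=> h h' /(_ _ _ (limsup_dist_le_mid h h')) mm.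
apply/eqP; rewrite -subr_eq0 -normr_eq0 -sqrf_eq0 eq_le sqr_ge0 andbT; lra.
Qed.

(** As the residuals vanish, u_n is asymptotically no farther from T c than from c, so T c is a
    centre too and uniqueness applies. *)
Lemma asymptotic_center_fix (T : H -> H) u c m : nonexpansive T ->
  (fun n => `|T (u n) - u n|) @ \oo --> 0 ->
  limsup_dist_le u c m -> (forall w s, limsup_dist_le u w s -> m <= s) ->
  T c = c.
Proof.
move=> hT ru hc mmin; apply: (asymptotic_center_unique _ hc mmin) => e e0.
have m0 := limsup_dist_le_ge0 hc.
(* B eventually bounds a = |u_n - c|; then (r + a)^2 <= a^2 + r (2 B + 1) for r <= 1, which fixes
   the threshold in [r2]. *)
pose B := m + 2.
have B0 : 0 < B by rewrite ltr_wpDl.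
have e2 : 0 < e / 2 by rewrite divr_gt0.
near=> n.
have r1 : `|T (u n) - u n| <= 1.
  by rewrite -(normr_id (_ - _)); near: n; exact: cvgr0_norm_le.
have r2 : `|T (u n) - u n| <= e / 2 / (2 * B + 1).
  rewrite -(normr_id (_ - _)); near: n; apply: cvgr0_norm_le => //.
  by rewrite divr_gt0// addr_gt0// mulr_gt0.
have h1 : `|u n - c| ^+ 2 <= m + 1 by near: n; exact: hc.
have h2 : `|u n - c| ^+ 2 <= m + e / 2 by near: n; exact: hc.
have t : `|u n - T c| <= `|T (u n) - u n| + `|u n - c|.
  rewrite (le_trans _ (lerD (lexx _) (hT (u n) c)))//.
  by rewrite (distrC (T (u n))) (le_trans _ (ler_normD _ _))// addrA subrK.
rewrite (@le_trans _ _ ((`|T (u n) - u n| + `|u n - c|) ^+ 2))//.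
  by rewrite ler_pXn2r ?nnegrE// addr_ge0.
move: r1 r2 h1 h2 {t}; rewrite ler_pdivlMr; last by rewrite addr_gt0// mulr_gt0.
move: (normr_ge0 (T (u n) - u n)) (normr_ge0 (u n - c)).
move: `|T (u n) - u n| `|u n - c| => r a r0 a0 r1 r2 h1 h2.
have aB : a <= B by rewrite /B; have := sqr_ge0 (a - 1); lra.
have := ler_wpM2l r0 aB; have := ler_wpM2l r0 r1; lra.
Unshelve. all: by end_near. Qed.

(** The weak limit is the asymptotic centre c of the whole sequence. Convergence of the distances to
    fixed points keeps the radius of every subsequence from dropping below that of c, and a failure
    of weak convergence would produce a subsequence with a smaller radius. *)
Lemma opial (T : H -> H) (x : nat -> H) : nonexpansive T -> Fix T !=set0 ->
  (forall p, Fix T p -> cvgn (fun k => `|x k - p|)) ->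
  (fun n => `|T (x n) - x n|) @ \oo --> 0 ->
  exists2 p, Fix T p & weakly_cvg dot x p.
Proof.
move=> hT [q Fq] hcv rx.
pose l p := lim ((fun k => `|x k - p| ^+ 2) @ \oo).
have hl p : Fix T p -> (fun k => `|x k - p| ^+ 2) @ \oo --> l p.
  move=> Fp; apply/cvg_ex; exists (lim ((fun k => `|x k - p|) @ \oo) ^+ 2).
  by apply: cvgM; exact: hcv.
(* Subsequences are reindexings with n <= phi n, which is enough to follow tails and easy to obtain
   by choice. *)
have sub_cvg (V : topologicalType) (f : nat -> V) (a : V) (phi : nat -> nat) :
    (forall n, (n <= phi n)%N) -> f @ \oo --> a -> (f \o phi) @ \oo --> a.
  move=> hphi fa; apply: cvg_comp fa => P [N _ hN]; exists N => // n /= Nn.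
  by apply: hN => /=; exact: leq_trans Nn (hphi n).
have l_lim phi p : (forall n, (n <= phi n)%N) -> Fix T p ->
    limsup_dist_le (x \o phi) p (l p).
  move=> hphi Fp e e0; have := sub_cvg _ _ _ _ hphi (hl p Fp).
  move=> /cvgr_le /(_ (l p + e)); apply; lra.
have l_min phi p s : (forall n, (n <= phi n)%N) -> Fix T p ->
    limsup_dist_le (x \o phi) p s -> l p <= s.
  move=> hphi Fp hs; apply/ler_addgt0Pr => e e0.
  have := sub_cvg _ _ _ _ hphi (hl p Fp).
  by move=> h; apply: (ler_cvg_to h (cvg_cst (s + e))); exact: hs.
have idle n : (n <= id n)%N by [].
have [c [m [cm mmin]]] : exists c m, limsup_dist_le x c m /\
    forall w s, limsup_dist_le x w s -> m <= s.
  by apply: asymptotic_center; exists q, (l q); exact: (l_lim id).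
have Fc : Fix T c by apply: asymptotic_center_fix cm mmin.
have lcm : l c <= m by apply: (l_min id).
(* The centre c' of the subsequence is a fixed point, so the limit of |x_k - c'|^2 along the
   subsequence is the one along the whole sequence, hence at least m. *)
have sub_min phi : (forall n, (n <= phi n)%N) ->
    forall w s, limsup_dist_le (x \o phi) w s -> m <= s.
  move=> hphi w s ws.
  have [c' [m' [cm' mmin']]] : exists c m, limsup_dist_le (x \o phi) c m /\
      forall w s, limsup_dist_le (x \o phi) w s -> m <= s.
    by apply: asymptotic_center; exists w, s.
  have Fc' : Fix T c'.
    apply: asymptotic_center_fix cm' mmin' => //.
    exact: (sub_cvg _ (fun n => `|T (x n) - x n|)).
  have h1 : l c' <= m' by exact: (l_min phi).
  have h2 : m <= l c' by apply: mmin; exact: (l_lim id).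
  by apply: (le_trans h2); apply: (le_trans h1); exact: mmin' ws.
exists c => // y.
have half z e : 0 < e -> \forall k \near \oo, dot (x k - c) z < e.
  move=> e0; apply: contrapT => hn.
  have /choice[phi hphi] N : exists k, (N <= k)%N /\ e <= dot (x k - c) z.
    apply: contrapT => hN; apply: hn; exists N => // k Nk.
    by rewrite ltNge; apply/negP => ek; apply: hN; exists k.
  have key t : 0 < t -> m <= m - 2 * t * e + t ^+ 2 * `|z| ^+ 2.
    move=> t0; apply: (sub_min phi (fun n => (hphi n).1) (c + t *: z)) => d d0.
    have := l_lim phi c (fun n => (hphi n).1) Fc d d0.
    apply: filterS => n /= hn'; have := ler_wpM2l (ltW t0) (hphi n).2.
    move: hn'; rewrite opprD addrA; move: (x (phi n) - c) => a.
    rewrite !hdot !dotE (dotC z a); lra.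
  (* For this t the gain 2 t e exceeds the loss t^2 |z|^2 by t e + t^2, contradicting [key]. *)
  pose t := e / (`|z| ^+ 2 + 1).
  have z1 : 0 < `|z| ^+ 2 + 1 by rewrite ltr_wpDl// sqr_ge0.
  have t0 : 0 < t by rewrite divr_gt0.
  have := key t t0.
  have : t * (`|z| ^+ 2 + 1) = e by rewrite /t divfK// gt_eqF.
  have := mulr_gt0 t0 e0; have := mulr_gt0 t0 t0.
  move=> tt te te' hh.
  have : t * e = t ^+ 2 * `|z| ^+ 2 + t * t by rewrite -te'; ring.
  lra.
apply/cvgrPdist_lt => e e0; near=> k.
rewrite distrC -dotNl -dotDl ltr_norml; apply/andP; split.
  by rewrite ltrNl -dotNr; near: k; exact: half.
by near: k; exact: half.
Unshelve. all: by end_near. Qed.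

End Opial.

(** * Measurability and Bochner integrals *)

Lemma separable_seq {R : realType} (H : completeNormedModType R) :
  separable H -> exists q : nat -> H, forall (x : H) (e : R), 0 < e ->
    exists n, `|x - q n| < e.
Proof.
move=> [S [/countable_injP[f finj] dS]].
pose q n := xget 0 [set s | S s /\ f s = n].
exists q => x e e0.
have [y [xy Sy]] : ball x e `&` S !=set0.
  by apply: dS; [exists x; exact: ballxx|exact: ball_open].
exists (f y); have -> : q (f y) = y.
  rewrite /q; case: xgetP => [z _ [Sz fz]|/(_ y)]; last by case.
  by apply: finj => //; rewrite inE.
by move: xy; rewrite -ball_normE.
Qed.

(** In a separable space the balls generate the Borel sets, so measurability of all distances to
    points replaces a sigma-algebra on H. *)
Definition hmeas {R : realType} {H : completeNormedModType R} {d}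
    {X : measurableType d} (f : X -> H) :=
  forall v, measurable_fun setT (fun w => `|f w - v|).

Section StrongMeasurability.
Context {R : realType} {H : completeNormedModType R} (hsep : separable H).

Lemma measurable_glue d (X : measurableType d) d' (Y : measurableType d')
    (g : X -> nat) (h : nat -> X -> Y) :
  (forall i, measurable [set w | g w = i]) ->
  (forall i, measurable_fun setT (h i)) ->
  measurable_fun setT (fun w => h (g w) w).
Proof.
move=> mg mh _ B mB; rewrite setTI.
rewrite (_ : _ @^-1` B = \bigcup_i ([set w | g w = i] `&` (h i @^-1` B))).
  apply: bigcup_measurable => i _; apply: measurableI => //.
  by rewrite -[X in measurable X]setTI; exact: mh.
apply/seteqP; split => [w Bw|w [i _ [/= <-]]//].
by exists (g w).
Qed.

(* [f w] is approximated by the first element of a dense sequence that is close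
   to it, so that Psi(w, f w) is a limit of functions that agree with some
   Psi(., v) on each piece of a countable measurable partition. *)
Lemma measurable_caratheodory d (X : measurableType d) (Psi : X -> H -> R)
    (f : X -> H) :
  (forall v, measurable_fun setT (Psi ^~ v)) ->
  (forall w, continuous (Psi w)) -> hmeas f ->
  measurable_fun setT (fun w => Psi w (f w)).
Proof.
move=> mPsi cPsi mf; have [q hq] := separable_seq hsep.
have hex n w : exists i, `|f w - q i| < n.+1%:R^-1.
  by apply: hq; rewrite invr_gt0.
pose g n w := ex_minn (hex n w).
have gP n w : `|f w - q (g n w)| < n.+1%:R^-1.
  by rewrite /g; case: ex_minnP.
have mg n i : measurable [set w | g n w = i].
  pose P j := [set w | `|f w - q j| < n.+1%:R^-1].
  have mP j : measurable (P j).
    rewrite /P (_ : [set w | _] = (fun w => `|f w - q j|) @^-1` `]-oo, n.+1%:R^-1[).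
      by rewrite -[X in measurable X]setTI; apply: mf.
    by apply/seteqP; split => w /=; rewrite in_itv.
  rewrite (_ : [set w | _] = P i `\` \bigcup_(j in [set j | (j < i)%N]) P j).
    by apply: measurableD => //; apply: bigcup_measurable.
  apply/seteqP; split => [w /= <-|w /= [Pi hi]].
    split; first exact: gP.
    move=> [j /= ji Pj]; move: ji; rewrite ltnNge /g.
    by case: ex_minnP => m _ /(_ _ Pj) ->.
  rewrite /g; case: ex_minnP => m Pm mmin; apply/eqP.
  rewrite eqn_leq mmin//= leqNgt; apply/negP => mi.
  by apply: hi; exists m.
apply: (@measurable_fun_cvg _ _ _ _ (fun n w => Psi w (q (g n w)))).
  by move=> n; exact: (measurable_glue (h := fun i w => Psi w (q i))).
move=> w _; apply: continuous_cvg; first exact: cPsi.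
apply/cvgrPdist_lt => e e0; near=> n; apply: lt_trans (gP n w) _.
by near: n; exact: (near_infty_natSinv_lt (PosNum e0)).
Unshelve. all: by end_near. Qed.

Section Closure.
Context {d} {X : measurableType d}.

Lemma hmeas_cst (v : H) : hmeas (fun _ : X => v).
Proof. by move=> u; exact: measurable_cst. Qed.

Lemma hmeas_comp d' (Y : measurableType d') (f : X -> H) (g : Y -> X) :
  hmeas f -> measurable_fun setT g -> hmeas (fun y => f (g y)).
Proof. by move=> mf mg v; exact: (measurableT_comp (mf v) mg). Qed.

Lemma hmeas_cvg (fn : nat -> X -> H) (f : X -> H) :
  (forall n, hmeas (fn n)) -> (forall w, fn n w @[n --> \oo] --> f w) ->
  hmeas f.
Proof.
move=> mfn cf v; apply: (@measurable_fun_cvg _ _ _ _ (fun n w => `|fn n w - v|)).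
  by move=> n; exact: mfn.
by move=> w _; apply: cvg_norm; apply: cvgB; [exact: cf|exact: cvg_cst].
Qed.

(** This gives measurability of a random operator evaluated at a random point, as in T_xi (x_k). *)
Lemma hmeas_caratheodory (Phi : X -> H -> H) (f : X -> H) :
  (forall v, hmeas (Phi ^~ v)) -> (forall w, continuous (Phi w)) -> hmeas f ->
  hmeas (fun w => Phi w (f w)).
Proof.
move=> mPhi cPhi mf v.
apply: (@measurable_caratheodory _ _ (fun w u => `|Phi w u - v|)) => //.
  by move=> u; exact: mPhi.
move=> w u; apply: (@continuous_comp _ _ _ (fun u => Phi w u - v) Num.norm).
  by apply: cvgB; [exact: cPhi|exact: cvg_cst].
exact: norm_continuous.
Qed.

Lemma hmeas_continuous (phi : H -> H) (f : X -> H) :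
  continuous phi -> hmeas f -> hmeas (fun w => phi (f w)).
Proof.
move=> cphi; apply: (@hmeas_caratheodory (fun _ => phi)) => // v.
exact: hmeas_cst.
Qed.

Lemma hmeasZ (a : R) (f : X -> H) : hmeas f -> hmeas (fun w => a *: f w).
Proof. by apply: hmeas_continuous => v; exact: scaler_continuous. Qed.

Lemma hmeasD (f g : X -> H) : hmeas f -> hmeas g -> hmeas (fun w => f w + g w).
Proof.
move=> mf mg; apply: (@hmeas_caratheodory (fun w u => u + g w)) => //.
  move=> v u; apply: eq_measurable_fun (mg (u - v)) => w _.
  by rewrite opprB addrCA addrA.
by move=> w u; apply: cvgD; [exact: cvg_id|exact: cvg_cst].
Qed.

Lemma hmeasB (f g : X -> H) : hmeas f -> hmeas g -> hmeas (fun w => f w - g w).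
Proof.
move=> mf mg; have := hmeasD mf (hmeasZ (-1) mg).
by rewrite (_ : (fun w => _) = fun w => f w - g w)//; apply/funext => w; rewrite scaleN1r.
Qed.

Lemma hmeas_norm (f : X -> H) : hmeas f -> measurable_fun setT (fun w => `|f w|).
Proof.
by move=> mf; apply: eq_measurable_fun (mf 0) => w _; rewrite subr0.
Qed.

Lemma hmeas_dot (dot : {dot H for idfun}) (f g : X -> H) : hilbert_norm dot ->
  hmeas f -> hmeas g -> measurable_fun setT (fun w => dot (f w) (g w)).
Proof.
move=> hdot mf mg.
rewrite (_ : (fun w => _) = (fun w => 4^-1 *
    (`|f w + g w| ^+ 2 - `|f w - g w| ^+ 2))); last first.
  by apply/funext => w; rewrite !hdot !dotE (dotC (g w) (f w)); field.
apply: measurable_funM; first exact: measurable_cst.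
apply: measurable_funB; apply: measurable_funX; apply: hmeas_norm.
  exact: hmeasD.
exact: hmeasB.
Qed.

End Closure.
End StrongMeasurability.

(** * Scalar expectations *)

Section Mean.
Context {R : realType} {d} {X : measurableType d} (mu : probability X R).
Implicit Types f g : X -> R.

(* The integrals of the statement are lower integrals when the integrand is not
   measurable, and they are still monotone. *)
Lemma ge0_le_integral_ae (f g : X -> \bar R) :
  (forall x, 0 <= f x)%E -> (forall x, 0 <= g x)%E ->
  {ae mu, forall x, (f x <= g x)%E} -> (\int[mu]_x f x <= \int[mu]_x g x)%E.
Proof.
move=> f0 g0 [N [mN muN0 hN]].
rewrite (ge0_integralTE mu f0) (ge0_integralTE mu g0).
apply: ge_ereal_sup => _ [h /= hf <-]; apply: ereal_sup_ubound.
have mN' : measurable (~` N) by exact: measurableC.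
have hE x : proj_nnsfun h mN' x = (h x * \1_(~` N) x)%R by [].
(* Cutting h off on the null set N puts it below g everywhere and leaves its integral unchanged. *)
exists (proj_nnsfun h mN') => /=.
  move=> x; rewrite [X in (X%:E <= _)%E](hE x) indicE.
  have [xN|xN] := boolP (x \in ~` N); last by rewrite mulr0.
  rewrite mulr1 (le_trans (hf x))//; apply: contrapT => fg.
  by move: xN; rewrite inE; apply; apply: hN.
rewrite -!integralT_nnsfun; apply: ge0_ae_eq_integral => //.
- by apply/measurable_EFinP; exact: measurable_funP.
- by apply/measurable_EFinP; exact: measurable_funP.
- by move=> x _; rewrite lee_fin.
- by move=> x _; rewrite lee_fin.
- exists N; split => // x /= hx; apply: contrapT => xN; apply: hx => _.
  by rewrite /= [X in X%:E = _](hE x) indicE mem_set// mulr1.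
Qed.

Lemma ge0_eq_integral_ae (f g : X -> \bar R) :
  (forall x, 0 <= f x)%E -> (forall x, 0 <= g x)%E ->
  {ae mu, forall x, f x = g x} -> (\int[mu]_x f x = \int[mu]_x g x)%E.
Proof.
move=> f0 g0 fg; apply/eqP; rewrite eq_le; apply/andP; split;
  by apply: ge0_le_integral_ae => //; apply: filterS fg => x /= ->.
Qed.

(** Integrability and the finite value travel together, so that linear combinations need no side
    conditions. *)
Definition has_mean f (m : R) :=
  mu.-integrable setT (EFin \o f) /\ (\int[mu]_x (f x)%:E)%E = m%:E.

Lemma has_mean_cst c : has_mean (fun _ => c) c.
Proof.
split; first exact: finite_measure_integrable_cst.
by rewrite integral_cst// [X in (_ * X)%E](_ : _ = 1%E) ?mule1//; exact: probability_setT.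
Qed.

Lemma has_meanD f g m n : has_mean f m -> has_mean g n ->
  has_mean (fun x => f x + g x) (m + n).
Proof.
move=> [fi fm] [gi gn]; split; first exact: (integrableD measurableT fi gi).
under eq_integral do rewrite EFinD.
by rewrite (integralD measurableT fi gi) fm gn.
Qed.

Lemma has_meanZ a f m : has_mean f m -> has_mean (fun x => a * f x) (a * m).
Proof.
move=> [fi fm]; split; first exact: (integrableZl measurableT a fi).
under eq_integral do rewrite EFinM.
by rewrite (integralZl measurableT fi) fm.
Qed.

Lemma eq_has_mean f g m : f =1 g -> has_mean f m -> has_mean g m.
Proof. by move=> /funext ->. Qed.

Lemma has_mean_unique f m n : has_mean f m -> has_mean f n -> m = n.
Proof. by move=> [_ h] [_]; rewrite h => -[]. Qed.

Lemma has_mean_sum (I : Type) (s : seq I) (f : I -> X -> R) (m : I -> R) :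
  (forall i, has_mean (f i) (m i)) ->
  has_mean (fun x => \sum_(i <- s) f i x) (\sum_(i <- s) m i).
Proof.
move=> h; elim: s => [|i s ih].
  by rewrite big_nil; apply: eq_has_mean (has_mean_cst 0) => x; rewrite big_nil.
rewrite big_cons; apply: eq_has_mean (has_meanD (h i) ih) => x.
by rewrite big_cons.
Qed.

Lemma has_mean_indic (E : set X) : measurable E ->
  has_mean (\1_E) (fine (mu E)).
Proof.
move=> mE; split; first exact: integrable_indic.
by rewrite integral_indic// setIT fineK// fin_num_measure.
Qed.

Lemma has_mean_le f g m n : has_mean f m -> has_mean g n ->
  (forall x, f x <= g x) -> m <= n.
Proof.
move=> [fi fm] [gi gn] fg; rewrite -lee_fin -fm -gn.
by apply: le_integral => // x _; rewrite lee_fin.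
Qed.

Lemma has_mean_dominated f g n : measurable_fun setT f -> has_mean g n ->
  (forall x, `|f x| <= g x) -> exists2 m, has_mean f m & `|m| <= n.
Proof.
move=> mf hg fg; have fi : mu.-integrable setT (EFin \o f).
  apply: (le_integrable measurableT _ _ hg.1); first exact/measurable_EFinP.
  by move=> x _ /=; rewrite lee_fin (le_trans (fg x))// ler_norm.
have fm : has_mean f (fine (\int[mu]_x (f x)%:E)).
  by split => //; rewrite fineK//; exact: integrable_fin_num.
exists (fine (\int[mu]_x (f x)%:E)) => //; rewrite ler_norml; apply/andP; split.
  rewrite -mulN1r; apply: (has_mean_le (has_meanZ (-1) hg) fm) => x.
  by rewrite mulN1r lerNl (le_trans _ (fg x))// -normrN ler_norm.
by apply: (has_mean_le fm hg) => x; rewrite (le_trans _ (fg x))// ler_norm.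
Qed.

Lemma ge0_has_mean f (c : \bar R) : measurable_fun setT f ->
  (forall x, 0 <= f x) -> (\int[mu]_x (f x)%:E <= c)%E -> (c < +oo)%E ->
  exists2 m, has_mean f m & (m%:E <= c)%E.
Proof.
move=> mf f0 fc coo; have fi : mu.-integrable setT (EFin \o f).
  apply/integrableP; split; first exact/measurable_EFinP.
  under eq_integral do rewrite /= ger0_norm//.
  exact: le_lt_trans fc coo.
exists (fine (\int[mu]_x (f x)%:E)).
  by split => //; rewrite fineK//; exact: integrable_fin_num.
by rewrite fineK//; exact: integrable_fin_num.
Qed.

End Mean.

(** * Bochner integrals tested against vectors *)

Section BochnerIntegral.
Context {R : realType} {H : completeNormedModType R} (hsep : separable H).
Context (dot : {dot H for idfun}) (hdot : hilbert_norm dot).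
Context {d} {X : measurableType d} (mu : probability X R).

Lemma is_simple_preimage (s : X -> H) (B : set H) :
  is_simple s -> measurable (s @^-1` B).
Proof.
move=> [fs ms].
rewrite (_ : _ @^-1` _ = \bigcup_(v in range s `&` B) s @^-1` [set v]).
  apply: fin_bigcup_measurable => [|v _]; last exact: ms.
  exact: finite_setIl.
apply/seteqP; split => [x Bx|x [v [_ Bv]] /= ->//].
by exists (s x) => //; split => //; exists x.
Qed.

Lemma is_simple_hmeas (s : X -> H) : is_simple s -> hmeas s.
Proof.
move=> hs v _ B mB; rewrite setTI.
exact: (is_simple_preimage [set u | B `|u - v|] hs).
Qed.

Lemma dot_simple_integral (s : X -> H) y : is_simple s ->
  has_mean mu (fun x => dot (s x) y) (dot (simple_integral mu s) y).
Proof.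
move=> [fs ms]; rewrite /simple_integral fsbig_finite//=.
have -> : dot (\sum_(v <- finmap.enum_fset (fset_set (range s))) fine (mu (s @^-1` [set v])) *: v) y
    = \sum_(v <- finmap.enum_fset (fset_set (range s))) dot v y * fine (mu (s @^-1` [set v])).
  elim: (finmap.enum_fset (fset_set (range s))) => [|v r ih]; first by rewrite !big_nil dot0l.
  by rewrite !big_cons dotDl ih dotZl mulrC.
have := has_mean_sum (finmap.enum_fset (fset_set (range s)))
  (fun v => has_meanZ (dot v y) (has_mean_indic mu (ms v))).
apply: eq_has_mean => x /=.
rewrite (bigD1_seq (s x)) ?finmap.fset_uniq//=; last first.
  by rewrite in_fset_set// inE; exists x.
rewrite indicE mem_set// mulr1 big1 ?addr0// => v vs.
by rewrite indicE memNset ?mulr0// => /= sv; rewrite sv eqxx in vs.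
Qed.

(** A Bochner integral is a weak integral: the scalar mean differs from that of the simple function
    s_n by at most |y| times the integral of |f - s_n|. One n with a finite error yields
    integrability, the limit yields the value. *)
Lemma bochner_dot (f : X -> H) v y : hmeas f -> is_bochner_integral mu f v ->
  has_mean mu (fun x => dot (f x) y) (dot v y).
Proof.
move=> mf [s [hs _ Is sv]].
pose I n := (\int[mu]_x (`|f x - s n x|)%:E)%E.
have mfs n : measurable_fun setT (fun x => `|f x - s n x|).
  by apply: hmeas_norm; apply: hmeasB => //; exact: is_simple_hmeas.
have step n : (I n < +oo)%E -> exists2 m, has_mean mu (fun x => dot (f x) y) m &
    `|m - dot (simple_integral mu (s n)) y| <= `|y| * fine (I n).
  move=> In; have [i hi _] := ge0_has_mean (mfs n) (fun x => normr_ge0 _) (lexx _) In.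
  have hb x : `|dot (f x - s n x) y| <= `|y| * `|f x - s n x|.
    by rewrite mulrC; exact: dot_le_normM.
  have md : measurable_fun setT (fun x => dot (f x - s n x) y).
    apply: (hmeas_dot hsep hdot); last exact: hmeas_cst.
    by apply: hmeasB => //; exact: is_simple_hmeas.
  have [m hm mi] := has_mean_dominated md (has_meanZ `|y| hi) hb.
  exists (m + dot (simple_integral mu (s n)) y).
    apply: eq_has_mean (has_meanD hm (dot_simple_integral y (hs n))) => x /=.
    by rewrite -dotDl subrK.
  by rewrite addrK (le_trans mi)// /I hi.2.
have /fine_cvgP[Ifin I0] : I n @[n --> \oo] --> 0%:E by exact: Is.
have [N _ hN] := Ifin.
have [m hm _] : exists2 m, has_mean mu (fun x => dot (f x) y) m & True.
  have [|m hm _] := step N; last by exists m.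
  by rewrite ltey_eq hN//=.
suff -> : dot v y = m by [].
have cs : dot (simple_integral mu (s n)) y @[n --> \oo] --> dot v y.
  by apply: dot_cvg => //; exact: cvg_cst.
apply: (cvg_unique _ cs) => //.
apply/cvgrPdist_le => e e0.
have y1 : 0 < `|y| + 1 by rewrite ltr_wpDl.
near=> n.
have In : I n \is a fin_num by near: n.
have [|m' hm' hle] := step n; first by rewrite ltey_eq In.
rewrite (has_mean_unique hm hm') (le_trans hle)//.
have I0n : `|fine (I n)| <= e / (`|y| + 1).
  by near: n; apply: cvgr0_norm_le => //; rewrite divr_gt0.
move: I0n; rewrite ler_pdivlMr// => h; apply: le_trans h.
rewrite mulrC (@le_trans _ _ (`|fine (I n)| * `|y|))//.
  by rewrite ler_wpM2r// ler_norm.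
by rewrite ler_wpM2l// lerDl.
Unshelve. all: by end_near. Qed.

Lemma is_bochner_integral_unique (f : X -> H) v w : hmeas f ->
  is_bochner_integral mu f v -> is_bochner_integral mu f w -> v = w.
Proof.
move=> mf hv hw; apply: (dot_ext hdot) => y.
exact: has_mean_unique (bochner_dot y mf hv) (bochner_dot y mf hw).
Qed.

Lemma eq_is_bochner_integral (f g : X -> H) v :
  {ae mu, forall x, f x = g x} ->
  is_bochner_integral mu f v -> is_bochner_integral mu g v.
Proof.
move=> fg [s [hs sf Is sv]]; exists s; split => //.
  by apply: filterS2 fg sf => x /= ->.
rewrite (_ : (fun n => _) = (fun n => \int[mu]_x (`|f x - s n x|)%:E)%E)//.
apply/funext => n; apply: ge0_eq_integral_ae => [x|x|]; rewrite ?lee_fin//.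
by apply: filterS fg => x /= ->.
Qed.

Lemma is_bochner_integral_affine (f : X -> H) v (c : H) (r : R) :
  hmeas f -> is_bochner_integral mu f v ->
  is_bochner_integral mu (fun x => c - r *: f x) (c - r *: v).
Proof.
move=> mf [s [hs sf Is sv]]; pose t n x := c - r *: s n x.
have ht n : is_simple (t n).
  split; last first.
    by move=> w; exact: (is_simple_preimage [set u | c - r *: u = w] (hs n)).
  rewrite (_ : range (t n) = (fun u => c - r *: u) @` range (s n)).
    exact: finite_image (hs n).1.
  by rewrite image_comp.
(* Testing against y replaces a reindexing of the sum over the range. *)
have tE n : simple_integral mu (t n) = c - r *: simple_integral mu (s n).
  apply: (dot_ext hdot) => y.
  apply: (has_mean_unique (dot_simple_integral y (ht n))).
  rewrite !dotE.
  have := has_meanD (has_mean_cst mu (dot c y))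
    (has_meanZ (- r) (dot_simple_integral y (hs n))).
  rewrite mulNr; apply: eq_has_mean => x.
  by rewrite /t !dotE mulNr.
exists t; split => //.
- apply: filterS sf => x /= hx.
  by apply: cvgB; [exact: cvg_cst|apply: cvgZr].
- rewrite (_ : (fun n => _) = (fun n => `|r|%:E * \int[mu]_x (`|f x - s n x|)%:E)%E).
    by rewrite -(mule0 `|r|%:E); apply: cvgeZl.
  apply/funext => n; rewrite -ge0_integralZl//=.
  + apply: eq_integral => x _; rewrite -EFinM -normrZ -[in RHS]normrN; congr (`|_|%:E).
    by apply: (dot_ext hdot) => y; rewrite /t !dotE; ring.
  + apply/measurable_EFinP; apply: hmeas_norm; apply: hmeasB => //.
    exact: is_simple_hmeas.
- under eq_fun do rewrite tE.
  by apply: cvgB; [exact: cvg_cst|apply: cvgZr].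
Qed.

End BochnerIntegral.

(** * Supermartingales *)

Lemma limn_einf_ge {R : realType} (u : nat -> \bar R) (m : \bar R) :
  (\forall n \near \oo, m <= u n)%E -> (m <= limn_einf u)%E.
Proof.
move=> [N _ hN]; rewrite limn_einf_lim (cvg_lim _ (@cvg_einfs_sup _ u))//.
apply: (@le_trans _ _ (einfs u N)); last by apply: ereal_sup_ubound; exists N.
by apply: le_ereal_inf_tmp => _ [k /= Nk <-]; exact: hN.
Qed.

Lemma ae_forall_count {R : realType} {d} {Omega : measurableType d}
    (P : probability Omega R) (I : countType) (Q : I -> Omega -> Prop) :
  (forall i, {ae P, forall w, Q i w}) -> {ae P, forall w, forall i, Q i w}.
Proof.
move=> h.
have : {ae P, forall w, forall n, if unpickle n is Some i then Q i w else True}.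
  apply: ae_foralln => n.
  by case: (unpickle n) => [i|]; [exact: h|exact: aeW].
by apply: filterS => w hw i; have := hw (pickle i); rewrite pickleK.
Qed.

Section Supermartingale.
Context {R : realType} {d} {Omega : measurableType d} (P : probability Omega R).

Definition adapted (G : set (set Omega)) {d'} {Y : measurableType d'}
    (f : Omega -> Y) :=
  @measurable_fun _ _ (g_sigma_algebraType G) Y setT f.

Lemma adapted_measurable (G : set (set Omega)) d' (Y : measurableType d')
    (f : Omega -> Y) : <<s G >> `<=` measurable -> adapted G f ->
  measurable_fun setT f.
Proof. by move=> hG hf _ B mB; apply: hG; exact: hf. Qed.

(** By Fatou's lemma the lower limit has a finite integral, hence is finite almost everywhere; M is
    any integer above it. *)
Lemma ae_not_near_ge (Y : nat -> Omega -> R) (C : R) :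
  (forall n, measurable_fun setT (Y n)) -> (forall n w, 0 <= Y n w) ->
  (forall n, (\int[P]_w (Y n w)%:E <= C%:E)%E) ->
  {ae P, forall w, exists M : nat, ~ \forall n \near \oo, M%:R <= Y n w}.
Proof.
move=> mY Y0 YC.
pose g w := limn_einf (fun n => (Y n w)%:E).
have g0 w : (0 <= g w)%E by apply: limn_einf_ge; near=> n; rewrite lee_fin.
have mYe n : measurable_fun setT (fun w => (Y n w)%:E) by exact/measurable_EFinP.
have gC : (\int[P]_w g w <= C%:E)%E.
  apply: (le_trans (fatou P measurableT mYe _)); first by move=> n w _; rewrite lee_fin.
  rewrite limn_einf_lim; apply: lime_le; first exact: is_cvg_einfs.
  near=> n; apply: (@le_trans _ _ (\int[P]_w (Y n w)%:E)%E) => //.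
  by apply: ereal_inf_lbound; exists n => /=.
have mg : measurable_fun setT g.
  apply: (measurableT_comp (oppe_measurable (D := setT))); apply: measurable_fun_limn_esup => n.
  exact: (measurableT_comp (oppe_measurable (D := setT))).
have gi : P.-integrable setT g.
  apply/integrableP; split => //; under eq_integral do rewrite gee0_abs//.
  by rewrite (le_lt_trans gC)// ltry.
apply: filterS (integrable_ae measurableT gi) => w /(_ I) gw.
exists (Num.truncn (fine (g w))).+1 => hn.
have : ((Num.truncn (fine (g w))).+1%:R%:E <= g w)%E.
  by apply: limn_einf_ge; apply: filterS hn => n; rewrite lee_fin.
rewrite -(fineK gw) lee_fin leNgt; apply/negP; rewrite negbK.
exact: truncnS_gt.
Unshelve. all: by end_near. Qed.

Context (G : nat -> set (set Omega)).
Context (Gmeas : forall k, <<s G k >> `<=` measurable).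
Context (Gincr : forall k, <<s G k >> `<=` <<s G k.+1 >>).

Lemma adapted_succ k d' (Y : measurableType d') (f : Omega -> Y) :
  adapted (G k) f -> adapted (G k.+1) f.
Proof. by move=> hf mT B mB; apply: Gincr; exact: hf. Qed.

(** Conditional expectations are avoided: the inequality is integrated over each event of the past,
    given by its indicator [e]. *)
Definition supermartingale (V : nat -> Omega -> R) :=
  [/\ forall k, adapted (G k) (V k), forall k w, 0 <= V k w &
      forall k (e : Omega -> bool), adapted (G k) e ->
        (\int[P]_w (if e w then V k.+1 w else 0)%:E <=
         \int[P]_w (if e w then V k w else 0)%:E)%E].

Lemma supermartingale_le (V : nat -> Omega -> R) k : supermartingale V ->
  (\int[P]_w (V k w)%:E <= \int[P]_w (V 0%N w)%:E)%E.
Proof.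
move=> [_ _ h]; elim: k => // k; apply: le_trans.
by apply: (h k (fun _ => true)); exact: measurable_cst.
Qed.

Section Upcrossing.
Context (V : nat -> Omega -> R) (hV : supermartingale V).
Context (a b : R) (a0 : 0 <= a) (ab : a < b).

(* [wait_up V k w] : at time k, the path has been below a since it was last
   above b, so that an upcrossing of [a, b] is in progress. *)
Fixpoint wait_up k w : bool :=
  if k is j.+1 then
    if wait_up j w then V j.+1 w <= b else V j.+1 w < a
  else V 0%N w < a.

Fixpoint upcrossings k w : nat :=
  if k is j.+1 then
    upcrossings j w + (wait_up j w && ~~ wait_up j.+1 w)
  else 0%N.

(** The wealth of a player who starts with a and stakes it on each passage from below a to above b;
    its mean stays at most a, so (b - a) times the mean number of upcrossings is at most a. *)
Let Q k w := (b - a) * (upcrossings k w)%:R + (if wait_up k w then V k w else a).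

Let wait_up_adapted k : adapted (G k) (wait_up k).
Proof.
have [hA _ _] := hV.
elim: k => [|k ih] /=.
  by apply: measurable_fun_ltr; [exact: hA|exact: measurable_cst].
apply: measurable_fun_ifT; first exact: adapted_succ.
  by apply: measurable_fun_ler; [exact: hA|exact: measurable_cst].
by apply: measurable_fun_ltr; [exact: hA|exact: measurable_cst].
Qed.

Let upcrossings_measurable k :
  measurable_fun setT (fun w => (upcrossings k w)%:R : R).
Proof.
elim: k => [|k ih] /=; first exact: measurable_cst.
have mw j : measurable_fun setT (wait_up j).
  exact: adapted_measurable (@Gmeas j) (@wait_up_adapted j).
rewrite (_ : (fun w => _) = (fun w => (upcrossings k w)%:R +
    (if wait_up k w && ~~ wait_up k.+1 w then 1 else 0))); last first.
  by apply/funext => w; rewrite natrD; case: (_ && _).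
apply: measurable_funD => //; apply: measurable_fun_ifT => //.
apply: measurable_and => //; exact: measurable_neg.
Qed.

Let V_measurable k : measurable_fun setT (V k).
Proof. have [hA _ _] := hV; exact: adapted_measurable (@Gmeas k) (hA k). Qed.

Let Q_ge0 k w : 0 <= Q k w.
Proof.
have [_ V0 _] := hV; rewrite addr_ge0//; last by case: ifP.
by rewrite mulr_ge0// subr_ge0 ltW.
Qed.

Let Q_le k : (\int[P]_w (Q k w)%:E <= a%:E)%E.
Proof.
have [hA V0 hS] := hV.
have ba : 0 <= b - a by rewrite subr_ge0 ltW.
have mw j : measurable_fun setT (wait_up j).
  exact: adapted_measurable (@Gmeas j) (@wait_up_adapted j).
elim: k => [|k]; last apply: le_trans.
  rewrite (@le_trans _ _ (\int[P]_w a%:E)%E)//; last first.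
    by rewrite (has_mean_cst P a).2.
  apply: ge0_le_integral_ae => [w|w|]; rewrite ?lee_fin//.
  apply: aeW => w; rewrite lee_fin /Q /= mulr0 add0r.
  by case: ifP => // /ltW.
pose g w := (b - a) * (upcrossings k w)%:R + (if wait_up k w then 0 else a).
have g0 w : 0 <= g w by rewrite addr_ge0//; [rewrite mulr_ge0|case: ifP].
have mg : measurable_fun setT g.
  apply: measurable_funD; first by apply: measurable_funM.
  by apply: measurable_fun_ifT.
have splitI (W : Omega -> R) : measurable_fun setT W -> (forall w, 0 <= W w) ->
   (\int[P]_w (g w + (if wait_up k w then W w else 0))%:E =
    \int[P]_w (g w)%:E + \int[P]_w (if wait_up k w then W w else 0)%:E)%E.
  move=> mW W0; under eq_integral do rewrite EFinD.
  apply: ge0_integralD => //.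
  - by move=> w _; rewrite lee_fin.
  - exact/measurable_EFinP.
  - by move=> w _; rewrite lee_fin; case: ifP.
  - by apply/measurable_EFinP; apply: measurable_fun_ifT.
(* If an upcrossing ends at k + 1, the count gains b - a and the reserve is a again: a total of b,
   below V at k + 1. If one starts there, V is below the reserve a. *)
apply: (@le_trans _ _
    (\int[P]_w (g w + (if wait_up k w then V k.+1 w else 0))%:E)%E).
  apply: ge0_le_integral_ae => [w|w|]; rewrite ?lee_fin//.
    by rewrite addr_ge0//; case: ifP.
  apply: aeW => w; rewrite lee_fin /Q /g /= natrD.
  case: (wait_up k w) => /=.
    have [Vb|Vb] := leP (V k.+1 w) b; rewrite /= ?addr0//.
    by rewrite mulrDr mulr1 -addrA lerD2l subrK ltW.
  by rewrite !addr0 lerD2l; case: ifP => // /ltW.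
rewrite splitI// (@le_trans _ _ (\int[P]_w (g w)%:E +
    \int[P]_w (if wait_up k w then V k w else 0)%:E)%E)//.
  by rewrite leeD2l// hS.
rewrite -splitI//; apply: ge0_le_integral_ae => [w|w|]; rewrite ?lee_fin//.
  by rewrite addr_ge0//; case: ifP.
apply: aeW => w; rewrite lee_fin /Q /g.
by case: ifP; rewrite ?addr0.
Qed.

(** Once the count is constant, an upcrossing in progress never ends, so the path stays at most b;
    if none is ever in progress, it never goes below a. *)
Lemma upcrossing_dichotomy_path w (N : nat) :
  (forall n, (N <= n)%N -> upcrossings n w = upcrossings N w) ->
  (\forall n \near \oo, V n w <= b) \/ (\forall n \near \oo, a <= V n w).
Proof.
move=> hN.
have hc n : (N <= n)%N -> wait_up n w -> wait_up n.+1 w.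
  move=> Nn wn; have := hN n.+1 (leqW Nn); rewrite -(hN n Nn) /= wn.
  by move=> /eqP; rewrite -[X in _ == X]addn0 eqn_add2l /= eqb0 negbK.
have [[k Nk wk]|hno] := pselect (exists2 k, (N <= k)%N & wait_up k w); [left|right].
  have hall j : wait_up (k + j) w.
    by elim: j => [|j ih]; rewrite ?addn0// addnS; apply: hc => //; rewrite (leq_trans Nk)// leq_addr.
  exists k.+1 => // n /= kn.
  have := hall (n - k)%N; rewrite subnKC 1?ltnW//.
  case: n kn => // n kn /=.
  by have := hall (n - k)%N; rewrite subnKC// => ->.
exists N.+1 => // n /= Nn; rewrite leNgt; apply/negP => Vn; apply: hno.
exists n; first exact: ltnW.
case: n Nn Vn => // n Nn Vn /=; case: ifP => // _.
by rewrite ltW// (lt_trans Vn).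
Qed.

Lemma upcrossing_dichotomy :
  {ae P, forall w, (\forall n \near \oo, V n w <= b) \/
                   (\forall n \near \oo, a <= V n w)}.
Proof.
have [_ V0 _] := hV.
have ba : 0 < b - a by rewrite subr_gt0.
have mU n : measurable_fun setT (fun w => (b - a) * (upcrossings n w)%:R).
  by apply: measurable_funM => //; exact: measurable_cst.
have U0 n w : 0 <= (b - a) * (upcrossings n w)%:R by rewrite mulr_ge0// ltW.
have h n : (\int[P]_w ((b - a) * (upcrossings n w)%:R)%:E <= a%:E)%E.
  apply: le_trans (Q_le n); apply: ge0_le_integral_ae => [w|w|].
  - by rewrite lee_fin.
  - by rewrite lee_fin.
  - by apply: aeW => w; rewrite lee_fin /Q lerDl; case: ifP.
apply: filterS (ae_not_near_ge mU U0 h) => w [M hM].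
have Umono m n : (m <= n)%N -> (upcrossings m w <= upcrossings n w)%N.
  by elim: n => [|n ih]; rewrite leq_eqVlt => /predU1P[->//|//]; rewrite ltnS => /ih /leq_trans; apply; rewrite /= leq_addr.
have [N hN] : exists N, forall n, (upcrossings n w <= upcrossings N w)%N.
  pose B := Num.truncn (M%:R / (b - a)).
  have UB n : (upcrossings n w <= B)%N.
    rewrite leqNgt; apply/negP => Bn; apply: hM; exists n => // m /= nm.
    rewrite mulrC -ler_pdivrMr//.
    have : M%:R / (b - a) < B.+1%:R by exact: truncnS_gt.
    move=> /ltW /le_trans; apply; rewrite ler_nat.
    exact: leq_trans Bn (Umono _ _ nm).
  pose p u := `[< exists n, upcrossings n w = u >].
  have p0 : exists u, p u by exists (upcrossings 0%N w); apply/asboolP; exists 0%N.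
  have pB u : p u -> (u <= B)%N by move=> /asboolP[n <-]; exact: UB.
  case: (ex_maxnP p0 pB) => u /asboolP[N <-] hu; exists N => n.
  by apply: hu; apply/asboolP; exists n.
apply: (@upcrossing_dichotomy_path w N) => n Nn; apply/eqP.
by rewrite eqn_leq hN Umono.
Qed.

End Upcrossing.

Theorem supermartingale_cvg (V : nat -> Omega -> R) : supermartingale V ->
  (\int[P]_w (V 0%N w)%:E < +oo)%E -> {ae P, forall w, cvgn (V ^~ w)}.
Proof.
move=> hV V0oo; have [hA V0 _] := hV.
have mV k : measurable_fun setT (V k) := adapted_measurable (@Gmeas k) (hA k).
have C0 : (\int[P]_w (V 0%N w)%:E)%E \is a fin_num.
  by rewrite ge0_fin_numE//; apply: integral_ge0 => w _; rewrite lee_fin.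
have hle n : (\int[P]_w (V n w)%:E <= (fine (\int[P]_w (V 0%N w)%:E))%:E)%E.
  by rewrite fineK//; exact: supermartingale_le.
(* One exceptional null set must serve all levels, so only countably many pairs of levels are
   treated at once. *)
have hrat : {ae P, forall w, forall q : rat * rat,
    0 <= (ratr q.1 : R) -> (ratr q.1 : R) < ratr q.2 ->
    (\forall n \near \oo, V n w <= ratr q.2) \/
    (\forall n \near \oo, ratr q.1 <= V n w)}.
  apply: ae_forall_count => q.
  have [q0|q0] := pselect (0 <= (ratr q.1 : R) /\ (ratr q.1 : R) < ratr q.2).
    by apply: filterS (upcrossing_dichotomy hV q0.1 q0.2).
  by apply: aeW => w h1 h2; case: q0.
apply: filterS2 hrat (ae_not_near_ge mV V0 hle) => w hq [M hM].
have hab (a b : R) : 0 <= a -> a < b -> (\forall n \near \oo, V n w <= b) \/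
    (\forall n \near \oo, a <= V n w).
  move=> a0 ab; have [q1 /andP[aq1 q1b]] := rat_in_itvoo ab.
  have [q2 /andP[q12 q2b]] := rat_in_itvoo q1b.
  have [|//|h|h] := hq (q1, q2) => /=; first exact: le_trans a0 (ltW aq1).
    by left; apply: filterS h => n /le_trans; apply; exact: ltW.
  by right; apply: filterS h => n; apply: le_trans; exact: ltW.
pose S := [set a | \forall n \near \oo, a <= V n w].
have S0 : S 0 by exists 0%N => // n _; exact: V0.
(* Of the alternatives at the levels M and M + 1, staying above M is excluded by the choice of M. *)
have [B hB] : exists B, \forall n \near \oo, V n w <= B.
  have [h|h] := hab M%:R (M%:R + 1) (ler0n _ _) (ltr_pwDr ltr01 (lexx _)).
    by exists (M%:R + 1).
  by [].
have Sub : has_sup S.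
  split; first by exists 0.
  exists B => a Sa; have [n []] := filter_ex (filterI hB Sa).
  by move=> /[swap]; exact: le_trans.
apply/cvg_ex; exists (sup S); apply/cvgrPdist_le => e e0.
have h1 : \forall n \near \oo, sup S - e <= V n w.
  have [a Sa ha] := sup_adherent e0 Sub.
  by apply: filterS Sa => n; apply: le_trans; exact: ltW.
(* Between the levels sup S + e/2 and sup S + e, the other alternative would put sup S + e/2 into
   S. *)
have h2 : \forall n \near \oo, V n w <= sup S + e.
  have s0 : 0 <= sup S by apply: ub_le_sup => //; exact: Sub.2.
  have [| |//|h] := hab (sup S + e / 2) (sup S + e).
  - by rewrite addr_ge0// divr_ge0// ltW.
  - by rewrite ltrD2l gtr_pMr// invf_lt1// ltr1n.
  - have : sup S + e / 2 <= sup S by apply: ub_le_sup => //; exact: Sub.2.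
    by rewrite gerDl leNgt divr_gt0.
near=> n; rewrite ler_distlC; apply/andP; split; near: n => //.
Unshelve. all: by end_near. Qed.

End Supermartingale.

(** * Independence *)

Section Freezing.
Context {R : realType} {d} {Omega : measurableType d} (P : probability Omega R).
Context {dX} {Xi : measurableType dX}.

(** P restricted to F and c P are finite measures that agree on a pi-system containing the whole
    space. *)
Lemma independent_sigma (G : set (set Omega)) (F : set Omega) (c : R) :
  0 <= c -> setI_closed G -> G setT -> G `<=` measurable -> measurable F ->
  (forall E, G E -> P (E `&` F) = (P E * c%:E)%E) ->
  forall E, <<s G >> E -> P (E `&` F) = (P E * c%:E)%E.
Proof.
move=> c0 GI GT Gm mF hG E GE.
pose m1 := mrestr P mF; pose m2 := mscale (NngNum c0) P.
have -> : (P E * c%:E)%E = m2 E by rewrite /m2 /mscale /= muleC.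
have -> : P (E `&` F) = m1 E by [].
apply: (@g_sigma_algebra_measure_unique _ _ _ G Gm (fun _ => setT)) => //.
- by rewrite bigcup_const.
- by move=> A /hG; rewrite /m2 /mscale /= /m1 /mrestr muleC.
- move=> _; have : (P (setT `&` F) < +oo)%E by rewrite setTI ltey_eq fin_num_measure.
  by [].
Qed.

Context (G : set (set Omega)) (Gmeas : <<s G >> `<=` measurable).

(* Conditionally on G, a random variable independent of G can be integrated out
   by freezing the G-measurable variables. *)
Lemma freezing (D : probability Xi R) (xi : {RV P >-> Xi})
    (Phi : Omega * Xi -> R) :
  (forall E B, <<s G >> E -> measurable B ->
     P (E `&` xi @^-1` B) = (P E * D B)%E) ->
  measurable_fun (setT : set (g_sigma_algebraType G * Xi)) Phi ->
  (forall p, 0 <= Phi p) ->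
  (\int[P]_w (Phi (w, xi w))%:E = \int[P]_w \int[D]_z (Phi (w, z))%:E)%E.
Proof.
move=> hind mPhi Phi0.
(* The identity into Omega with the sigma-algebra of G represents the past as a random variable.
   Independence makes the law of (past, xi) a product measure, to which Tonelli's theorem
   applies. *)
have midG : measurable_fun setT (idfun : Omega -> g_sigma_algebraType G).
  by move=> _ B mB; rewrite setTI; exact: Gmeas.
pose idG : {mfun Omega >-> g_sigma_algebraType G} :=
  HB.pack idfun (isMeasurableFun.Build _ _ _ _ _ midG).
have mpair : measurable_fun setT
    (fun w => (w, xi w) : g_sigma_algebraType G * Xi).
  by apply: measurable_fun_pair => //; exact: measurable_funP.
pose pair : {mfun Omega >-> (g_sigma_algebraType G * Xi)%type} :=
  HB.pack (fun w : Omega => (w, xi w)) (isMeasurableFun.Build _ _ _ _ _ mpair).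
have mPhiE : measurable_fun (setT : set (g_sigma_algebraType G * Xi)) (EFin \o Phi).
  exact/measurable_EFinP.
have -> : (\int[P]_w (Phi (w, xi w))%:E)%E =
    (\int[distribution P pair]_p (EFin \o Phi) p)%E.
  by rewrite ge0_integral_pushforward// => p _; rewrite /= lee_fin.
transitivity (\int[(distribution P idG \x D)%E]_p (EFin \o Phi) p)%E.
  apply: eq_measure_integral => E mE _.
  apply/esym/(@product_measure_unique _ _ _ _ _ (distribution P idG) D)=> //.
rewrite fubini_tonelli1//.
rewrite ge0_integral_pushforward//.
- exact: measurable_fun_fubini_tonelli_F.
- by move=> w _; apply: integral_ge0 => z _; rewrite lee_fin.
Qed.

End Freezing.

Section IID.
Context {R : realType} {d} {Omega : measurableType d} (P : probability Omega R).
Context {dX} {Xi : measurableType dX} (D : probability Xi R).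
Context (xi : nat -> {RV P >-> Xi}) (hxi : iid D xi).

(* A pi-system generating the sigma-algebra of xi_0, ..., xi_{k-1}. *)
Definition history k : set (set Omega) :=
  [set E | exists B : nat -> set Xi, (forall i, measurable (B i)) /\
     E = \bigcap_(i in [set i | (i < k)%N]) xi i @^-1` B i].

Lemma xi_preimage i (B : set Xi) : measurable B -> measurable (xi i @^-1` B).
Proof. by move=> mB; exact: measurable_funPTI. Qed.

Lemma history_setI k : setI_closed (history k).
Proof.
move=> _ _ [B [mB ->]] [B' [mB' ->]]; exists (fun i => B i `&` B' i).
by split=> [i|]; [exact: measurableI|rewrite -bigcapI].
Qed.

Lemma history_setT k : history k setT.
Proof.
exists (fun _ => setT); split => //.
by apply/esym; rewrite -subTset => w _ i _.
Qed.

Lemma history_measurable k : history k `<=` measurable.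
Proof.
move=> _ [B [mB ->]]; apply: bigcap_measurableType => i _.
exact: xi_preimage.
Qed.

Lemma history_sigma_measurable k : <<s history k >> `<=` measurable.
Proof.
apply: smallest_sub; last exact: history_measurable.
exact: sigma_algebra_measurable.
Qed.

Lemma history_incr k : <<s history k >> `<=` <<s history k.+1 >>.
Proof.
apply: sub_sigma_algebra2 => _ [B [mB ->]].
exists (fun i => if (i < k)%N then B i else setT); split.
  by move=> i; case: ifP.
apply/seteqP; split => w hw i /= ik.
  by case: ifP => // ik'; exact: hw.
by have := hw i (leqW ik); rewrite ik.
Qed.

Lemma xi_adapted k : adapted (history k.+1) (xi k).
Proof.
move=> _ B mB; rewrite setTI; apply: sub_sigma_algebra.
exists (fun i => if i == k then B else setT); split.
  by move=> i; case: ifP.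
apply/seteqP; split => [w hw i /= ik|w hw].
  by case: eqP => // ->.
by have := hw k (ltnSn k); rewrite eqxx.
Qed.

(** On cylinders this is the product formula with B appended at index k; the pi-system argument
    extends it. *)
Lemma history_independent k E B : <<s history k >> E -> measurable B ->
  P (E `&` xi k @^-1` B) = (P E * D B)%E.
Proof.
move=> hE mB; have [hD hprod] := hxi.
have DB : D B \is a fin_num by rewrite fin_num_measure.
rewrite -(fineK DB); apply: (independent_sigma (G := history k)) => //.
- exact: fine_ge0.
- exact: history_setI.
- exact: history_setT.
- exact: history_measurable.
- exact: xi_preimage.
move=> _ [B' [mB' ->]]; rewrite fineK//.
have setE n : [set` iota 0 n] = [set i | (i < n)%N].
  by apply/seteqP; split => i /=; rewrite mem_iota.
pose B1 i := if i == k then B else B' i.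
have mB1 i : measurable (B1 i) by rewrite /B1; case: ifP.
have := hprod (iota 0 k.+1) B1 (iota_uniq _ _) mB1.
have := hprod (iota 0 k) B' (iota_uniq _ _) mB'.
rewrite !setE => ->.
have B1k : B1 k = B by rewrite /B1 eqxx.
rewrite -addn1 iotaD big_cat/= big_seq1 add0n B1k.
have -> : P (xi k @^-1` B) = D B by exact: hD.
rewrite (_ : \bigcap_(i in _) _ =
  (\bigcap_(i in [set i | (i < k)%N]) xi i @^-1` B' i) `&` xi k @^-1` B).
  move=> ->; congr (_ * _)%E; apply: eq_big_seq => i.
  by rewrite mem_iota add0n /B1 => /andP[_ ik]; rewrite ltn_eqF.
apply/seteqP; split => w.
  move=> hw; split=> [i /= ik|].
    by have := hw i (ltn_addr 1 ik); rewrite /B1 ltn_eqF.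
  have : (k < k + 1)%N by rewrite addn1.
  by move=> /(hw k); rewrite /B1 eqxx.
move=> [hw hk] i /=; rewrite addn1 ltnS leq_eqVlt => /predU1P[->|ik].
  by rewrite /B1 eqxx.
by rewrite /B1 ltn_eqF//; exact: hw.
Qed.

Lemma history_sigma_of k : <<s history k >> `<=` sigma_of xi.
Proof.
apply: smallest_sub; first exact: smallest_sigma_algebra.
move=> _ [B [mB ->]].
apply: (@bigcap_measurableType _ (g_sigma_algebraType
  (\bigcup_k preimage_set_system setT (xi k) measurable))) => i _.
apply: sub_sigma_algebra; exists i => //; exists (B i) => //.
by rewrite setTI.
Qed.

(** A function of the past and of xi_k is known at time k + 1; this carries adaptedness through the
    recursion. *)
Lemma history_xi_measurable d' (Y : measurableType d') k
    (f : Omega * Xi -> Y) :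
  measurable_fun (setT : set (g_sigma_algebraType (history k) * Xi)) f ->
  adapted (history k.+1) (fun w => f (w, xi k w)).
Proof.
move=> mf.
have mp : measurable_fun (setT : set (g_sigma_algebraType (history k.+1)))
    (fun w => (w, xi k w) : g_sigma_algebraType (history k) * Xi).
  apply: measurable_fun_pair; last exact: xi_adapted.
  by move=> _ B mB; rewrite setTI; exact: history_incr.
exact: (measurableT_comp mf mp).
Qed.

End IID.

(** * Expectations at an independent random index *)

Section RandomIndex.
Context {R : realType} {d} {Omega : measurableType d} (P : probability Omega R).
Context {dX} {Xi : measurableType dX} (D : probability Xi R).
Context (xi : nat -> {RV P >-> Xi}) (hxi : iid D xi).

Lemma sigma_of_measurable : sigma_of xi `<=` measurable.
Proof.
apply: smallest_sub; first exact: sigma_algebra_measurable.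
move=> _ [k _ [B mB <-]]; rewrite setTI; exact: xi_preimage.
Qed.

Lemma integral_random_index (lam : nat -> R) (K : nat) (N : {RV P >-> nat})
    (r : nat -> Omega -> R) :
  random_index lam K xi N -> (forall k w, 0 <= r k w) ->
  (forall k, adapted (history xi k) (r k)) ->
  (\int[P]_w (r (N w) w)%:E = \sum_(k < K)
    (index_weight lam k / \sum_(j < K) index_weight lam j)%:E *
    \int[P]_w (r k w)%:E)%E.
Proof.
move=> [NK PN hind] r0 ar.
have mr k : measurable_fun setT (r k).
  exact: adapted_measurable (@history_sigma_measurable _ _ _ P _ _ xi k) (@ar k).
have -> : (\int[P]_w (r (N w) w)%:E =
    \int[P]_w \sum_(k < K) (r k w * \1_[set nat_of_ord k] (N w))%:E)%E.
  apply: eq_integral => w _; rewrite sumEFin; congr EFin.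
  rewrite (bigD1 (Ordinal (NK w)))//= indicE mem_set// mulr1 big1 ?addr0//.
  move=> i iN; rewrite indicE memNset ?mulr0// => /= Ni.
  by move/eqP: iN; apply; apply/val_inj.
have mN k : measurable_fun setT (fun w => \1_[set k] (N w) : R).
  apply: (measurableT_comp (measurable_indic _)) => //.
rewrite ge0_integral_sum//; last 2 first.
- by move=> k; apply/measurable_EFinP; apply: measurable_funM.
- by move=> k w _; rewrite lee_fin mulr_ge0.
apply: eq_bigr => k _.
pose G := \bigcup_k preimage_set_system setT (xi k) measurable.
have ark : adapted G (r k).
  by move=> _ B mB; apply: (@history_sigma_of _ _ _ P _ _ xi k); exact: ar.
transitivity (\int[P]_w \int[distribution P N]_n (r k w * \1_[set nat_of_ord k] n)%:E)%E.
  apply: (freezing (G := G) sigma_of_measurable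
     (Phi := fun p => r k p.1 * \1_[set nat_of_ord k] p.2)).
  - move=> E B hE mB; rewrite setIC hind// muleC.
    by rewrite /distribution /pushforward.
  - apply: measurable_funM.
      by apply: (measurableT_comp _ measurable_fst); exact: ark.
    by apply: (measurableT_comp _ measurable_snd); exact: measurable_indic.
  - by move=> p; rewrite mulr_ge0.
rewrite -ge0_integralZl//=.
- apply: eq_integral => w _; under eq_integral do rewrite EFinM.
  rewrite ge0_integralZl_EFin//=.
  + rewrite integral_indic// setIT muleC; congr (_ * _)%E.
    by apply: PN.
- exact/measurable_EFinP.
- by move=> w _; rewrite lee_fin.
- by rewrite -(PN k (ltn_ord k)).
Qed.

End RandomIndex.

(** * The stochastic Krasnoselskii-Mann iteration *)

Section StochasticStep.
Context {R : realType} {H : completeNormedModType R} (hsep : separable H).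
Context (dot : {dot H for idfun}) (hdot : hilbert_norm dot).
Context {dX} {Xi : measurableType dX} (D : probability Xi R).
Context (Tz : Xi -> H -> H) (T : H -> H).

(* Under the last clause T is the expectation of Tz, in the weak sense. *)
Definition random_nonexpansive :=
  [/\ forall z, nonexpansive (Tz z), nonexpansive T,
      forall x, hmeas (Tz ^~ x) &
      forall x y, has_mean D (fun z => dot (Tz z x) y) (dot (T x) y)].

Context (hTz : random_nonexpansive).

Definition noise (z : Xi) (x : H) := Tz z x - T x.

Definition variance_le (p : H) (v : R) :=
  (\int[D]_z (`|noise z p| ^+ 2)%:E <= v%:E)%E.

Lemma hmeas_noise x : hmeas (noise ^~ x).
Proof.
have [_ _ mTz _] := hTz; apply: hmeasB => //; exact: hmeas_cst.
Qed.

Lemma measurable_sqr_norm d (X : measurableType d) (f : X -> H) : hmeas f ->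
  measurable_fun setT (fun w => `|f w| ^+ 2).
Proof. by move=> mf; apply: measurable_funX; exact: hmeas_norm. Qed.

Lemma noise_mean0 x y : has_mean D (fun z => dot (noise z x) y) 0.
Proof.
have [_ _ _ hm] := hTz; rewrite -(subrr (dot (T x) y)).
apply: eq_has_mean (has_meanD (hm x y) (has_mean_cst D (- dot (T x) y))) => z.
by rewrite /noise dotDl dotNl.
Qed.

(* The variance at x is compared to that at p through
   T_z x - T_z p, which has norm at most |x - p|. *)
Lemma noise_variance p v x : variance_le p v ->
  exists2 m, has_mean D (fun z => `|noise z x| ^+ 2) m &
             0 <= m <= 2 * `|x - p| ^+ 2 + 2 * v.
Proof.
move=> hv; have [nTz _ _ _] := hTz.
have [vp hvp vpv] := ge0_has_mean (measurable_sqr_norm (hmeas_noise p))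
  (fun z => sqr_ge0 _) hv (ltry _).
rewrite lee_fin in vpv.
pose q := T x - T p.
(* Expanding |T_z x - T_z p|^2 around its mean q shows that only terms linear in the noise are
   added. They have mean zero, so the constants remain 2. *)
have hb z : `| `|noise z x| ^+ 2 | <= 2 * `|noise z p| ^+ 2 +
    (2 * `|x - p| ^+ 2 + (-4) * (dot (noise z x) q + (-1) * dot (noise z p) q)).
  rewrite ger0_norm ?sqr_ge0//.
  have h1 : `|noise z x| ^+ 2 <= 2 * `|noise z p| ^+ 2 +
      2 * `|noise z x - noise z p| ^+ 2.
    by rewrite -{1}(subrKC (noise z p) (noise z x)); exact: sqr_normD_le.
  have h2 : `|Tz z x - Tz z p| ^+ 2 <= `|x - p| ^+ 2.
    by rewrite ler_pXn2r ?nnegrE//; exact: nTz.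
  have h3 : Tz z x - Tz z p = (noise z x - noise z p) + q.
    by apply: (dot_ext hdot) => y; rewrite /noise /q !dotE; ring.
  have h4 := dot_ge0 hdot q.
  apply: (le_trans h1); rewrite -subr_ge0; move: h2; rewrite h3 !hdot.
  move: (noise z x) (noise z p) (q) h4 => a b c h4.
  by rewrite !dotE (dotC b a) (dotC c a) (dotC c b); lra.
have hmean := has_meanD (has_meanZ 2 hvp) (has_meanD (has_mean_cst D (2 * `|x - p| ^+ 2))
  (has_meanZ (-4) (has_meanD (noise_mean0 x q) (has_meanZ (-1) (noise_mean0 p q))))).
have [m hm mle] := has_mean_dominated (measurable_sqr_norm (hmeas_noise x)) hmean hb.
exists m => //; rewrite (has_mean_le (has_mean_cst D 0) hm)//=.
by rewrite (le_trans (ler_norm _))// (le_trans mle)//; lra.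
Qed.

(** The cross term vanishes because the noise is centred. *)
Lemma step_mean p v x (y : H) (l : R) : variance_le p v ->
  exists2 m, has_mean D (fun z => `|y + l *: noise z x| ^+ 2) m &
             m <= `|y| ^+ 2 + l ^+ 2 * (2 * `|x - p| ^+ 2 + 2 * v).
Proof.
move=> hv; have [n hn /andP[n0 nle]] := noise_variance x hv.
exists (`|y| ^+ 2 + (2 * l * 0 + l ^+ 2 * n)); last first.
  by rewrite mulr0 add0r lerD2l ler_wpM2l// sqr_ge0.
have := has_meanD (has_mean_cst D (`|y| ^+ 2))
  (has_meanD (has_meanZ (2 * l) (noise_mean0 x y)) (has_meanZ (l ^+ 2) hn)).
apply: eq_has_mean => z; rewrite !hdot; move: (noise z x) => e.
by rewrite !dotE (dotC y e); ring.
Qed.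

Lemma iterate_mean p v x (l : R) : variance_le p v -> T p = p -> 0 <= l ->
  exists2 m, has_mean D (fun z => `|(1 - l) *: x + l *: Tz z x - p| ^+ 2) m &
    m <= (1 + 2 * l ^+ 2) * (`|x - p| ^+ 2 + v) - v -
         l * (1 - l) * `|T x - x| ^+ 2.
Proof.
move=> hv Tp l0; have [_ nT _ _] := hTz.
have [m hm mle] := step_mean x (x + l *: (T x - x) - p) l hv.
exists m.
  apply: eq_has_mean hm => z; congr (`|_| ^+ 2).
  by apply: (dot_ext hdot) => y; rewrite /noise !dotE; ring.
have := km_step hdot nT x Tp l0.
by move: mle; lra.
Qed.

(** Bounding (1 - l)^2 by 1 - l leaves a decrement l |u|^2. *)
Lemma noise_average_mean p v x (u : H) (l : R) :
  variance_le p v -> 0 <= l <= 1 ->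
  exists2 m, has_mean D (fun z => `|(1 - l) *: u + l *: noise z x| ^+ 2) m &
    m <= (1 - l) * `|u| ^+ 2 + l ^+ 2 * (2 * `|x - p| ^+ 2 + 2 * v).
Proof.
move=> hv /andP[l0 l1]; have [m hm mle] := step_mean x ((1 - l) *: u) l hv.
exists m => //; apply: (le_trans mle); rewrite lerD2r normrZ exprMn.
rewrite ler_wpM2r ?sqr_ge0// ger0_norm ?subr_ge0// expr2 ler_piMr ?subr_ge0//.
by rewrite gerBl.
Qed.

End StochasticStep.

(** * The iteration as an adapted process, and its supermartingales *)

Section StochasticProcess.
Context {R : realType} {H : completeNormedModType R} (hsep : separable H).
Context (dot : {dot H for idfun}) (hdot : hilbert_norm dot).
Context {dX} {Xi : measurableType dX} (D : probability Xi R).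
Context (Tz : Xi -> H -> H) (T : H -> H) (hTz : random_nonexpansive dot D Tz T).
Context (lam : nat -> R) (hlam : forall k, 0 < lam k < 1) (x0 : H).

Fixpoint skm (z : nat -> Xi) k : H :=
  if k is j.+1 then
    (1 - lam j) *: skm z j + lam j *: Tz (z j) (skm z j)
  else x0.

(* The average of the noise accumulated since time m: subtracting it from the
   iterates turns the stochastic iteration into an inexact deterministic one. *)
Fixpoint noise_average m (z : nat -> Xi) k : H :=
  if k is j.+1 then
    if (j < m)%N then 0 else
    (1 - lam j) *: noise_average m z j + lam j *: noise Tz T (z j) (skm z j)
  else 0.

Context {d} {Omega : measurableType d} (P : probability Omega R).
Context (xi : nat -> {RV P >-> Xi}) (hxi : iid D xi).

Let F k := g_sigma_algebraType (history xi k).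
Let x k (w : Omega) := skm (fun i => xi i w) k.
Let u m k (w : Omega) := noise_average m (fun i => xi i w) k.

Let lam0 k : 0 <= lam k. Proof. by have /andP[/ltW] := hlam k. Qed.
Let lam1 k : 0 <= 1 - lam k.
Proof. by rewrite subr_ge0; have /andP[_ /ltW] := hlam k. Qed.

(** The step as a function of the pair (past, fresh sample), the form in which freezing applies. *)
Let xnext k (p : F k * Xi) := (1 - lam k) *: x k p.1 + lam k *: Tz p.2 (x k p.1).
Let unext m k (p : F k * Xi) := if (k < m)%N then 0 else
  (1 - lam k) *: u m k p.1 + lam k *: noise Tz T p.2 (x k p.1).

Let hmeas_succ k (f : F k * Xi -> H) : hmeas f ->
  hmeas (fun w : F k.+1 => f (w, xi k w)).
Proof. by move=> mf v; exact: (history_xi_measurable (@mf v)). Qed.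

Let hmeas_next k : hmeas (x k : F k -> H) -> hmeas (@xnext k).
Proof.
have [nTz _ mTz _] := hTz => mx.
have mx1 : hmeas (fun p : F k * Xi => x k p.1).
  exact: (hmeas_comp mx measurable_fst).
apply: hmeasD => //; apply: hmeasZ => //.
apply: (hmeas_caratheodory hsep (Phi := fun p : F k * Xi => Tz p.2)) => //.
- move=> v; exact: (hmeas_comp (mTz v) measurable_snd).
- by move=> p; apply: nonexpansive_continuous; exact: nTz.
Qed.

Lemma hmeas_skm k : hmeas (x k : F k -> H).
Proof.
elim: k => [|k ih]; first exact: hmeas_cst.
exact: (hmeas_succ (hmeas_next ih)).
Qed.

Let hmeas_unext m k : hmeas (u m k : F k -> H) -> hmeas (@unext m k).
Proof.
have [nTz nT mTz _] := hTz => mu.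
have [km|km] := boolP (k < m)%N.
  rewrite (_ : @unext m k = fun _ => 0); first exact: hmeas_cst.
  by apply/funext => q; rewrite /unext km.
rewrite (_ : @unext m k = fun q => (1 - lam k) *: u m k q.1 +
    lam k *: noise Tz T q.2 (x k q.1)); last first.
  by apply/funext => q; rewrite /unext (negbTE km).
have mx1 : hmeas (fun p : F k * Xi => x k p.1).
  exact: (hmeas_comp (@hmeas_skm k) measurable_fst).
apply: hmeasD => //; apply: hmeasZ => //.
  exact: (hmeas_comp mu measurable_fst).
apply: hmeasB => //; last first.
  by apply: hmeas_continuous => //; exact: nonexpansive_continuous.
apply: (hmeas_caratheodory hsep (Phi := fun p : F k * Xi => Tz p.2)) => //.
- move=> v; exact: (hmeas_comp (mTz v) measurable_snd).
- by move=> p; apply: nonexpansive_continuous; exact: nTz.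
Qed.

Lemma hmeas_noise_average m k : hmeas (u m k : F k -> H).
Proof.
elim: k => [|k ih]; first exact: hmeas_cst.
exact: (hmeas_succ (hmeas_unext ih)).
Qed.

(** It turns a bound on the mean over the fresh sample, with the past frozen, into the inequality
    required of a supermartingale. *)
Lemma conditional_le k (Phi : F k * Xi -> R) (B : Omega -> R) (e : Omega -> bool) :
  measurable_fun setT Phi -> (forall p, 0 <= Phi p) ->
  (forall w, exists2 m, has_mean D (fun z => Phi (w, z)) m & m <= B w) ->
  adapted (history xi k) e ->
  (\int[P]_w (if e w then Phi (w, xi k w) else 0)%:E <=
   \int[P]_w (if e w then B w else 0)%:E)%E.
Proof.
move=> mPhi Phi0 hB me.
have B0 w : 0 <= B w.
  have [m hm] := hB w; apply: le_trans.
  exact: has_mean_le (has_mean_cst D 0) hm _.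
rewrite (freezing (@history_sigma_measurable _ _ _ P _ _ xi k)
  (D := D) (Phi := fun p => if e p.1 then Phi p else 0)).
- apply: ge0_le_integral_ae => [w|w|].
  + by apply: integral_ge0 => z _; rewrite lee_fin; case: ifP.
  + by rewrite lee_fin; case: ifP.
  + apply: aeW => w /=; case: ifP => ew.
      by have [m [_ ->]] := hB w; rewrite lee_fin.
    by rewrite integral0.
- by move=> E B'; exact: history_independent.
- apply: measurable_fun_ifT => //.
  by apply: (measurableT_comp _ measurable_fst); exact: me.
- by move=> p; case: ifP.
Qed.

(* The Robbins-Siegmund argument: v turns the additive error into a
   multiplicative one, which is then absorbed by the discount factor. *)
Definition discount (a : R) k : R := \prod_(i < k) (1 + a * lam i ^+ 2)^-1.

Lemma discount_gt0 a k : 0 <= a -> 0 < discount a k.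
Proof.
move=> a0; apply: prodr_gt0 => i _.
by rewrite invr_gt0 ltr_wpDr// mulr_ge0 ?sqr_ge0.
Qed.

Lemma discountS a k : 0 <= a ->
  discount a k.+1 * (1 + a * lam k ^+ 2) = discount a k.
Proof.
move=> a0; rewrite /discount big_ord_recr/= divfK// gt_eqF//.
by rewrite ltr_wpDr// mulr_ge0 ?sqr_ge0.
Qed.

Section RobbinsSiegmund.
Context (a v : R) (a0 : 0 <= a) (v0 : 0 <= v).
Context (Psi rho : nat -> Omega -> R).
Context (aPsi : forall k, adapted (history xi k) (Psi k))
        (arho : forall k, adapted (history xi k) (rho k))
        (Psi0 : forall k w, 0 <= Psi k w) (rho0 : forall k w, 0 <= rho k w).
Context (Phi : forall k, F k * Xi -> R)
  (PhiE : forall k w, Psi k.+1 w = @Phi k (w, xi k w))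
  (mPhi : forall k, measurable_fun (setT : set (F k * Xi)) (@Phi k))
  (Phi0 : forall k p, 0 <= @Phi k p)
  (hstep : forall k w, exists2 m, has_mean D (fun z => @Phi k (w, z)) m &
     m <= (1 + a * lam k ^+ 2) * (Psi k w + v) - v - rho k w).

Let S k w := \sum_(j < k) discount a j.+1 * rho j w.

Let adapted_sum k j : (j <= k)%N -> adapted (history xi k) (S j).
Proof.
move=> jk.
have up i (f : Omega -> R) : (i <= k)%N -> adapted (history xi i) f ->
    adapted (history xi k) f.
  move=> ik hf; elim: k ik {jk} => [|k ih].
    by rewrite leqn0 => /eqP <-.
  rewrite leq_eqVlt => /predU1P[<-//|]; rewrite ltnS => /ih h.
  exact: (adapted_succ (@history_incr _ _ _ P _ _ xi) h).
apply: (@measurable_sum _ (F k)) => i.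
apply: measurable_funM; first exact: measurable_cst.
by apply: (up i); [rewrite (leq_trans _ jk)// ltnW|exact: arho].
Qed.

Let S0 k w : 0 <= S k w.
Proof.
by apply: sumr_ge0 => j _; rewrite mulr_ge0// ltW// discount_gt0.
Qed.

Lemma robbins_siegmund :
  supermartingale P (history xi) (fun k w => discount a k * (Psi k w + v)) /\
  supermartingale P (history xi) (fun k w => discount a k * (Psi k w + v) +
    \sum_(j < k) discount a j.+1 * rho j w).
Proof.
have d0 k : 0 < discount a k by exact: discount_gt0.
(* The constant q is 0 for the first supermartingale and the accumulated sum, known at time k, for
   the second. *)
have inner (q : R) k w : exists2 m,
    has_mean D (fun z => discount a k.+1 * (@Phi k (w, z) + v) + q) m &
    m <= discount a k * (Psi k w + v) - discount a k.+1 * rho k w + q.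
  have [m hm mle] := @hstep k w.
  exists (discount a k.+1 * (m + v) + q).
    exact: has_meanD (has_meanZ _ (has_meanD hm (has_mean_cst D v))) (has_mean_cst D q).
  rewrite lerD2r -(discountS k a0) -mulrA -mulrBr ler_pM2l//.
  by move: mle; lra.
split; split.
- move=> k; apply: measurable_funM; first exact: measurable_cst.
  by apply: measurable_funD; [exact: aPsi|exact: measurable_cst].
- by move=> k w; rewrite mulr_ge0 ?addr_ge0// ltW.
- move=> k e me; under eq_integral do rewrite PhiE.
  apply: (conditional_le (Phi := fun p => discount a k.+1 * (Phi p + v))) => //.
  + apply: measurable_funM; first exact: measurable_cst.
    by apply: measurable_funD; [exact: mPhi|exact: measurable_cst].
  + by move=> p; rewrite mulr_ge0 ?addr_ge0// ltW.
  + move=> w; have [m hm mle] := inner 0 k w; exists m.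
      by apply: eq_has_mean hm => z; rewrite addr0.
    by rewrite (le_trans mle)// addr0 gerBl mulr_ge0// ltW.
- move=> k; apply: measurable_funD; last exact: adapted_sum.
  apply: measurable_funM; first exact: measurable_cst.
  by apply: measurable_funD; [exact: aPsi|exact: measurable_cst].
- by move=> k w; rewrite addr_ge0//; [rewrite mulr_ge0 ?addr_ge0// ltW|exact: S0].
- move=> k e me; under eq_integral do rewrite PhiE big_ord_recr/=.
  apply: (conditional_le (Phi := fun p => discount a k.+1 * (Phi p + v) +
    (S k p.1 + discount a k.+1 * rho k p.1))) => //.
  + apply: measurable_funD.
      apply: measurable_funM; first exact: measurable_cst.
      by apply: measurable_funD; [exact: mPhi|exact: measurable_cst].
    apply: measurable_funD.
      by apply: (measurableT_comp _ measurable_fst); exact: adapted_sum.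
    apply: measurable_funM; first exact: measurable_cst.
    by apply: (measurableT_comp _ measurable_fst); exact: arho.
  + move=> p; rewrite addr_ge0//; first by rewrite mulr_ge0 ?addr_ge0// ltW.
    by rewrite addr_ge0// mulr_ge0// ltW.
  + move=> w; have [m hm mle] := inner (S k w + discount a k.+1 * rho k w) k w.
    by exists m => //; move: mle; rewrite /S; lra.
Qed.

End RobbinsSiegmund.

Context (p : H) (v : R) (Tp : T p = p) (v0 : 0 <= v)
  (hv : variance_le D Tz T p v).

Let r2 k w := `|T (x k w) - x k w| ^+ 2.

Lemma adapted_residual k : adapted (history xi k) (r2 k).
Proof.
have [_ nT _ _] := hTz.
apply: (@measurable_sqr_norm _ _ _ (F k)); apply: hmeasB => //; last exact: hmeas_skm.
by apply: hmeas_continuous; [|exact: nonexpansive_continuous|exact: hmeas_skm].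
Qed.

Let adapted_dist k : adapted (history xi k) (fun w => `|x k w - p| ^+ 2).
Proof.
apply: (@measurable_sqr_norm _ _ _ (F k)); apply: hmeasB => //.
by exact: hmeas_skm.
Qed.

Lemma skm_supermartingales :
  supermartingale P (history xi)
    (fun k w => discount 2 k * (`|x k w - p| ^+ 2 + v)) /\
  supermartingale P (history xi)
    (fun k w => discount 2 k * (`|x k w - p| ^+ 2 + v) +
       \sum_(j < k) discount 2 j.+1 * (lam j * (1 - lam j) * r2 j w)).
Proof.
apply: (@robbins_siegmund 2 v (ler0n _ _) v0 (fun k w => `|x k w - p| ^+ 2)
  (fun k w => lam k * (1 - lam k) * r2 k w) _ _ _ _
  (fun k q => `|@xnext k q - p| ^+ 2)) => //.
- by move=> k; apply: measurable_funM; [exact: measurable_cst|exact: adapted_residual].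
- by move=> k w; rewrite mulr_ge0 ?sqr_ge0// mulr_ge0.
- move=> k; apply: measurable_sqr_norm; apply: hmeasB => //.
  by apply: hmeas_next; exact: hmeas_skm.
- by move=> k w; exact: (iterate_mean hsep hdot hTz (x k w) hv Tp (lam0 k)).
Qed.

(** The iterate and the noise average each contribute an error 2 lambda^2 (|x - p|^2 + v), hence the
    discount 4. *)
Lemma skm_noise_supermartingales m :
  supermartingale P (history xi)
    (fun k w => discount 4 k * (`|x k w - p| ^+ 2 + `|u m k w| ^+ 2 + v)) /\
  supermartingale P (history xi)
    (fun k w => discount 4 k * (`|x k w - p| ^+ 2 + `|u m k w| ^+ 2 + v) +
       \sum_(j < k) discount 4 j.+1 *
         (lam j * (1 - lam j) * r2 j w + lam j * `|u m j w| ^+ 2)).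
Proof.
have au k : adapted (history xi k) (fun w => `|u m k w| ^+ 2).
  by apply: (@measurable_sqr_norm _ _ _ (F k)); exact: hmeas_noise_average.
apply: (@robbins_siegmund 4 v (ler0n _ _) v0
  (fun k w => `|x k w - p| ^+ 2 + `|u m k w| ^+ 2)
  (fun k w => lam k * (1 - lam k) * r2 k w + lam k * `|u m k w| ^+ 2) _ _ _ _
  (fun k q => `|@xnext k q - p| ^+ 2 + `|@unext m k q| ^+ 2)) => //.
- by move=> k; apply: measurable_funD; [exact: adapted_dist|exact: au].
- move=> k; apply: measurable_funD; apply: measurable_funM; try exact: measurable_cst.
    exact: adapted_residual.
  exact: au.
- by move=> k w; rewrite addr_ge0 ?mulr_ge0 ?sqr_ge0.
- move=> k; apply: measurable_funD; apply: measurable_sqr_norm.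
    apply: hmeasB => //.
    by apply: hmeas_next; exact: hmeas_skm.
  by apply: hmeas_unext; exact: hmeas_noise_average.
- move=> k w.
  have [m1 h1 le1] := iterate_mean hsep hdot hTz (x k w) hv Tp (lam0 k).
  have hl : 0 <= lam k <= 1 by rewrite lam0 -subr_ge0 lam1.
  have [m2 h2 le2] := noise_average_mean hsep hdot hTz (x k w) (u m k w) hv hl.
  have rest : 0 <= (1 - lam k) * `|u m k w| ^+ 2 +
      lam k ^+ 2 * (2 * `|x k w - p| ^+ 2 + 2 * v).
    by rewrite addr_ge0// mulr_ge0 ?sqr_ge0// addr_ge0// mulr_ge0.
  have l4 := mulr_ge0 (sqr_ge0 (lam k)) (sqr_ge0 `|u m k w|).
  have lv := mulr_ge0 (sqr_ge0 (lam k)) v0.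
  have [km|km] := boolP (k < m)%N.
    exists (m1 + 0).
      apply: eq_has_mean (has_meanD h1 (has_mean_cst D 0)) => z.
      by rewrite /unext km normr0 expr0n.
    by move: le1 rest; rewrite /r2; lra.
  exists (m1 + m2).
    by apply: eq_has_mean (has_meanD h1 h2) => z; rewrite /unext (negbTE km).
  by move: le1 le2; rewrite /r2; lra.
Qed.

Lemma noise_average_le m k : (m <= k)%N ->
  (\int[P]_w (`|u m k.+1 w| ^+ 2)%:E <=
   \int[P]_w ((1 - lam k) * `|u m k w| ^+ 2 +
              lam k ^+ 2 * (2 * `|x k w - p| ^+ 2 + 2 * v))%:E)%E.
Proof.
move=> mk; have kmF : (k < m)%N = false by rewrite ltnNge mk.
apply: (@conditional_le k (fun q => `|@unext m k q| ^+ 2) _ (fun _ => true)).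
- by apply: measurable_sqr_norm; apply: hmeas_unext; exact: hmeas_noise_average.
- by move=> q; exact: sqr_ge0.
- move=> w; have hl : 0 <= lam k <= 1 by rewrite lam0 -subr_ge0 lam1.
  have [n hn nle] := noise_average_mean hsep hdot hTz (x k w) (u m k w) hv hl.
  by exists n => //; apply: eq_has_mean hn => z; rewrite /unext kmF.
- exact: measurable_cst.
Qed.

End StochasticProcess.

(** * Bounds on the expected squared residual *)

Section ExpectedResidual.
Context {R : realType} {H : completeNormedModType R} (hsep : separable H).
Context (dot : {dot H for idfun}) (hdot : hilbert_norm dot).
Context {dX} {Xi : measurableType dX} (D : probability Xi R).
Context (Tz : Xi -> H -> H) (T : H -> H) (hTz : random_nonexpansive dot D Tz T).
Context (lam : nat -> R) (hlam : forall k, 0 < lam k < 1) (x0 : H).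
Context {d} {Omega : measurableType d} (P : probability Omega R).
Context (xi : nat -> {RV P >-> Xi}) (hxi : iid D xi).
Context (p : H) (v : R) (Tp : T p = p) (v0 : 0 <= v)
  (hv : variance_le D Tz T p v).

Let x k (w : Omega) := skm Tz lam x0 (fun i => xi i w) k.
Let u m k (w : Omega) := noise_average Tz T lam x0 m (fun i => xi i w) k.
Let r2 k w := `|T (x k w) - x k w| ^+ 2.
Let B := `|x0 - p| ^+ 2 + v.

Let hist_meas k (Y : Omega -> R) : adapted (history xi k) Y -> measurable_fun setT Y.
Proof. exact: adapted_measurable (@history_sigma_measurable _ _ _ P _ _ xi k). Qed.

Let lam0 k : 0 < lam k. Proof. by have /andP[] := hlam k. Qed.
Let lam1 k : 0 < 1 - lam k.
Proof. by rewrite subr_gt0; have /andP[] := hlam k. Qed.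

Let B0 : 0 <= B. Proof. by rewrite addr_ge0 ?sqr_ge0. Qed.

Let weight_ge0 k : 0 <= index_weight lam k.
Proof.
have L0 : 0 < Lambda lam k.+1 by exact: (discount_gt0 lam _ (ler0n _ 2)).
by rewrite /index_weight !mulr_ge0// ltW.
Qed.

Lemma mean_sqr_dist k : exists2 m,
  has_mean P (fun w => `|x k w - p| ^+ 2) m & Lambda lam k * (m + v) <= B.
Proof.
have [hS _] := skm_supermartingales hsep hdot hTz hlam x0 hxi Tp v0 hv.
have [aV V0 _] := hS; have L0 : 0 < Lambda lam k by exact: (discount_gt0 lam k (ler0n _ 2)).
have := supermartingale_le k hS; rewrite /= /discount big_ord0 mul1r.
rewrite (has_mean_cst P _).2 => h.
have [m hm mB] := ge0_has_mean (hist_meas (@aV k)) (V0 k) h (ltry _).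
exists ((Lambda lam k)^-1 * m - v).
  apply: eq_has_mean (has_meanD (has_meanZ (Lambda lam k)^-1 hm) (has_mean_cst P (- v))) => w.
  by rewrite mulrA mulVf ?gt_eqF// mul1r addrK.
by rewrite subrK mulVKf ?gt_eqF// -lee_fin.
Qed.

Let measurable_r2 k : measurable_fun setT (r2 k).
Proof. by apply: (@hist_meas k); exact: (adapted_residual hsep hTz). Qed.

Lemma residual_dist_le k w : r2 k w <= 4 * `|x k w - p| ^+ 2.
Proof.
have [_ nT _ _] := hTz.
have -> : (4 : R) = 2 ^+ 2 by rewrite -natrX.
rewrite -exprMn ler_pXn2r ?nnegrE ?mulr_ge0//.
have -> : T (x k w) - x k w = (T (x k w) - p) - (x k w - p).
  by apply: (dot_ext hdot) => y; rewrite !dotE; ring.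
rewrite (le_trans (ler_normB _ _))// mulr_natl mulr2n lerD2r.
by rewrite -{1}Tp nT.
Qed.

Lemma mean_residual k : exists m, has_mean P (r2 k) m.
Proof.
have [m hm _] := mean_sqr_dist k.
have [|n hn _] := has_mean_dominated (measurable_r2 k) (has_meanZ 4 hm).
  by move=> w; rewrite ger0_norm ?sqr_ge0// residual_dist_le.
by exists n.
Qed.

(** The weights defining N_K are exactly the coefficients of the decrements in the discounted
    supermartingale, whose initial value is B. *)
Lemma weighted_mean_residual (a : nat -> R) K :
  (forall k, has_mean P (r2 k) (a k)) ->
  \sum_(k < K) index_weight lam k * a k <= B.
Proof.
move=> ha; have [_ hS] := skm_supermartingales hsep hdot hTz hlam x0 hxi Tp v0 hv.
have [aV V0 _] := hS.
have := supermartingale_le K hS; rewrite [X in (_ <= X)%E](_ : _ = B%:E); last first.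
  rewrite -(has_mean_cst P B).2; apply: eq_integral => w _.
  by rewrite /discount !big_ord0 mul1r addr0.
move=> h.
have [m hm mB] := ge0_has_mean (hist_meas (@aV K)) (V0 K) h (ltry _).
rewrite lee_fin in mB; apply: le_trans mB.
apply: (has_mean_le (has_mean_sum (index_enum 'I_K) (fun i => has_meanZ (index_weight lam i) (ha i))) hm) => w.
rewrite [leRHS](_ : _ = Lambda lam K * (`|x K w - p| ^+ 2 + v) +
   \sum_(i < K) index_weight lam i * r2 i w); last first.
  congr (_ + _); apply: eq_bigr => i _.
  by rewrite /index_weight -!mulrA.
rewrite lerDr mulr_ge0 ?addr_ge0 ?sqr_ge0// ltW//.
exact: (discount_gt0 lam K (ler0n _ 2)).
Qed.

(** In x - u the noise cancels, which leaves (1 - lambda) (x - u) + lambda T x; [residual_step] then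
    applies with |x - z| = |u|. *)
Lemma corrected_residual_step m k w : (m <= k)%N ->
  `|T (x k.+1 w - u m k.+1 w) - (x k.+1 w - u m k.+1 w)| ^+ 2 <=
  `|T (x k w - u m k w) - (x k w - u m k w)| ^+ 2 +
  lam k / (1 - lam k) * `|u m k w| ^+ 2.
Proof.
have [_ nT _ _] := hTz; move=> mk.
have -> : x k.+1 w - u m k.+1 w =
    (1 - lam k) *: (x k w - u m k w) + lam k *: T (x k w).
  rewrite /x /u /= ltnNge mk /=.
  by apply: (dot_ext hdot) => y; rewrite /noise !dotE; ring.
apply: (le_trans (residual_step hdot nT _ _ (hlam k))).
by rewrite lerD2l opprB addrCA subrr addr0.
Qed.

Let noise_average0 m w : u m m w = 0.
Proof. by rewrite /u; case: m => [//|j] /=; rewrite ltnSn. Qed.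

Section LastIterate.
Context (m K : nat) (b S2 : R) (b1 : b < 1).
Context (hb : forall i, (m <= i < K)%N -> lam i <= b).
Context (hS2 : forall i q, (i < K)%N ->
  has_mean P (fun w => `|x i w - p| ^+ 2) q -> 2 * q + 2 * v <= S2).

Let measurable_u k : measurable_fun setT (fun w => `|u m k w| ^+ 2).
Proof.
apply: measurable_sqr_norm => y.
by apply: (@hist_meas k); apply: (hmeas_noise_average hsep hTz).
Qed.

(** The bound reproduces itself: (1 - lambda) b S2 + lambda^2 S2 <= b S2 as lambda <= b. It is
    claimed only for m < k because the sign of b * S2 is unknown when m = K. *)
Lemma mean_noise_average k : (m <= k <= K)%N -> exists2 q,
  has_mean P (fun w => `|u m k w| ^+ 2) q & (m < k)%N -> q <= b * S2.
Proof.
elim: k => [|k ih] /andP[mk kK].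
  exists 0 => //; apply: eq_has_mean (has_mean_cst P 0) => w.
  by rewrite /u /= normr0 expr0n.
move: mk; rewrite leq_eqVlt => /predU1P[->|]; last rewrite ltnS => mk.
  exists 0; last by rewrite ltnn.
  apply: eq_has_mean (has_mean_cst P 0) => w.
  by rewrite /u /= ltnSn normr0 expr0n.
have [q hq qb] := ih (introT andP (conj mk (ltnW kK))).
have [e he _] := mean_sqr_dist k.
have hmean := has_meanD (has_meanZ (1 - lam k) hq)
  (has_meanZ (lam k ^+ 2) (has_meanD (has_meanZ 2 he) (has_mean_cst P (2 * v)))).
have := noise_average_le hsep hdot hTz hlam x0 hxi hv mk.
rewrite hmean.2 => hle.
have [q' hq' q'le] := ge0_has_mean (measurable_u k.+1) (fun w => sqr_ge0 _) hle (ltry _).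
exists q' => // _; rewrite lee_fin in q'le; apply: (le_trans q'le).
have S20 : 0 <= S2.
  apply: le_trans (hS2 kK he); rewrite addr_ge0// mulr_ge0//.
  exact: has_mean_le (has_mean_cst P 0) he (fun w => sqr_ge0 _).
have lb : lam k <= b by apply: hb; rewrite mk.
have bS : 0 <= b * S2 by rewrite mulr_ge0// (le_trans (ltW (lam0 k))).
have h1 : (1 - lam k) * q <= (1 - lam k) * (b * S2).
  rewrite ler_wpM2l ?(ltW (lam1 k))//.
  move: mk; rewrite leq_eqVlt => /predU1P[mk|/qb//].
  suff -> : q = 0 by [].
  apply: (has_mean_unique hq); apply: eq_has_mean (has_mean_cst P 0) => w.
  rewrite /u -mk; case: (m) => [|j] /=; first by rewrite normr0 expr0n.
  by rewrite ltnSn normr0 expr0n.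
have h2 : lam k ^+ 2 * (2 * e + 2 * v) <= lam k * (b * S2).
  rewrite expr2 -mulrA ler_wpM2l ?(ltW (lam0 k))//.
  apply: (@le_trans _ _ (lam k * S2)).
    by rewrite ler_wpM2l ?(ltW (lam0 k))//; exact: hS2 kK he.
  by rewrite ler_wpM2r.
by lra.
Qed.

Lemma residual_corrected k w : (m <= k)%N ->
  `|T (x k w - u m k w) - (x k w - u m k w)| ^+ 2 <=
  r2 m w + \sum_(m <= i < k) lam i / (1 - lam i) * `|u m i w| ^+ 2.
Proof.
move=> /subnKC <-; elim: (k - m)%N => [|j ih].
  by rewrite addn0 big_geq// noise_average0 subr0 addr0.
rewrite addnS; set n := (m + j)%N in ih *; have mn : (m <= n)%N by exact: leq_addr.
rewrite big_nat_recr//= addrA.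
by apply: (le_trans (corrected_residual_step _ mn)); rewrite lerD2r.
Qed.

Lemma last_iterate am aK : (m < K)%N -> has_mean P (r2 m) am -> has_mean P (r2 K) aK ->
  aK <= 2 * am + (2 * (K - m)%:R * b / (1 - b) + 8) * (b * S2).
Proof.
move=> mltK ham haK; have [_ nT _ _] := hTz; have mK := ltnW mltK.
have b0 : 0 < b.
  by apply: lt_le_trans (lam0 m) _; apply: hb; rewrite leqnn.
have S20 : 0 <= S2.
  have [e he _] := mean_sqr_dist m.
  apply: le_trans (hS2 mltK he); rewrite addr_ge0// mulr_ge0//.
  exact: has_mean_le (has_mean_cst P 0) he (fun w => sqr_ge0 _).
have bS : 0 <= b * S2 by rewrite mulr_ge0// ltW.
have /choice[q hq] i : exists q, (m <= i <= K)%N ->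
    has_mean P (fun w => `|u m i w| ^+ 2) q /\ q <= b * S2.
  have [iK|iK] := boolP (m <= i <= K)%N; last by exists 0.
  have [q hq qle] := mean_noise_average iK; exists q => _; split => //.
  move: iK => /andP[]; rewrite leq_eqVlt => /predU1P[mi _|/qle//].
  suff -> : q = 0 by [].
  apply: (has_mean_unique hq); apply: eq_has_mean (has_mean_cst P 0) => w.
  by rewrite -mi noise_average0 normr0 expr0n.
pose t i := if (m <= i < K)%N then b / (1 - b) else 0.
have hsum : has_mean P (fun w => \sum_(m <= i < K) t i * `|u m i w| ^+ 2)
    (\sum_(m <= i < K) t i * q i).
  apply: has_mean_sum => i; rewrite /t; case: ifP => iK; last first.
    by rewrite mul0r; apply: eq_has_mean (has_mean_cst P 0) => w; rewrite mul0r.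
  apply: has_meanZ; apply: (hq i _).1.
  by move: iK => /andP[-> /ltnW].
have hK := (hq K (introT andP (conj mK (leqnn K)))).
have hmean := has_meanD (has_meanZ 2 (has_meanD ham hsum)) (has_meanZ 8 hK.1).
have hle : aK <= 2 * (am + \sum_(m <= i < K) t i * q i) + 8 * q K.
  apply: (has_mean_le haK hmean) => w.
  have h3 := residual_perturbation hdot nT (x K w - u m K w) (- u m K w).
  rewrite opprK subrK normrN in h3.
  have h4 := residual_corrected w mK.
  have h5 : \sum_(m <= i < K) lam i / (1 - lam i) * `|u m i w| ^+ 2 <=
      \sum_(m <= i < K) t i * `|u m i w| ^+ 2.
    apply: ler_sum_nat => i iK; rewrite ler_wpM2r ?sqr_ge0// /t iK.
    have lb := hb iK; rewrite ler_pM// ?invr_ge0 ?(ltW (lam0 _)) ?(ltW (lam1 _))//.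
    by rewrite lef_pV2 ?posrE ?lam1 ?subr_gt0// lerD2l lerN2.
  by apply: (le_trans h3); move: h4 h5; lra.
apply: (le_trans hle).
have h6 : \sum_(m <= i < K) t i * q i <= (K - m)%:R * (b / (1 - b) * (b * S2)).
  rewrite mulr_natl -sumr_const_nat; apply: ler_sum_nat => i iK.
  rewrite /t iK ler_wpM2l//; first by rewrite divr_ge0 ?(ltW b0)// subr_ge0 ltW.
  by apply: (hq i _).2; move: iK => /andP[-> /ltnW].
have := hK.2; move: h6; set s := \sum_(m <= i < K) _ => h6 h7.
have -> : (2 * (K - m)%:R * b / (1 - b) + 8) * (b * S2) =
  2 * ((K - m)%:R * (b / (1 - b) * (b * S2))) + 8 * (b * S2) by ring.
lra.
Qed.

End LastIterate.

(** By [last_iterate] from each start j in [m, K), every mean [a j] is at least (aK - err) / 2.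
    Their weighted sum is at most B and each weight is at least c0 al (1 - b). *)
Lemma last_iterate_average (m K : nat) (al b c0 aK : R) :
  (m < K)%N -> b < 1 -> 0 < al -> 0 < c0 ->
  (forall i, (m <= i < K)%N -> al <= lam i <= b) ->
  (forall k, (k <= K)%N -> c0 <= Lambda lam k) ->
  has_mean P (r2 K) aK ->
  aK <= (2 * (K - m)%:R * b / (1 - b) + 8) * (b * (2 * B / c0)) +
        2 * B / ((K - m)%:R * (c0 * al * (1 - b))).
Proof.
move=> mK b1 al0 c00 hl hc haK.
set err := _ * (b * _).
have b0 : 0 < b.
  have /andP[h1 h2] : al <= lam m <= b by apply: hl; rewrite leqnn.
  exact: lt_le_trans al0 (le_trans h1 h2).
have b10 : 0 < 1 - b by rewrite subr_gt0.
have Km0 : 0 < (K - m)%:R :> R by rewrite ltr0n subn_gt0.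
have q0 : 0 < c0 * al * (1 - b) by rewrite !mulr_gt0.
have [a ha] : exists a, forall k, has_mean P (r2 k) (a k).
  by have /choice[a ha] := mean_residual; exists a.
have hS2 i q : (i < K)%N -> has_mean P (fun w => `|x i w - p| ^+ 2) q ->
    2 * q + 2 * v <= 2 * B / c0.
  move=> iK hq; have [q' hq' hB] := mean_sqr_dist i.
  rewrite (has_mean_unique hq hq') ler_pdivlMr// -mulrDr -mulrA ler_pM2l//.
  apply: le_trans hB; rewrite mulrC ler_wpM2r ?hc ?(ltnW iK)//.
  rewrite addr_ge0//.
  exact: has_mean_le (has_mean_cst P 0) hq' (fun w => sqr_ge0 _).
have hstep j : (m <= j < K)%N -> aK <= 2 * a j + err.
  move=> /andP[mj jK].
  have hb i : (j <= i < K)%N -> lam i <= b.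
    by move=> /andP[ji iK]; have /andP[] := hl i (introT andP (conj (leq_trans mj ji) iK)).
  apply: (le_trans (last_iterate b1 hb hS2 jK (ha j) haK)); rewrite lerD2l.
  rewrite ler_wpM2r ?(mulr_ge0 (ltW b0)) ?divr_ge0 ?mulr_ge0 ?(ltW c00)//.
  rewrite lerD2r ler_pM2r ?invr_gt0// ler_pM2r// ler_pM2l// ler_nat.
  exact: leq_sub2l.
have [aKe|aKe] := leP aK err.
  rewrite (le_trans aKe)// lerDl; apply: divr_ge0; first by rewrite mulr_ge0.
  by rewrite ltW// mulr_gt0.
rewrite -lerBlDl ler_pdivlMr ?mulr_gt0//.
have hsum : (K - m)%:R * (c0 * al * (1 - b) * ((aK - err) / 2)) <= B.
  apply: le_trans (weighted_mean_residual K ha).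
  rewrite -(big_mkord xpredT (fun k => index_weight lam k * a k)).
  rewrite (big_cat_nat (n := m))//=; last exact: ltnW.
  have a0 k : 0 <= a k by exact: has_mean_le (has_mean_cst P 0) (ha k) (fun w => sqr_ge0 _).
  rewrite (@le_trans _ _ (\sum_(m <= i < K) index_weight lam i * a i))//; last first.
    by rewrite lerDr sumr_ge0// => i _; rewrite mulr_ge0.
  rewrite mulr_natl -sumr_const_nat; apply: ler_sum_nat => i iK.
  have /andP[li1 li2] := hl i iK; have /andP[mi iK'] := iK.
  apply: ler_pM.
  - by rewrite ltW.
  - by rewrite divr_ge0// subr_ge0 ltW.
  - rewrite /index_weight ler_pM ?mulr_ge0 ?(ltW c00) ?(ltW al0) ?(ltW b10)//.
      by rewrite ler_pM ?(ltW c00) ?(ltW al0) ?hc.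
    by rewrite lerD2l lerN2.
  - by rewrite ler_pdivrMr// mulrC lerBlDr hstep.
have -> : (aK - err) * ((K - m)%:R * (c0 * al * (1 - b))) =
  2 * ((K - m)%:R * (c0 * al * (1 - b) * ((aK - err) / 2))) by field.
by rewrite ler_pM2l.
Qed.

Lemma random_iterate (K : nat) (N : {RV P >-> nat}) :
  random_index lam K xi N -> 0 < \sum_(j < K) index_weight lam j ->
  (\int[P]_w (r2 (N w) w)%:E <= (B / \sum_(j < K) index_weight lam j)%:E)%E.
Proof.
move=> hN W0; have /choice[a ha] := mean_residual.
rewrite (integral_random_index (r := r2) hN) => [|k w|k]; last 2 first.
- exact: sqr_ge0.
- exact: (adapted_residual hsep hTz).
rewrite (eq_bigr (fun k : 'I_K => (index_weight lam k / (\sum_(j < K) index_weight lam j)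
    * a k)%:E)); last first.
  by move=> k _; rewrite (ha k).2.
rewrite sumEFin lee_fin.
under eq_bigr do rewrite mulrAC.
rewrite -mulr_suml ler_pM2r ?invr_gt0//; exact: weighted_mean_residual.
Qed.

End ExpectedResidual.

(** The inequality f <= (f^2 / c + c) / 2 replaces Jensen's; c will be the target rate and a of
    order c^2. *)
Lemma integral_le_sqr {R : realType} {d} {Omega : measurableType d}
    (P : probability Omega R) (f : Omega -> R) (a c : R) :
  measurable_fun setT f -> (forall w, 0 <= f w) -> 0 < c ->
  (\int[P]_w (f w ^+ 2)%:E <= a%:E)%E ->
  (\int[P]_w (f w)%:E <= ((a / c + c) / 2)%:E)%E.
Proof.
move=> mf f0 c0 h.
have [m hm ma] := ge0_has_mean (measurable_funX 2 mf) (fun w => sqr_ge0 _) h (ltry _).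
rewrite lee_fin in ma.
have hb w : `|f w| <= 2^-1 * (c^-1 * f w ^+ 2 + c).
  rewrite ger0_norm// -(ler_pM2l (mulr_gt0 (ltr0n R 2) c0)).
  have -> : 2 * c * (2^-1 * (c^-1 * f w ^+ 2 + c)) = f w ^+ 2 + c ^+ 2.
    by field; rewrite gt_eqF.
  by have := sqr_ge0 (f w - c); lra.
have [n hn nle] := has_mean_dominated mf
  (has_meanZ 2^-1 (has_meanD (has_meanZ c^-1 hm) (has_mean_cst P c))) hb.
rewrite hn.2 lee_fin (le_trans (ler_norm _))// (le_trans nle)// mulrC.
by rewrite ler_pM2r ?invr_gt0// lerD2r mulrC ler_pM2r ?invr_gt0.
Qed.

(** * Convergence of real sequences *)

Section Sequences.
Context {R : realType}.
Implicit Types a g s l : nat -> R.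

Lemma partial_sums_bounded s g : (forall k, s k <= s k.+1) ->
  (forall k, s k <= g k) -> cvgn g -> exists M, forall k, s k <= M.
Proof.
move=> smono sg cg.
have [N _ hN] : \forall k \near \oo, g k <= limn g + 1.
  by apply: (cvgr_le (limn g)) => //; rewrite ltrDl.
exists (limn g + 1) => k.
have up i j : (i <= j)%N -> s i <= s j.
  by elim: j => [|j ih]; rewrite leq_eqVlt => /predU1P[->//|//]; rewrite ltnS => /ih /le_trans; apply.
rewrite (le_trans (up k (maxn k N) (leq_maxl _ _)))// (le_trans (sg _))//.
by apply: hN => /=; exact: leq_maxr.
Qed.

(** Subtracting the partial sums of a makes g nonincreasing and bounded below by -M. *)
Lemma almost_nonincreasing_cvg g a (M : R) :
  (forall k, 0 <= g k) -> (forall k, 0 <= a k) ->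
  (forall k, g k.+1 <= g k + a k) -> (forall n, \sum_(k < n) a k <= M) ->
  cvgn g.
Proof.
move=> g0 a0 hg aM; pose s n := \sum_(k < n) a k.
have cs : cvgn s.
  apply: nondecreasing_is_cvgn; last by exists M => _ [n _ <-]; exact: aM.
  apply/nondecreasing_seqP => n; rewrite /s big_ord_recr/= lerDl//.
have ch : cvgn (fun n => g n - s n).
  apply: nonincreasing_is_cvgn; last first.
    exists (- M) => _ [n _ <-]; rewrite -[leLHS]add0r lerD ?g0// lerN2; exact: aM.
  apply/nonincreasing_seqP => n; rewrite /s big_ord_recr/=.
  by rewrite opprD addrA addrAC lerD2r lerBlDr hg.
rewrite (_ : g = (fun n => (g n - s n) + s n)); first exact: is_cvgD.
by apply/funext => n; rewrite subrK.
Qed.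

Lemma divergent_weights_cvg0 l g (M : R) :
  (forall k, 0 <= l k) -> (forall k, 0 <= g k) -> cvgn g ->
  (forall n, \sum_(k < n) l k * g k <= M) ->
  (forall c : R, exists n, c <= \sum_(k < n) l k) ->
  g @ \oo --> (0 : R).
Proof.
move=> l0 g0 cg hM hl.
have L0 : 0 <= limn g by apply: limr_ge => //; exact: nearW.
have [->//|Ln0] := eqVneq 0 (limn g).
have Lp : 0 < limn g by rewrite lt_neqAle Ln0.
have [N _ hN] : \forall k \near \oo, limn g / 2 <= g k.
  by apply: (cvgr_ge (limn g)) => //; rewrite gtr_pMr// invf_lt1// ltr1n.
(* Weights summing to c leave more than M / (limn g / 2) beyond N, where g >= limn g / 2. *)
pose c := \sum_(k < N) l k + M / (limn g / 2) + 1.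
have [n hn] := hl c.
have L2 : 0 < limn g / 2 by rewrite divr_gt0.
have M0 : 0 <= M by have := hM 0%N; rewrite big_ord0.
have Nn : (N <= n)%N.
  rewrite leqNgt; apply/negP => nN.
  have : \sum_(k < n) l k <= \sum_(k < N) l k.
    rewrite -(big_mkord xpredT l) -(big_mkord xpredT l) [leRHS](big_cat_nat (n := n))//=; last exact: ltnW.
    by rewrite lerDl sumr_ge0.
  by move=> /(le_trans hn); rewrite /c -addrA gerDl leNgt ltr_wpDl// divr_ge0// ltW.
have := hM n; have : limn g / 2 * \sum_(N <= k < n) l k <= \sum_(k < n) l k * g k.
  rewrite -(big_mkord xpredT (fun k => l k * g k)) [leRHS](big_cat_nat (n := N))//=.
  rewrite ler_wpDl//; first by rewrite sumr_ge0// => i _; rewrite mulr_ge0.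
  rewrite mulr_sumr; apply: ler_sum_nat => i /andP[Ni _].
  by rewrite mulrC ler_wpM2l// hN.
move=> h1 h2; have := le_trans h1 h2; rewrite mulrC -ler_pdivlMr//.
move: hn; rewrite -(big_mkord xpredT l) (big_cat_nat (n := N))//= big_mkord /c.
rewrite -addrA lerD2l => /le_trans h /h.
by rewrite gerDl leNgt ltr01.
Qed.

Lemma cvg_sqrt_sqr (a : nat -> R) : (forall k, 0 <= a k) ->
  cvgn (fun k => a k ^+ 2) -> cvgn a.
Proof.
move=> a0 h; rewrite (_ : a = (fun k => Num.sqrt (a k ^+ 2))); last first.
  by apply/funext => k; rewrite sqrtr_sqr ger0_norm.
apply/cvg_ex; exists (Num.sqrt (limn (fun k => a k ^+ 2))).
exact: (cvg_comp _ _ h (@sqrt_continuous R _)).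
Qed.

Lemma sqr_cvg0 (a : nat -> R) : (fun k => a k ^+ 2) @ \oo --> (0 : R) ->
  a @ \oo --> (0 : R).
Proof.
move=> h; apply/cvgr0Pnorm_le => e e0; near=> k.
rewrite -(@ler_pXn2r _ 2) ?nnegrE ?(ltW e0)// real_normK ?num_real//.
near: k; have := h => /cvgr_le /(_ (e ^+ 2)); apply.
by rewrite exprn_gt0.
Unshelve. all: by end_near. Qed.

Lemma cvgn_of_approx (a : nat -> R) : (forall e : R, 0 < e ->
    exists2 b : nat -> R, cvgn b & forall k, `|a k - b k| <= e) -> cvgn a.
Proof.
move=> h; apply: (@cvg_of_dist_le R R) => e e0.
have e4 : 0 < e / 4 by rewrite divr_gt0.
have [b cb ab] := h _ e4.
have [N _ hN] : \forall k \near \oo, `|limn b - b k| <= e / 4.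
  by apply: cvgr_dist_le.
exists N => m n mN nN.
have := ab m; have := ab n; have := hN m mN; have := hN n nN.
rewrite !ler_distl => /andP[h1 h2] /andP[h3 h4] /andP[h5 h6] /andP[h7 h8].
by apply/andP; split; lra.
Qed.

End Sequences.

(** * Almost sure convergence *)

Section AlmostSure.
Context {R : realType} {H : completeNormedModType R} (hsep : separable H).
Context (dot : {dot H for idfun}) (hdot : hilbert_norm dot).
Context {dX} {Xi : measurableType dX} (D : probability Xi R).
Context (Tz : Xi -> H -> H) (T : H -> H) (hTz : random_nonexpansive dot D Tz T).
Context (lam : nat -> R) (hlam : forall k, 0 < lam k < 1) (x0 : H).
Context {d} {Omega : measurableType d} (P : probability Omega R).
Context (xi : nat -> {RV P >-> Xi}) (hxi : iid D xi).
Context (p0 : H) (v : R) (Tp0 : T p0 = p0) (v0 : 0 <= v)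
  (hv : variance_le D Tz T p0 v).
Context (b c0 : R) (b1 : b < 1) (lamb : forall k, lam k <= b) (c00 : 0 < c0)
  (hc2 : forall k, c0 <= discount lam 2 k) (hc4 : forall k, c0 <= discount lam 4 k)
  (hdiv : forall c : R, exists n, c <= \sum_(k < n) lam k).

Let x k (w : Omega) := skm Tz lam x0 (fun i => xi i w) k.
Let u k (w : Omega) := noise_average Tz T lam x0 0 (fun i => xi i w) k.
Let r2 k w := `|T (x k w) - x k w| ^+ 2.

Let lam0 k : 0 <= lam k. Proof. by have /andP[/ltW] := hlam k. Qed.
Let b10 : 0 < 1 - b. Proof. by rewrite subr_gt0. Qed.

Let discount_cvg (a : R) : 0 <= a -> (forall k, c0 <= discount lam a k) ->
  exists2 L : R, 0 < L & discount lam a @ \oo --> L.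
Proof.
move=> a0 hc; have cd : cvgn (discount lam a).
  apply: nonincreasing_is_cvgn; last by exists c0 => _ [k _ <-].
  apply/nonincreasing_seqP => k; rewrite -(discountS lam k a0) ler_peMr//.
    by rewrite (le_trans (ltW c00)).
  by rewrite lerDl mulr_ge0 ?sqr_ge0.
exists (limn (discount lam a)) => //; apply: lt_le_trans c00 _.
by apply: limr_ge => //; exact: nearW.
Qed.

Let undiscount (a : R) (g : nat -> R) (c : R) : 0 <= a -> (forall k, c0 <= discount lam a k) ->
  cvgn (fun k => discount lam a k * (g k + c)) -> cvgn g.
Proof.
move=> a0 hc hg; have [L L0 hL] := discount_cvg a0 hc.
rewrite (_ : g = (fun k => (discount lam a k)^-1 *
    (discount lam a k * (g k + c)) - c)); last first.
  apply/funext => k; rewrite mulrA mulVf ?mul1r ?addrK//.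
  by rewrite gt_eqF// (lt_le_trans c00).
apply: is_cvgB; last exact: is_cvg_cst.
apply: is_cvgM => //; apply/cvg_ex; exists (L^-1); apply: cvgV => //.
by rewrite gt_eqF.
Qed.

Let history_supermartingale_cvg (V : nat -> Omega -> R) (c : R) :
  supermartingale P (history xi) V -> (forall w, V 0%N w = c) ->
  {ae P, forall w, cvgn (V ^~ w)}.
Proof.
move=> hS hV; apply: (supermartingale_cvg (@history_sigma_measurable _ _ _ P _ _ xi)
  (@history_incr _ _ _ P _ _ xi) hS).
by under eq_integral do rewrite hV; rewrite (has_mean_cst P c).2 ltry.
Qed.

(** [noise_variance] transports the finite variance from p0 to p, so the supermartingale can be
    centred at p. *)
Lemma ae_dist_cvg (p : H) : T p = p -> {ae P, forall w, cvgn (fun k => `|x k w - p|)}.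
Proof.
move=> Tp; have [m hm /andP[m0 _]] := noise_variance hsep hdot hTz p hv.
have hvp : variance_le D Tz T p m by rewrite /variance_le hm.2.
have [hS _] := skm_supermartingales hsep hdot hTz hlam x0 hxi Tp m0 hvp.
have := history_supermartingale_cvg
  (c := discount lam 2 0 * (`|x0 - p| ^+ 2 + m)) hS (fun _ => erefl).
apply: filterS => w hw; apply: cvg_sqrt_sqr => //.
exact: (undiscount (ler0n _ 2) hc2 hw).
Qed.

(** Distances to a countable family [f] of fixed points, dense in Fix T, approximate |x_k - p|
    uniformly in k; where no fixed point is near, [f] takes the value p0. *)
Lemma ae_all_dist_cvg :
  {ae P, forall w, forall p, T p = p -> cvgn (fun k => `|x k w - p|)}.
Proof.
have [q hq] := separable_seq hsep.
pose f (nm : nat * nat) :=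
  xget p0 [set p | T p = p /\ `|p - q nm.1| < nm.2.+1%:R^-1].
have Tf nm : T (f nm) = f nm by rewrite /f; case: xgetP => [y _ []|].
have := ae_forall_count (fun nm : nat * nat => ae_dist_cvg (Tf nm)).
apply: filterS => w hw p Tp; apply: cvgn_of_approx => e e0.
have [m hm] : exists m : nat, m.+1%:R^-1 <= e / 2.
  have e2 : 0 < e / 2 by rewrite divr_gt0.
  have [N _ hN] := near_infty_natSinv_lt (PosNum e2).
  by exists N; rewrite ltW//; exact: (hN N (leqnn N)).
have m0 : 0 < m.+1%:R^-1 :> R by rewrite invr_gt0.
have [n hn] := hq p _ m0.
exists (fun k => `|x k w - f (n, m)|); first exact: hw.
have hf : `|f (n, m) - q n| < m.+1%:R^-1.
  by rewrite /f; case: xgetP => [y _ []//|/(_ p)]; case.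
move=> k; rewrite (le_trans (ler_dist_dist _ _))//.
have -> : x k w - p - (x k w - f (n, m)) = (f (n, m) - q n) - (p - q n).
  by apply: (dot_ext hdot) => y; rewrite !dotE; ring.
rewrite (le_trans (ler_normB _ _))// (le_trans (lerD (ltW hf) (ltW hn)))//.
by rewrite (le_trans (lerD hm hm))// -splitr.
Qed.

Lemma ae_residual_cvg0 :
  {ae P, forall w, (fun k => `|T (x k w) - x k w|) @ \oo --> (0 : R)}.
Proof.
have [_ nT _ _] := hTz.
have l1 k : 0 < 1 - lam k by rewrite subr_gt0; have /andP[] := hlam k.
have [hS1 hS2] := skm_noise_supermartingales hsep hdot hTz hlam x0 hxi Tp0 v0 hv 0.
pose c := discount lam 4 0 * (`|x0 - p0| ^+ 2 + `|0 : H| ^+ 2 + v).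
have c1 := history_supermartingale_cvg (c := c) hS1 (fun _ => erefl).
have := history_supermartingale_cvg (c := c) hS2.
have c20 w : c + \sum_(j < 0) discount lam 4 j.+1 *
   (lam j * (1 - lam j) * r2 j w + lam j * `|u j w| ^+ 2) = c.
  by rewrite big_ord0 addr0.
move=> /(_ c20) c2; apply: filterS3 c1 c2 (ae_dist_cvg Tp0).
move=> w h1 h2 h3.
have cu : cvgn (fun k => `|u k w| ^+ 2).
  have := undiscount (ler0n _ 4) hc4 h1 => h4.
  rewrite (_ : (fun k => _) = (fun k => (`|x k w - p0| ^+ 2 + `|u k w| ^+ 2) - `|x k w - p0| ^+ 2)).
    by apply: is_cvgB => //; apply: is_cvgM.
  by apply/funext => k; rewrite addrC addKr.
have [M hM] : exists M, forall n, \sum_(j < n) (lam j * r2 j w + lam j * `|u j w| ^+ 2) <= M.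
  pose t j := discount lam 4 j.+1 *
    (lam j * (1 - lam j) * r2 j w + lam j * `|u j w| ^+ 2).
  have t0 j : 0 <= t j.
    apply: mulr_ge0; first exact: le_trans (ltW c00) (hc4 _).
    by rewrite addr_ge0// !mulr_ge0 ?sqr_ge0 ?(ltW (l1 _)).
  have [||M hM] := partial_sums_bounded (s := fun n => \sum_(j < n) t j) _ _ h2.
  - by move=> k; rewrite big_ord_recr/= lerDl.
  - move=> k; rewrite lerDr mulr_ge0 ?addr_ge0 ?sqr_ge0//.
    by rewrite (le_trans (ltW c00)).
  (* Discounts are at least c0 and 1 - lambda is at least 1 - b. *)
  exists (M / (c0 * (1 - b))) => n; rewrite ler_pdivlMr ?mulr_gt0//.
  apply: le_trans (hM n); rewrite mulr_suml; apply: ler_sum => j _.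
  rewrite mulrC -mulrA; apply: ler_pM.
  - exact: ltW.
  - by rewrite mulr_ge0 ?(ltW b10)// addr_ge0// mulr_ge0 ?sqr_ge0.
  - exact: hc4.
  have bl := lamb j.
  have h5 : 0 <= lam j * r2 j w * (b - lam j).
    by rewrite mulr_ge0 ?subr_ge0// mulr_ge0 ?sqr_ge0.
  have h6 : 0 <= lam j * `|u j w| ^+ 2 * b.
    by rewrite !mulr_ge0 ?sqr_ge0// (le_trans (lam0 j)).
  by lra.
have hu0 : (fun k => `|u k w| ^+ 2) @ \oo --> (0 : R).
  apply: (divergent_weights_cvg0 (l := lam) (M := M)) => // n.
  apply: le_trans (hM n); apply: ler_sum => j _.
  by rewrite lerDr mulr_ge0 ?sqr_ge0.
pose g k := `|T (x k w - u k w) - (x k w - u k w)| ^+ 2.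
have gle k : g k <= 2 * r2 k w + 8 * `|u k w| ^+ 2.
  exact: (residual_perturbation hdot nT).
have rle k : r2 k w <= 2 * g k + 8 * `|u k w| ^+ 2.
  have := residual_perturbation hdot nT (x k w - u k w) (- u k w).
  by rewrite opprK subrK normrN.
have cg : cvgn g.
  apply: (almost_nonincreasing_cvg (a := fun k => lam k / (1 - lam k) * `|u k w| ^+ 2)
     (M := (1 - b)^-1 * M)) => //.
  - by move=> k; exact: sqr_ge0.
  - by move=> k; rewrite mulr_ge0 ?sqr_ge0// divr_ge0// ltW.
  - move=> k; exact: (corrected_residual_step hdot hTz hlam x0 xi).
  - move=> n; apply: (@le_trans _ _ ((1 - b)^-1 *
        \sum_(j < n) (lam j * r2 j w + lam j * `|u j w| ^+ 2))).
      rewrite mulr_sumr; apply: ler_sum => j _.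
      rewrite mulrAC mulrC; apply: ler_pM.
      + by rewrite invr_ge0 ltW.
      + by rewrite mulr_ge0 ?sqr_ge0.
      + by rewrite lef_pV2 ?posrE ?l1// lerD2l lerN2.
      + by rewrite lerDr mulr_ge0 ?sqr_ge0.
    by rewrite ler_wpM2l// invr_ge0 ltW.
have hg0 : g @ \oo --> (0 : R).
  (* 8 is the larger constant in [gle]. *)
  apply: (divergent_weights_cvg0 (l := lam) (M := 8 * M)) => //.
    by move=> k; exact: sqr_ge0.
  move=> n; apply: (@le_trans _ _ (8 *
      \sum_(j < n) (lam j * r2 j w + lam j * `|u j w| ^+ 2))).
    rewrite mulr_sumr; apply: ler_sum => j _.
    have := ler_wpM2l (lam0 j) (gle j).
    have : 0 <= lam j * r2 j w by rewrite mulr_ge0 ?sqr_ge0.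
    by lra.
  by rewrite ler_wpM2l.
apply: sqr_cvg0.
apply: (@squeeze_cvgr _ _ _ _ (cst 0) (fun k => 2 * g k + 8 * `|u k w| ^+ 2)).
- by near=> k; rewrite sqr_ge0 /=; exact: rle.
- exact: cvg_cst.
- have : (fun k => 2 * g k + 8 * `|u k w| ^+ 2) @ \oo --> 2 * 0 + 8 * (0 : R).
    by apply: cvgD; (apply: cvgM; first exact: cvg_cst).
  by rewrite !mulr0 addr0.
Unshelve. all: by end_near. Qed.

Theorem skm_almost_sure :
  {ae P, forall w, exists p, T p = p /\ weakly_cvg dot (fun k => x k w) p} /\
  {ae P, forall w, (fun k => `|T (x k w) - x k w|) @ \oo --> (0 : R)}.
Proof.
have [_ nT _ _] := hTz.
split; last exact: ae_residual_cvg0.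
apply: filterS2 ae_all_dist_cvg ae_residual_cvg0 => w h1 h2.
have [p Fp wp] := opial hdot nT (ex_intro _ p0 Tp0) h1 h2.
by exists p.
Qed.

End AlmostSure.

(** * Step sizes and rates *)

Section Schedules.
Context {R : realType}.

Lemma powRX (x : R) (e f : R) n : 0 <= x -> f = e * n%:R -> (x `^ e) ^+ n = x `^ f.
Proof. by move=> x0 ->; rewrite powRrM powR_mulrn// powR_ge0. Qed.

(** Each factor is bounded by 1 + y <= exp y. *)
Lemma discount_ge (lam : nat -> R) (a s : R) k : 0 <= a ->
  \sum_(i < k) lam i ^+ 2 <= s -> expR (- (a * s)) <= discount lam a k.
Proof.
move=> a0 hs; apply: (@le_trans _ _ (expR (- (a * \sum_(i < k) lam i ^+ 2)))).
  by rewrite ler_expR lerN2 ler_wpM2l.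
rewrite mulr_sumr -sumrN expR_sum; apply: ler_prod => i _.
rewrite expR_ge0/= expRN lef_pV2 ?posrE ?expR_gt0 ?expR_ge1Dx//.
by rewrite ltr_wpDr// mulr_ge0 ?sqr_ge0.
Qed.

Lemma harmonic_unbounded (l : nat -> R) (c : R) : 0 < c ->
  (forall k, c / k.+1%:R <= l k) -> forall M, exists n, M <= \sum_(k < n) l k.
Proof.
move=> c0 hl M; apply: contrapT => hM.
apply: (@dvg_harmonic R).
apply: nondecreasing_is_cvgn.
  apply/nondecreasing_seqP => n; rewrite /series/= big_nat_recr//= lerDl.
  by rewrite /harmonic/= invr_ge0.
exists (M / c) => _ [n _ <-]; rewrite ler_pdivlMr// mulr_suml.
have nM : ~~ (M <= \sum_(k < n) l k) by apply/negP => h; apply: hM; exists n.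
move: nM; rewrite -ltNge => /ltW; apply: le_trans.
rewrite big_mkord; apply: ler_sum => k _.
by rewrite /harmonic/= mulrC; exact: hl.
Qed.

Lemma expR1_le4 : expR 1 <= (4 : R).
Proof.
have h : expR (2^-1 : R) <= 2.
  have := expR_ge1Dx (- (2^-1) : R); rewrite expRN.
  have -> : 1 + - 2^-1 = 2^-1 :> R by field.
  by rewrite lef_pV2 ?posrE ?expR_gt0.
rewrite (_ : expR 1 = expR 2^-1 * expR 2^-1 :> R); last first.
  by rewrite -expRD; congr expR; field.
rewrite [leRHS](_ : _ = 2 * 2); last by ring.
by rewrite ler_pM ?expR_ge0.
Qed.

Lemma ln_shift_ge1 k : 1 <= ln (k%:R + expR 1 : R).
Proof.
by rewrite -{1}(expRK (1 : R)) ler_ln ?posrE ?expR_gt0 ?lerDr// ltr_wpDl// expR_gt0.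
Qed.

Lemma shift_gt0 k : 0 < k%:R + expR 1 :> R.
Proof. by rewrite ltr_wpDl// expR_gt0. Qed.

Lemma shift_le k : k%:R + expR 1 <= 4 * k.+1%:R :> R.
Proof.
have := expR1_le4; rewrite -natr1; have := ler0n R k; lra.
Qed.

Context (lbar : R) (hlbar : 0 < lbar < 1).

Let lb0 : 0 < lbar. Proof. by case/andP: hlbar. Qed.
Let lb1 : lbar < 1. Proof. by case/andP: hlbar. Qed.

Section Bertrand.
Let lam2 (k : nat) : R := lbar * k.+1%:R `^ (- (1 / 2)) * (ln (k%:R + expR 1))^-1.
Let h k : R := k.+1%:R `^ (- (1 / 2)).

Let h2 k : h k ^+ 2 = k.+1%:R^-1.
Proof. by rewrite /h (powRX (f := - 1))// ?powR_inv1//; field. Qed.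

Let h0 k : 0 < h k. Proof. by rewrite powR_gt0. Qed.
Let h1 k : h k <= 1.
Proof.
rewrite -(@ler_pXn2r _ 2) ?nnegrE ?(ltW (h0 _))// h2 expr1n.
by rewrite invf_le1 ?ler1n.
Qed.

Let il k : 0 < (ln (k%:R + expR 1 : R))^-1 <= 1.
Proof.
have l1 := ln_shift_ge1 k; have l0 : 0 < ln (k%:R + expR 1 : R) by exact: lt_le_trans l1.
by rewrite invr_gt0 l0 invf_le1.
Qed.

Lemma bertrand_le k : 0 < lam2 k <= lbar.
Proof.
have /andP[i0 i1] := il k; rewrite /lam2 -/(h k) !mulr_gt0//=.
rewrite -mulrA ler_piMr ?(ltW lb0)// mulr_ile1 ?h1 ?i1 ?(ltW i0)//.
exact: ltW.
Qed.

Lemma bertrand_harmonic k : (lbar / 4) / k.+1%:R <= lam2 k.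
Proof.
have l0 : 0 < ln (k%:R + expR 1 : R) := lt_le_trans ltr01 (ln_shift_ge1 k).
have h2k : 0 < 2 / h k by rewrite divr_gt0.
(* As k + e <= 4 (k + 1) = (2 / h)^2, the logarithm is at most 2 ln (2 / h) <= 4 / h. *)
have hl : h k * ln (k%:R + expR 1) <= 4.
  rewrite mulrC -ler_pdivlMr//.
  apply: (@le_trans _ _ (ln ((2 / h k) ^+ 2))).
    rewrite ler_ln ?posrE ?shift_gt0 ?exprn_gt0//.
    apply: (le_trans (shift_le k)); rewrite exprMn exprVn h2 invrK.
    by rewrite -natrX.
  rewrite lnXn// -[leLHS]mulr_natl.
  rewrite [leRHS](_ : _ = 2 * (2 / h k)); last by ring.
  by rewrite ler_pM2l// ltW// ln_sublinear.
rewrite /lam2 -/(h k) ler_pdivlMr// -(h2 k).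
have := ler_wpM2l (ltW (mulr_gt0 lb0 (h0 k))) hl; lra.
Qed.

(** The terms are dominated by increments of -4 / ln (k + e); the factor 4 comes from [shift_le],
    and 5 adds the first term. *)
Lemma bertrand_sqr_sum n : \sum_(k < n) lam2 k ^+ 2 <= 5.
Proof.
pose l k : R := ln (k%:R + expR 1).
have l1 k : 1 <= l k := ln_shift_ge1 k.
have l0 k : 0 < l k := lt_le_trans ltr01 (l1 k).
have key : \sum_(k < n.+1) lam2 k ^+ 2 <= 5 - 4 * (l n)^-1.
  elim: n => [|n ih].
    rewrite big_ord1 /l add0r expRK invr1.
    have /andP[a0 a1] := bertrand_le 0.
    have : lam2 0 ^+ 2 <= 1 by rewrite exprn_ile1 ?(ltW a0)// (le_trans a1)// ltW.
    lra.
  rewrite big_ord_recr/= (le_trans (lerD ih (lexx _)))//.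
  suff : lam2 n.+1 ^+ 2 <= 4 * ((l n)^-1 - (l n.+1)^-1) by lra.
  have y0 := shift_gt0 n.+1.
  have yS : n%:R + expR 1 = n.+1%:R + expR 1 - 1 :> R by rewrite -natr1; ring.
  have hba : (n.+1%:R + expR 1)^-1 <= l n.+1 - l n.
    rewrite /l -lerN2 opprB -ln_div ?posrE ?shift_gt0// yS mulrBl divff ?gt_eqF//.
    rewrite mul1r; apply: le_ln1Dx; rewrite ltrN2 invf_lt1//.
    by rewrite ltr_wpDl// expR_gt1.
  have hb : h n.+1 ^+ 2 <= 4 * (l n.+1 - l n).
    rewrite h2; apply: (@le_trans _ _ (4 * (n.+1%:R + expR 1)^-1)).
      rewrite -[leLHS]mul1r ler_pdivrMr// mulrAC ler_pdivlMr// mul1r.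
      exact: shift_le.
    by rewrite ler_pM2l.
  have ba : 0 <= l n.+1 - l n by rewrite (le_trans _ hba)// invr_ge0 ltW.
  apply: (@le_trans _ _ (h n.+1 ^+ 2 / (l n.+1) ^+ 2)).
    rewrite /lam2 -/(h _) -/(l _) !exprMn exprVn -mulrA ler_piMl//.
      by rewrite divr_ge0 ?sqr_ge0.
    by rewrite exprn_ile1// ltW.
  apply: (@le_trans _ _ (4 * (l n.+1 - l n) / (l n.+1) ^+ 2)).
    by rewrite ler_wpM2r// invr_ge0 sqr_ge0.
  have -> : (l n)^-1 - (l n.+1)^-1 = (l n.+1 - l n) / (l n * l n.+1).
    by field; rewrite !gt_eqF.
  rewrite -mulrA ler_wpM2l// ler_wpM2l// lef_pV2 ?posrE ?mulr_gt0 ?exprn_gt0//.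
  by rewrite expr2 ler_pM2r// -subr_ge0.
apply: (@le_trans _ _ (\sum_(k < n.+1) lam2 k ^+ 2)).
  by rewrite big_ord_recr/= lerDl sqr_ge0.
by rewrite (le_trans key)// gerBl mulr_ge0// invr_ge0 ltW.
Qed.

End Bertrand.

Section Power.
Let lam4 (k : nat) : R := lbar * k.+1%:R `^ (- (2 / 3)).
Let t k : R := k.+1%:R `^ (- (1 / 3)).

Let t3 k : t k ^+ 3 = k.+1%:R^-1.
Proof. by rewrite /t (powRX (f := - 1))// ?powR_inv1//; field. Qed.

Let t2 k : lam4 k = lbar * t k ^+ 2.
Proof. by rewrite /lam4 /t (powRX (f := - (2 / 3)))//; field. Qed.

Let t0 k : 0 < t k. Proof. by rewrite powR_gt0. Qed.
Let t1 k : t k <= 1.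
Proof.
rewrite -(@ler_pXn2r _ 3) ?nnegrE ?(ltW (t0 _))// t3 expr1n.
by rewrite invf_le1 ?ler1n.
Qed.

Lemma power_le k : 0 < lam4 k <= lbar.
Proof.
rewrite t2 mulr_gt0 ?exprn_gt0//= ler_piMr ?(ltW lb0)//.
by rewrite exprn_ile1// ltW.
Qed.

Lemma power_harmonic k : lbar / k.+1%:R <= lam4 k.
Proof.
rewrite t2 -t3 ler_pM2l// exprS ler_piMl ?sqr_ge0//.
Qed.

(** With t_k = (k + 1)^(-1/3), the relation t_n^(-3) + 1 = t_{n+1}^(-3) gives t_{n+1}^4 <= 3 (t_n -
    t_{n+1}), which telescopes; 4 is 3 plus the first term. *)
Lemma power_sqr_sum n : \sum_(k < n) lam4 k ^+ 2 <= 4.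
Proof.
have key : \sum_(k < n.+1) lam4 k ^+ 2 <= 4 - 3 * t n.
  have lt k : lam4 k ^+ 2 <= t k ^+ 4.
    rewrite t2 exprMn -exprM ler_piMl ?exprn_ge0 ?(ltW (t0 _))//.
    by rewrite exprn_ile1// ltW.
  elim: n => [|n ih].
    rewrite big_ord1 (le_trans (lt 0%N))//.
    have -> : t 0 = 1 by rewrite /t powR1.
    by rewrite expr1n; lra.
  rewrite big_ord_recr/= (le_trans (lerD ih (lt n.+1)))//.
  have a0 := t0 n; have b0 := t0 n.+1.
  have ab : t n.+1 <= t n.
    rewrite -(@ler_pXn2r _ 3) ?nnegrE ?(ltW (t0 _))// !t3.
    by rewrite lef_pV2 ?posrE// ler_nat.
  have hab : t n ^+ 3 - t n.+1 ^+ 3 = t n ^+ 3 * t n.+1 ^+ 3.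
    rewrite !t3 -(natr1 n.+1); have : 0 < n.+1%:R :> R by rewrite ltr0n.
    move: (n.+1%:R) => c c0; field.
    by rewrite !gt_eqF// addr_gt0.
  move: a0 b0 ab hab; move: (t n) (t n.+1) => a b a0 b0 ab hab.
  suff : b ^+ 4 <= 3 * (a - b) by lra.
  have h1 : a * b ^+ 3 <= 3 * (a - b).
    rewrite -(ler_pM2l (exprn_gt0 2 a0)).
    have -> : a ^+ 2 * (a * b ^+ 3) = (a - b) * (a ^+ 2 + a * b + b ^+ 2).
      by rewrite mulrA -exprSr -hab; ring.
    have -> : a ^+ 2 * (3 * (a - b)) = (a - b) * (3 * a ^+ 2) by ring.
    rewrite ler_wpM2l ?subr_ge0//.
    have : a * b <= a * a by rewrite ler_pM2l.
    have : b * b <= a * a by rewrite ler_pM// ltW.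
    lra.
  by apply: le_trans h1; rewrite exprS ler_wpM2r// exprn_ge0// ltW.
apply: (@le_trans _ _ (\sum_(k < n.+1) lam4 k ^+ 2)).
  by rewrite big_ord_recr/= lerDl sqr_ge0.
by rewrite (le_trans key)// gerBl mulr_ge0// ltW.
Qed.

End Power.
End Schedules.

Lemma weight_sum_ge {R : realType} (lam : nat -> R) (K : nat) (al b c0 : R) :
  0 <= al -> b <= 1 -> 0 <= c0 ->
  (forall k, (k < K)%N -> al <= lam k <= b) ->
  (forall k, (k <= K)%N -> c0 <= Lambda lam k) ->
  K%:R * (c0 * al * (1 - b)) <= \sum_(k < K) index_weight lam k.
Proof.
move=> al0 b1 c00 hl hc; rewrite -[K in K%:R]card_ord mulr_natl -sumr_const.
apply: ler_sum => k _; have /andP[h1 h2] := hl k (ltn_ord k).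
rewrite /index_weight ler_pM ?mulr_ge0 ?subr_ge0//.
  by rewrite ler_pM// hc.
by rewrite lerD2l lerN2.
Qed.

(** * Rates from bounds on the step sizes *)

Section Rates.
Context {R : realType} {H : completeNormedModType R} (hsep : separable H).
Context (dot : {dot H for idfun}) (hdot : hilbert_norm dot).
Context {dX} {Xi : measurableType dX} (D : probability Xi R).
Context (Tz : Xi -> H -> H) (T : H -> H) (hTz : random_nonexpansive dot D Tz T).
Context (x0 p : H) (v : R) (Tp : T p = p) (v0 : 0 <= v)
  (hv : variance_le D Tz T p v).
Context {d} {Omega : measurableType d} (P : probability Omega R).

Let B := `|x0 - p| ^+ 2 + v.
Let B0 : 0 <= B. Proof. by rewrite addr_ge0 ?sqr_ge0. Qed.

Let residual (lam : nat -> R) (xi : nat -> {RV P >-> Xi}) k w :=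
  `|T (skm Tz lam x0 (fun i => xi i w) k) - skm Tz lam x0 (fun i => xi i w) k|.

Lemma measurable_residual lam xi k : measurable_fun setT (residual lam xi k).
Proof.
have [_ nT _ _] := hTz.
have mx := hmeas_skm hsep hTz lam x0 (xi := xi) (k := k).
have mr : hmeas (fun w : g_sigma_algebraType (history xi k) =>
    T (skm Tz lam x0 (fun i => xi i w) k) - skm Tz lam x0 (fun i => xi i w) k).
  by apply: hmeasB => //; apply: hmeas_continuous => //; exact: nonexpansive_continuous.
exact: adapted_measurable (@history_sigma_measurable _ _ _ P _ _ xi k) (hmeas_norm mr).
Qed.

Lemma rate_random lam xi (K : nat) (N : {RV P >-> nat}) (c s : R) :
  (forall k, 0 < lam k < 1) -> iid D xi -> random_index lam K xi N ->
  0 < c -> 0 < s -> c / s ^+ 2 <= \sum_(j < K) index_weight lam j ->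
  (\int[P]_w (residual lam xi (N w) w)%:E <= ((B / c + 1) / 2 * s)%:E)%E.
Proof.
move=> hlam hxi hN c0 s0 hW.
have cs0 : 0 < c / s ^+ 2 by rewrite divr_gt0// exprn_gt0.
have W0 : 0 < \sum_(j < K) index_weight lam j := lt_le_trans cs0 hW.
have h := random_iterate hsep hdot hTz hlam x0 hxi Tp v0 hv hN W0.
have mN : measurable_fun setT (fun w => residual lam xi (N w) w).
  apply: (measurable_glue (h := fun k w => residual lam xi k w)).
    by move=> i; exact: (measurable_funPTI N (_ : measurable [set i])).
  by move=> k; exact: measurable_residual.
apply: le_trans (integral_le_sqr mN (fun w => normr_ge0 _) s0 h) _.
rewrite lee_fin -/B [leRHS]mulrAC ler_pM2r ?invr_gt0// [leRHS]mulrDl mul1r lerD2r.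
rewrite ler_pdivrMr//.
have -> : B / c * s * s = B * (c / s ^+ 2)^-1 by field; rewrite !gt_eqF.
by rewrite ler_wpM2l// lef_pV2.
Qed.

(** The coefficient of s^2 when the steps are comparable to s^4 and K s^6 = 1: the noise contributes
    K s^8 = s^2 and s^4 <= s^2, the averaging 1 / (K s^4) = s^2. The 4 reflects K <= 2 (K - m). *)
Definition last_constant (lbar beta b0 c0 : R) :=
  (2 * beta ^+ 2 / (1 - b0) + 8 * beta) * (2 * B / c0) +
  4 * B / (c0 * lbar * (1 - b0)).

Lemma rate_last lam xi (K m : nat) (lbar beta b0 c0 s : R) :
  (forall k, 0 < lam k < 1) -> iid D xi ->
  (m < K)%N -> (K <= 2 * (K - m))%N -> 0 < lbar -> 0 < beta ->
  0 < c0 -> 0 < s <= 1 -> K%:R * s ^+ 6 = 1 -> beta * s ^+ 4 <= b0 -> b0 < 1 ->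
  (forall i, (m <= i < K)%N -> lbar * s ^+ 4 <= lam i <= beta * s ^+ 4) ->
  (forall k, (k <= K)%N -> c0 <= Lambda lam k) ->
  (\int[P]_w (residual lam xi K w)%:E <=
    ((last_constant lbar beta b0 c0 + 1) / 2 * s)%:E)%E.
Proof.
move=> hlam hxi mK K2 lb0 be0 c00 /andP[s0 s1] Ks bb0 b01 hl hc.
have [a ha] := mean_residual hsep hdot hTz hlam x0 hxi Tp v0 hv K.
have s40 : 0 < s ^+ 4 by rewrite exprn_gt0.
have b10 : 0 < 1 - b0 by rewrite subr_gt0.
have al0 : 0 < lbar * s ^+ 4 by rewrite mulr_gt0.
have bK0 : 0 < beta * s ^+ 4 by rewrite mulr_gt0.
have b1 : beta * s ^+ 4 < 1 by exact: le_lt_trans b01.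
have hle := last_iterate_average hsep hdot hTz hlam hxi Tp v0 hv mK b1 al0 c00 hl hc ha.
have s2K : s ^+ 2 = K%:R * s ^+ 8.
  by rewrite (exprD s 6 2) mulrA Ks mul1r.
have Km : (K - m)%:R <= K%:R :> R by rewrite ler_nat leq_subr.
have Km2 : K%:R <= 2 * (K - m)%:R :> R by rewrite -natrM ler_nat.
have Km0 : 0 < (K - m)%:R :> R by rewrite ltr0n subn_gt0.
have Bc : 0 <= 2 * B / c0 by rewrite divr_ge0 ?mulr_ge0// ltW.
have b1b : 0 < 1 - beta * s ^+ 4 by rewrite subr_gt0.
have hbb : (1 - beta * s ^+ 4)^-1 <= (1 - b0)^-1.
  by rewrite lef_pV2 ?posrE// lerD2l lerN2.
have aC : a <= last_constant lbar beta b0 c0 * s ^+ 2.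
  apply: (le_trans hle); rewrite -/B /last_constant [leRHS]mulrDl; apply: lerD.
    rewrite mulrA -(mulrAC _ (s ^+ 2)) ler_wpM2r//.
    have h1 : (K - m)%:R * (beta * s ^+ 4) * (beta * s ^+ 4) / (1 - beta * s ^+ 4)
        <= beta ^+ 2 / (1 - b0) * s ^+ 2.
      rewrite -mulrA [leRHS](_ : _ = (K%:R * (beta ^+ 2 * s ^+ 8)) * (1 - b0)^-1).
        rewrite [leLHS](_ : _ = ((K - m)%:R * (beta ^+ 2 * s ^+ 8)) * (1 - beta * s ^+ 4)^-1).
          apply: ler_pM => //.
          - by rewrite !mulr_ge0 ?exprn_ge0 ?(ltW s0)// ltW.
          - by rewrite invr_ge0 ltW.
          - by rewrite ler_wpM2r// mulr_ge0 ?exprn_ge0 ?(ltW s0) ?(ltW be0).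
        ring.
      by rewrite s2K; ring.
    have h2 : beta * s ^+ 4 <= beta * s ^+ 2.
      rewrite ler_pM2l// (exprD s 2 2) ler_piMl ?sqr_ge0//.
      by rewrite exprn_ile1// ltW.
    have -> : (2 * (K - m)%:R * (beta * s ^+ 4) / (1 - beta * s ^+ 4) + 8) *
        (beta * s ^+ 4) = 2 * ((K - m)%:R * (beta * s ^+ 4) * (beta * s ^+ 4) /
        (1 - beta * s ^+ 4)) + 8 * (beta * s ^+ 4) by ring.
    have -> : (2 * beta ^+ 2 / (1 - b0) + 8 * beta) * s ^+ 2 =
      2 * (beta ^+ 2 / (1 - b0) * s ^+ 2) + 8 * (beta * s ^+ 2) by ring.
    by rewrite lerD// ler_pM2l.
  rewrite ler_pdivrMr; last by rewrite !mulr_gt0.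
  have e1 : 1 <= 2 * ((K - m)%:R * s ^+ 6).
    by rewrite -[leLHS]Ks mulrA ler_wpM2r// exprn_ge0// ltW.
  have e2 : 1 <= (1 - beta * s ^+ 4) / (1 - b0).
    by rewrite ler_pdivlMr// mul1r lerD2l lerN2.
  have -> : 4 * B / (c0 * lbar * (1 - b0)) * s ^+ 2 *
      ((K - m)%:R * (c0 * (lbar * s ^+ 4) * (1 - beta * s ^+ 4))) =
      2 * B * (2 * ((K - m)%:R * s ^+ 6) * ((1 - beta * s ^+ 4) / (1 - b0))).
    by field; rewrite !gt_eqF.
  rewrite ler_peMr ?mulr_ge0//.
  by rewrite (le_trans e1)// ler_peMr// (le_trans _ e1).
have mf : measurable_fun setT (residual lam xi K) by exact: measurable_residual.
have h2 : (\int[P]_w (residual lam xi K w ^+ 2)%:E <=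
    (last_constant lbar beta b0 c0 * s ^+ 2)%:E)%E by rewrite ha.2 lee_fin.
apply: le_trans (integral_le_sqr mf (fun w => normr_ge0 _) s0 h2) _.
rewrite lee_fin le_eqVlt; apply/orP; left; apply/eqP.
by move: (last_constant _ _ _ _) => C; field; rewrite gt_eqF.
Qed.

End Rates.

(** * Rates for the four schedules *)

Section ScheduleRates.
Context {R : realType} {H : completeNormedModType R} (hsep : separable H).
Context (dot : {dot H for idfun}) (hdot : hilbert_norm dot).
Context {dX} {Xi : measurableType dX} (D : probability Xi R).
Context (Tz : Xi -> H -> H) (T : H -> H) (hTz : random_nonexpansive dot D Tz T).
Context (x0 p : H) (v : R) (Tp : T p = p) (v0 : 0 <= v)
  (hv : variance_le D Tz T p v).
Context {d} {Omega : measurableType d} (P : probability Omega R).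
Context (lbar : R) (hlbar : 0 < lbar < 1).

Let residual (lam : nat -> R) (xi : nat -> {RV P >-> Xi}) k w :=
  `|T (skm Tz lam x0 (fun i => xi i w) k) - skm Tz lam x0 (fun i => xi i w) k|.

Let lb0 : 0 < lbar. Proof. by case/andP: hlbar. Qed.
Let lb1 : lbar < 1. Proof. by case/andP: hlbar. Qed.
Let lb10 : 0 < 1 - lbar. Proof. by rewrite subr_gt0. Qed.

Let root_le1 (s : R) (K n : nat) : (0 < K)%N -> (0 < n)%N -> 0 < s ->
  K%:R * s ^+ n = 1 -> s <= 1.
Proof.
move=> K0 n0 s0 Ks; rewrite -(@ler_pXn2r _ n)// ?nnegrE ?(ltW s0)// expr1n.
by rewrite -Ks ler_peMl ?ler1n// exprn_ge0// ltW.
Qed.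

Let powR_root (K n : nat) : (0 < K)%N -> (0 < n)%N ->
  K%:R * (K%:R `^ (- (1 / n%:R))) ^+ n = 1 :> R.
Proof.
move=> K0 n0; rewrite (powRX (f := - 1))// ?powR_inv1// ?divff ?pnatr_eq0 -?lt0n//.
by rewrite mulNr div1r mulVf// pnatr_eq0 -lt0n.
Qed.

Let eq_inv (a b : R) : a * b = 1 -> b = a^-1.
Proof.
move=> h; have a0 : a != 0.
  by apply/eqP => a0; move/eqP: h; rewrite a0 mul0r eq_sym oner_eq0.
by apply: (mulfI a0); rewrite h divff.
Qed.

Let constant_Lambda (l : R) (K k : nat) : K%:R * l ^+ 2 <= 1 -> (k <= K)%N ->
  expR (- (2 * 1)) <= Lambda (fun _ => l) k.
Proof.
move=> hl kK; apply: discount_ge => //.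
rewrite sumr_const card_ord -[leLHS]mulr_natl (le_trans _ hl)//.
by rewrite ler_wpM2r ?sqr_ge0// ler_nat.
Qed.

Lemma rate_constant_random : exists M, forall K (xi : nat -> {RV P >-> Xi})
    (N : {RV P >-> nat}), (0 < K)%N -> iid D xi ->
  random_index (fun _ => lbar * K%:R `^ (- (1 / 2))) K xi N ->
  (\int[P]_w (residual (fun _ => (lbar * K%:R `^ (- (1 / 2)))%R) xi (N w) w)%:E <=
     (M * K%:R `^ (- (1 / 4)))%:E)%E.
Proof.
pose c := expR (- (2 * 1)) * lbar * (1 - lbar).
exists (((`|x0 - p| ^+ 2 + v) / c + 1) / 2) => K xi N K0 hxi.
pose s : R := K%:R `^ (- (1 / 4)).
have s0 : 0 < s by rewrite powR_gt0 ?ltr0n.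
have Ks : K%:R * s ^+ 4 = 1 by exact: powR_root.
have s1 : s <= 1 by exact: root_le1 Ks.
have -> : K%:R `^ (- (1 / 2)) = s ^+ 2.
  by rewrite /s (powRX (f := - (1 / 2)))//; field.
have s2 : 0 < s ^+ 2 by rewrite exprn_gt0.
have ll : 0 < lbar * s ^+ 2 <= lbar.
  by rewrite mulr_gt0//= ler_piMr ?(ltW lb0)// exprn_ile1// ltW.
have hlam (k : nat) : 0 < lbar * s ^+ 2 < 1.
  by case/andP: ll => -> /=/le_lt_trans; apply.
move=> hN; apply: (rate_random hsep hdot hTz x0 Tp v0 hv hlam hxi hN) => //.
  by rewrite !mulr_gt0// expR_gt0.
have h := @weight_sum_ge _ (fun _ => lbar * s ^+ 2) K (lbar * s ^+ 2) lbar (expR (- (2 * 1))).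
apply: le_trans (h _ _ _ _ _).
- rewrite ler_pdivrMr// /c.
  have -> : K%:R * (expR (- (2 * 1)) * (lbar * s ^+ 2) * (1 - lbar)) * s ^+ 2 =
    expR (- (2 * 1)) * lbar * (1 - lbar) * (K%:R * s ^+ 4) by ring.
  by rewrite Ks [leRHS]mulr1.
- by rewrite mulr_ge0// ltW.
- exact: ltW.
- exact: expR_ge0.
- by move=> k _; rewrite lexx/=; case/andP: ll.
- move=> k; apply: constant_Lambda; rewrite exprMn.
  rewrite -exprM mulrCA Ks mulr1 exprn_ile1// ltW//.
Qed.

Lemma rate_constant_last : exists M, forall K (xi : nat -> {RV P >-> Xi}),
  (0 < K)%N -> iid D xi ->
  (\int[P]_w (residual (fun _ => (lbar * K%:R `^ (- (2 / 3)))%R) xi K w)%:E <=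
     (M * K%:R `^ (- (1 / 6)))%:E)%E.
Proof.
exists ((last_constant x0 p v lbar lbar lbar (expR (- (2 * 1))) + 1) / 2) => K xi K0 hxi.
pose s : R := K%:R `^ (- (1 / 6)).
have s0 : 0 < s by rewrite powR_gt0 ?ltr0n.
have Ks : K%:R * s ^+ 6 = 1 by exact: powR_root.
have s1 : s <= 1 by exact: root_le1 Ks.
have -> : K%:R `^ (- (2 / 3)) = s ^+ 4.
  by rewrite /s (powRX (f := - (2 / 3)))//; field.
have ll : 0 < lbar * s ^+ 4 <= lbar.
  by rewrite mulr_gt0 ?exprn_gt0//= ler_piMr ?(ltW lb0)// exprn_ile1// ltW.
have hlam (k : nat) : 0 < lbar * s ^+ 4 < 1.
  by case/andP: ll => -> /=/le_lt_trans; apply.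
apply: (rate_last hsep hdot hTz x0 Tp v0 hv (m := 0) hlam hxi K0 _ lb0 lb0) => //.
- by rewrite subn0 mul2n -addnn leq_addr.
- by rewrite s0.
- by case/andP: ll.
- by move=> i _; rewrite lexx.
- move=> k; apply: constant_Lambda; rewrite exprMn.
  have -> : K%:R * (lbar ^+ 2 * s ^+ 4 ^+ 2) = lbar ^+ 2 * s ^+ 2 * (K%:R * s ^+ 6) by ring.
  by rewrite Ks mulr1 mulr_ile1 ?exprn_ge0 ?exprn_ile1 ?(ltW lb0) ?(ltW s0) ?(ltW lb1).
Qed.

Let lam2 (k : nat) := lbar * k.+1%:R `^ (- (1 / 2)) * (ln (k%:R + expR 1))^-1.
Let lam4 (k : nat) := lbar * k.+1%:R `^ (- (2 / 3)).

Lemma bertrand_bounds : [/\ forall k, 0 < lam2 k < 1, forall k, lam2 k <= lbar,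
  forall k, expR (- (4 * 5)) <= discount lam2 2 k,
  forall k, expR (- (4 * 5)) <= discount lam2 4 k &
  forall c : R, exists n, c <= \sum_(k < n) lam2 k].
Proof.
split.
- by move=> k; have /andP[-> /le_lt_trans->] := bertrand_le hlbar k.
- by move=> k; have /andP[] := bertrand_le hlbar k.
- move=> k; apply: (@le_trans _ _ (expR (- (2 * 5)))).
    by rewrite ler_expR lerN2 ler_pM2r// ler_nat.
  by apply: discount_ge => //; exact: bertrand_sqr_sum.
- by move=> k; apply: discount_ge => //; exact: bertrand_sqr_sum.
- apply: (harmonic_unbounded (c := lbar / 4)); first by rewrite divr_gt0.
  exact: bertrand_harmonic.
Qed.

Lemma power_bounds : [/\ forall k, 0 < lam4 k < 1, forall k, lam4 k <= lbar,
  forall k, expR (- (4 * 4)) <= discount lam4 2 k,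
  forall k, expR (- (4 * 4)) <= discount lam4 4 k &
  forall c : R, exists n, c <= \sum_(k < n) lam4 k].
Proof.
split.
- by move=> k; have /andP[-> /le_lt_trans->] := power_le hlbar k.
- by move=> k; have /andP[] := power_le hlbar k.
- move=> k; apply: (@le_trans _ _ (expR (- (2 * 4)))).
    by rewrite ler_expR lerN2 ler_pM2r// ler_nat.
  by apply: discount_ge => //; exact: power_sqr_sum.
- by move=> k; apply: discount_ge => //; exact: power_sqr_sum.
- by apply: (harmonic_unbounded (c := lbar)) => //; exact: power_harmonic.
Qed.

Lemma ln_ge1 (K : nat) : (4 <= K)%N -> 1 <= ln K%:R :> R.
Proof.
move=> K4; rewrite -{1}(expRK (1 : R)) ler_ln ?posrE ?expR_gt0 ?ltr0n//.
  by rewrite (le_trans (@expR1_le4 R))// ler_nat.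
exact: leq_trans K4.
Qed.

Lemma rate_bertrand_random : exists M, forall K (xi : nat -> {RV P >-> Xi})
    (N : {RV P >-> nat}), (4 <= K)%N -> iid D xi -> random_index lam2 K xi N ->
  (\int[P]_w (residual lam2 xi (N w) w)%:E <=
     (M * (ln K%:R `^ (1 / 2) * K%:R `^ (- (1 / 4))))%:E)%E.
Proof.
have [hlam hb hc _ _] := bertrand_bounds.
pose c0 : R := expR (- (4 * 5)).
have c00 : 0 < c0 by exact: expR_gt0.
pose c := c0 * lbar * (1 - lbar) / 2.
exists (((`|x0 - p| ^+ 2 + v) / c + 1) / 2) => K xi N K4 hxi hN.
have K0 : (0 < K)%N by exact: leq_trans K4.
have l1 := ln_ge1 K4; have l0 : 0 < ln K%:R :> R by exact: lt_le_trans l1.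
pose h : R := K%:R `^ (- (1 / 2)).
have h0 : 0 < h by rewrite powR_gt0 ?ltr0n.
have Kh : K%:R * h ^+ 2 = 1 by exact: powR_root.
have s2 : (ln K%:R `^ (1 / 2) * K%:R `^ (- (1 / 4))) ^+ 2 = ln K%:R * h :> R.
  rewrite exprMn (powRX (f := 1)) ?(ltW l0)//; last by field.
  rewrite powRr1 ?(ltW l0)//; congr (_ * _).
  by rewrite (powRX (f := - (1 / 2)))//; field.
have lK0 : 0 < ln (K%:R + expR 1) :> R.
  by apply: lt_le_trans (ln_shift_ge1 K).
(* For K >= 4, K + e <= K^2; this factor 2 is the divisor in [c]. *)
have lK : ln (K%:R + expR 1) <= 2 * ln K%:R :> R.
  rewrite mulr_natl -lnXn ?ltr0n// ler_ln ?posrE ?shift_gt0 ?exprn_gt0 ?ltr0n//.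
  have : 4 <= K%:R :> R by rewrite ler_nat.
  have := @expR1_le4 R; move: (K%:R : R) (expR 1 : R) => k e he hk.
  rewrite expr2; have : 4 * k <= k * k by rewrite ler_wpM2r// (le_trans _ hk).
  lra.
apply: (rate_random hsep hdot hTz x0 Tp v0 hv hlam hxi hN).
- by rewrite divr_gt0// !mulr_gt0.
- by rewrite mulr_gt0 ?powR_gt0 ?ltr0n.
rewrite s2.
apply: le_trans (weight_sum_ge (al := lbar * h * (ln (K%:R + expR 1))^-1) (b := lbar)
   (c0 := c0) _ (ltW lb1) (ltW c00) _ _).
- rewrite ler_pdivrMr ?mulr_gt0//.
  have -> : K%:R * (c0 * (lbar * h / ln (K%:R + expR 1)) * (1 - lbar)) * (ln K%:R * h) =
    c0 * lbar * (1 - lbar) * (ln K%:R / ln (K%:R + expR 1)) * (K%:R * h ^+ 2).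
    by ring.
  rewrite Kh mulr1 /c ler_wpM2l// ?mulr_ge0 ?(ltW c00) ?(ltW lb0) ?(ltW lb10)//.
  by rewrite ler_pdivlMr// mulrC ler_pdivrMr// mulrC.
- by rewrite !mulr_ge0 ?invr_ge0 ?(ltW lb0) ?(ltW h0) ?(ltW lK0).
- move=> k kK; rewrite hb andbT /lam2 -!mulrA ler_pM2l//.
  have lk0 : 0 < ln (k%:R + expR 1) :> R by apply: lt_le_trans (ln_shift_ge1 k).
  apply: ler_pM; rewrite ?invr_ge0 ?(ltW h0) ?(ltW lK0)//.
    rewrite /h !powRN lef_pV2 ?posrE ?powR_gt0 ?ltr0n//.
    by rewrite ge0_ler_powR ?nnegrE// ler_nat.
  rewrite lef_pV2 ?posrE// ler_ln ?posrE ?shift_gt0// lerD2r ler_nat.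
  exact: ltnW.
- by move=> k _; exact: hc.
Qed.

(** On the window [K/2, K) the steps behave like a constant step lbar K^(-2/3) up to a factor 2.
    This yields K^(-1/6), to which the logarithmic factor, at least 1, is attached. *)
Lemma rate_power_last : exists M, forall K (xi : nat -> {RV P >-> Xi}),
  (8 <= K)%N -> iid D xi ->
  (\int[P]_w (residual lam4 xi K w)%:E <=
     (M * (ln K%:R `^ (1 / 2) * K%:R `^ (- (1 / 6))))%:E)%E.
Proof.
have [hlam hb hc _ _] := power_bounds.
pose c0 : R := expR (- (4 * 4)).
have c00 : 0 < c0 by exact: expR_gt0.
pose M := (last_constant x0 p v lbar (2 * lbar) (1 / 2) c0 + 1) / 2.
exists `|M| => K xi K8 hxi.
have K0 : (0 < K)%N by exact: leq_trans K8.
have l1 : 1 <= ln K%:R :> R by apply: ln_ge1; exact: leq_trans K8.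
pose s : R := K%:R `^ (- (1 / 6)).
have s0 : 0 < s by rewrite powR_gt0 ?ltr0n.
have Ks : K%:R * s ^+ 6 = 1 by exact: powR_root.
have s1 : s <= 1 by exact: root_le1 Ks.
have s6 := eq_inv Ks.
(* K >= 8 serves to keep the largest step of the window, 2 lbar s^4, below b0 = 1/2. *)
have s4 : s ^+ 4 <= 4^-1.
  have s2 : s ^+ 2 <= 2^-1.
    rewrite -(@ler_pXn2r _ 3) ?nnegrE ?exprn_ge0 ?(ltW s0)// -exprM s6 exprVn.
    by rewrite lef_pV2 ?posrE ?exprn_gt0 ?ltr0n// -natrX ler_nat.
  have -> : (4^-1 : R) = 2^-1 * 2^-1 by field.
  by rewrite (exprD s 2 2) ler_pM ?sqr_ge0.
apply: (@le_trans _ _ (M * s)%:E); last first.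
  rewrite lee_fin mulrA ler_wpM2r ?(ltW s0)// (le_trans (ler_norm M))//.
  rewrite ler_peMr//; apply: (@le_trans _ _ (ln K%:R `^ 0)).
    by rewrite powRr0.
  by rewrite ler_powR.
have mK : (K./2 < K)%N by lia.
apply: (rate_last hsep hdot hTz x0 Tp v0 hv hlam hxi mK _ lb0 (beta := 2 * lbar)) => //.
- by lia.
- by rewrite mulr_gt0.
- by rewrite s0.
- have := ler_wpM2l (ltW lb0) s4; have := lb1; lra.
- by rewrite ltr_pdivrMr// mul1r ltr1n.
- move=> i /andP[mi iK].
  pose t : R := i.+1%:R `^ (- (1 / 3)).
  have t0 : 0 < t by rewrite powR_gt0 ?ltr0n.
  have it : i.+1%:R * t ^+ 3 = 1 by exact: powR_root.
  have -> : lam4 i = lbar * t ^+ 2.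
    by rewrite /lam4 /t (powRX (f := - (2 / 3)))//; field.
  have Ki : K%:R <= 2 * i.+1%:R :> R.
    by rewrite -natrM ler_nat; lia.
  have iK' : i.+1%:R <= K%:R :> R by rewrite ler_nat.
  have i0 : 0 < i.+1%:R :> R by rewrite ltr0n.
  have t3 := eq_inv it.
  (* Cubes turn the fractional powers into K^(-2) and (i + 1)^(-2). *)
  have e1 : s ^+ 4 ^+ 3 = K%:R^-1 ^+ 2 by rewrite -s6 -!exprM.
  have e2 : t ^+ 2 ^+ 3 = i.+1%:R^-1 ^+ 2 by rewrite -t3 -!exprM.
  apply/andP; split.
    rewrite ler_pM2l// -(@ler_pXn2r _ 3) ?nnegrE ?exprn_ge0 ?(ltW s0) ?(ltW t0)//.
    rewrite e1 e2 ler_pXn2r ?nnegrE ?invr_ge0//.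
    by rewrite lef_pV2 ?posrE ?ltr0n.
  rewrite [leRHS](_ : _ = lbar * (2 * s ^+ 4)); last by ring.
  rewrite ler_pM2l// -(@ler_pXn2r _ 3) ?nnegrE ?mulr_ge0 ?exprn_ge0 ?(ltW s0) ?(ltW t0)//.
  rewrite [leRHS]exprMn e1 e2.
  apply: (@le_trans _ _ ((2 * K%:R^-1) ^+ 2)).
    rewrite ler_pXn2r ?nnegrE ?mulr_ge0 ?invr_ge0//.
    by rewrite ler_pdivlMr ?ltr0n// mulrC ler_pdivrMr.
  by rewrite [leLHS]exprMn ler_wpM2r ?sqr_ge0// -!natrX ler_nat.
- by move=> k _; exact: hc.
Qed.

End ScheduleRates.

(** * The backward-forward iteration *)

Section RegularVersion.
Context {R : realType} {H : completeNormedModType R} (hsep : separable H).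
Context (dot : {dot H for idfun}) (hdot : hilbert_norm dot).
Context {dX} {Xi : measurableType dX} (D : probability Xi R).
Context (tau : R) (tau0 : 0 < tau) (Cs : Xi -> H -> H).
Context (hCsco : {ae D, forall z, cocoercive dot tau (Cs z)}).
Context (hCsmeas : forall x, bochner_measurable D (fun z => Cs z x)).

(* Cs is only almost surely cocoercive and almost everywhere approximable by
   simple functions; outside of a null set it is replaced by 0. *)
Lemma cocoercive_regular_version : exists Ct : Xi -> H -> H,
  [/\ forall z, cocoercive dot tau (Ct z), forall y, hmeas (Ct ^~ y) &
      exists N, [/\ measurable N, D N = 0%E &
        forall z, ~ N z -> Ct z = Cs z]].
Proof.
have [q hq] := separable_seq hsep.
have /choice[s hs] n : exists s : nat -> Xi -> H, (forall j, is_simple (s j)) /\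
    {ae D, forall z, s j z @[j --> \oo] --> Cs z (q n)} by exact: hCsmeas.
have [N [mN N0 hN]] := filterI hCsco (ae_foralln (fun n => (hs n).2)).
have {}hN z : ~ N z -> cocoercive dot tau (Cs z) /\
    forall n, s n j z @[j --> \oo] --> Cs z (q n).
  by move=> Nz; apply: contrapT => h; apply: Nz; apply: hN.
pose Ct z := if z \in N then (fun _ => 0) else Cs z.
have Ctco z : cocoercive dot tau (Ct z).
  rewrite /Ct; have [_|zN] := boolP (z \in N).
    by move=> x y; rewrite subrr normr0 expr0n mulr0 dot0l.
  by have [] := hN z _ => // Nz; rewrite mem_set in zN.
have mN' : measurable_fun setT (fun z => z \in N).
  apply: (measurable_fun_bool true); rewrite setTI.
  by rewrite (_ : _ @^-1` _ = N)//; apply/seteqP; split => z; [exact: set_mem|exact: mem_set].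
have Ctq n : hmeas (Ct ^~ (q n)).
  apply: (@hmeas_cvg _ _ _ _ (fun j z => if z \in N then 0 else s n j z)).
    move=> j v.
    rewrite (_ : (fun z => _) = (fun z => if z \in N then `|0 - v| else `|s n j z - v|)).
      by apply: measurable_fun_ifT => //; exact: (is_simple_hmeas ((hs n).1 j)).
    by apply/funext => z; case: ifP.
  move=> z; rewrite /Ct; have [_|zN] := boolP (z \in N); first exact: cvg_cst.
  by have [] := hN z _ => // Nz; rewrite mem_set in zN.
exists Ct; split => //; last first.
  by exists N; split => // z Nz; rewrite /Ct memNset.
move=> y.
(* From the dense points measurability passes to y, as the Lipschitz constant 1 / tau is common to
   all z. *)
have /choice[i hi] k : exists n, `|y - q n| < k.+1%:R^-1.
  by apply: hq; rewrite invr_gt0.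
apply: (@hmeas_cvg _ _ _ _ (fun k => Ct ^~ (q (i k)))) => // z.
apply/cvgrPdist_le => e e0; have te : 0 < e * tau by rewrite mulr_gt0.
near=> k.
rewrite (le_trans (cocoercive_lipschitz hdot _ _ tau0 (Ctco z)))//.
rewrite mulrC ler_pdivrMr// (le_trans (ltW (hi k)))// ltW//.
near: k; exact: (near_infty_natSinv_lt (PosNum te)).
Unshelve. all: by end_near. Qed.

End RegularVersion.

Section BackwardForwardModel.
Context {R : realType} {H : completeNormedModType R} (hsep : separable H).
Context (dot : {dot H for idfun}) (hdot : hilbert_norm dot).
Context {dX} {Xi : measurableType dX} (D : probability Xi R).
Context (A : H -> set H) (hA : maximally_monotone dot A).
Context (tau rho : R) (hrho : 0 < rho < 2 * tau).
Context (C : H -> H) (hC : cocoercive dot tau C) (Cs Ct : Xi -> H -> H).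
Context (hCtco : forall z, cocoercive dot tau (Ct z))
  (hCtmeas : forall y, hmeas (Ct ^~ y)) (N : set Xi) (mN : measurable N)
  (N0 : D N = 0%E) (hN : forall z, ~ N z -> Ct z = Cs z).
Context (hCmean : forall y, is_bochner_integral D (fun z => Cs z y) (C y)).

Let J := resolvent rho A.
Let T x := J x - rho *: C (J x).

Let rho0 : 0 < rho. Proof. by case/andP: hrho. Qed.

Lemma ae_regular : {ae D, forall z, Ct z = Cs z}.
Proof.
by exists N; split => // z /= h; apply: contrapT => Nz; apply: h; exact: hN.
Qed.

Let hCtmean y : is_bochner_integral D (fun z => Ct z y) (C y).
Proof.
by apply: eq_is_bochner_integral (hCmean y); apply: filterS ae_regular => z ->.
Qed.

(** [bochner_integral] is defined by choice; uniqueness identifies the chosen value with the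
    integral of the regular version. *)
Lemma bf_meanE : bf_mean D rho A Cs = T.
Proof.
apply/funext => x; rewrite /bf_mean /bochner_integral.
have hT : is_bochner_integral D (fun z => bf_op rho A Ct z x) (T x).
  exact: (is_bochner_integral_affine hsep hdot (J x) rho (hCtmeas (J x)) (hCtmean (J x))).
have mT : hmeas (fun z => bf_op rho A Ct z x).
  apply: hmeasB => //.
  by apply: hmeasZ => //; exact: hCtmeas.
have eqT : {ae D, forall z, bf_op rho A Ct z x = bf_op rho A Cs z x}.
  by apply: filterS ae_regular => z; rewrite /bf_op => ->.
have eqT' : {ae D, forall z, bf_op rho A Cs z x = bf_op rho A Ct z x}.
  by apply: filterS eqT => z ->.
case: xgetP => [v _ hv|/(_ (T x)) []].
  exact: (is_bochner_integral_unique hsep hdot mT (eq_is_bochner_integral eqT' hv) hT).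
exact: eq_is_bochner_integral eqT hT.
Qed.

Lemma bf_random_nonexpansive : random_nonexpansive dot D (bf_op rho A Ct) T.
Proof.
have nJ := resolvent_nonexpansive hdot hA rho0.
split.
- by move=> z x y; rewrite (le_trans _ (nJ x y))//; exact: (forward_nonexpansive hdot hrho (hCtco z)).
- by move=> x y; rewrite (le_trans _ (nJ x y))//; exact: (forward_nonexpansive hdot hrho hC).
- move=> x; apply: hmeasB => //.
  by apply: hmeasZ => //; exact: hCtmeas.
- move=> x y; rewrite /T !dotE -mulNr.
  have := has_meanD (has_mean_cst D (dot (J x) y))
    (has_meanZ (- rho) (bochner_dot hsep hdot y (hCtmeas (J x)) (hCtmean (J x)))).
  by apply: eq_has_mean => z; rewrite /bf_op !dotE mulNr.
Qed.

Lemma bf_variance_le (p : H) (sigma : R) :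
  (\int[D]_z (`|C (J p) - Cs z (J p)| ^+ 2)%:E <= (sigma ^+ 2)%:E)%E ->
  variance_le D (bf_op rho A Ct) T p (rho ^+ 2 * sigma ^+ 2).
Proof.
move=> hs; rewrite /variance_le.
have m1 : measurable_fun setT (fun z => `|C (J p) - Ct z (J p)| ^+ 2).
  by apply: measurable_sqr_norm; apply: hmeasB => //; exact: hmeas_cst.
have -> : (\int[D]_z (`|noise (bf_op rho A Ct) T z p| ^+ 2)%:E =
    (rho ^+ 2)%:E * \int[D]_z (`|C (J p) - Ct z (J p)| ^+ 2)%:E)%E.
  rewrite -ge0_integralZl_EFin ?sqr_ge0//.
  - apply: eq_integral => z _; rewrite -EFinM; congr EFin.
    have -> : noise (bf_op rho A Ct) T z p = rho *: (C (J p) - Ct z (J p)).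
      by apply: (dot_ext hdot) => y; rewrite /noise /bf_op /T -/J !dotE; ring.
    by rewrite normrZ exprMn real_normK ?num_real.
  - exact/measurable_EFinP.
rewrite [leRHS]EFinM lee_wpmul2l ?lee_fin ?sqr_ge0//; apply: le_trans hs.
apply: ge0_le_integral_ae => [z|z|]; rewrite ?lee_fin ?sqr_ge0//.
by apply: filterS ae_regular => z ->.
Qed.

Context {d} {Omega : measurableType d} (P : probability Omega R).

(** Each xi_k has law D and so avoids N almost surely; countably many null events are discarded. *)
Lemma ae_bf_iterE (lam : nat -> R) (x0 : H) (xi : nat -> {RV P >-> Xi}) :
  iid D xi -> {ae P, forall w, forall k,
    bf_iter rho A Cs lam x0 (fun i => xi i w) k =
    skm (bf_op rho A Ct) lam x0 (fun i => xi i w) k}.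
Proof.
move=> [hD _].
have hxi : {ae P, forall w, forall k, ~ N (xi k w)}.
  apply: ae_foralln => k; exists (xi k @^-1` N); split.
  - exact: measurable_funPTI.
  - by rewrite -N0 -(hD k N mN).
  - by move=> w /= h; apply: contrapT.
apply: filterS hxi => w hw; elim=> [//|k ih] /=.
by rewrite ih /bf_op (hN (hw k)).
Qed.

End BackwardForwardModel.

Theorem mainTheorem9 (R : realType) (H : completeNormedModType R)
    (dot : {dot H for idfun}) (hdot : hilbert_norm dot) (hsep : separable H)
    (dX : measure_display) (Xi : measurableType dX) (D : probability Xi R)
    (A : H -> set H) (hA : maximally_monotone dot A)
    (tau : R) (htau : 0 < tau)
    (C : H -> H) (hC : cocoercive dot tau C) (Cs : Xi -> H -> H)
    (hCsco : {ae D, forall z, cocoercive dot tau (Cs z)})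
    (hCsmeas : forall x, bochner_measurable D (fun z => Cs z x))
    (hCsint : forall x, bochner_integrable D (fun z => Cs z x))
    (hCmean : forall x, C x = bochner_integral D (fun z => Cs z x))
    (hZer : Zer (sum_op A C) !=set0)
    (rho : R) (hrho : 0 < rho < 2 * tau)
    (sigma : R) (p0 : H) (hp0 : Fix (bf_mean D rho A Cs) p0)
    (hsigma : ('E_D[fun z => (`|C (resolvent rho A p0)
                               - Cs z (resolvent rho A p0)| ^+ 2)%R]
               <= (sigma ^+ 2)%:E)%E)
    (x0 : H) (lbar : R) (hlbar : 0 < lbar < 1)
    (dO : measure_display) (Omega : measurableType dO)
    (P : probability Omega R) :
  let T := bf_mean D rho A Cs in
  let x (lam : nat -> R) (xi : nat -> {RV P >-> Xi}) (k : nat) (w : Omega) :=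
    bf_iter rho A Cs lam x0 (fun i => xi i w) k in
  let residual lam xi k w := `|T (x lam xi k w) - x lam xi k w| in
  let lam1 (K k : nat) := lbar * K%:R `^ (- (1 / 2)) in
  let lam2 (k : nat) :=
    lbar * k.+1%:R `^ (- (1 / 2)) * (ln (k%:R + expR 1))^-1 in
  let lam3 (K k : nat) := lbar * K%:R `^ (- (2 / 3)) in
  let lam4 (k : nat) := lbar * k.+1%:R `^ (- (2 / 3)) in
  [/\ forall (xi : nat -> nat -> {RV P >-> Xi}) (N : nat -> {RV P >-> nat}),
        (forall K, (0 < K)%N ->
           iid D (xi K) /\ random_index (lam1 K) K (xi K) (N K)) ->
        le_bigO (fun K => 'E_P[fun w => residual (lam1 K) (xi K) (N K w) w])%E
                (fun K => K%:R `^ (- (1 / 4))),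
      forall (xi : nat -> {RV P >-> Xi}) (N : nat -> {RV P >-> nat}),
        iid D xi ->
        (forall K, (0 < K)%N -> random_index lam2 K xi (N K)) ->
        le_bigO (fun K => 'E_P[fun w => residual lam2 xi (N K w) w])%E
                (fun K => ln K%:R `^ (1 / 2) * K%:R `^ (- (1 / 4))),
      forall xi : nat -> nat -> {RV P >-> Xi},
        (forall K, (0 < K)%N -> iid D (xi K)) ->
        le_bigO (fun K => 'E_P[residual (lam3 K) (xi K) K])%E
                (fun K => K%:R `^ (- (1 / 6))),
      forall xi : nat -> {RV P >-> Xi}, iid D xi ->
        le_bigO (fun K => 'E_P[residual lam4 xi K])%E
                (fun K => ln K%:R `^ (1 / 2) * K%:R `^ (- (1 / 6)))
    & forall lam : nat -> R, lam = lam2 \/ lam = lam4 ->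
      forall xi : nat -> {RV P >-> Xi}, iid D xi ->
        {ae P, forall w, exists p : H,
           [/\ Fix T p, Zer (sum_op A C) (resolvent rho A p)
             & weakly_cvg dot (fun k => x lam xi k w) p]}
        /\ {ae P, forall w, residual lam xi k w @[k --> \oo] --> (0 : R)}].
Proof.
have /andP[rho0 rho2] := hrho.
have [Ct [hCtco hCtmeas [N0 [mN DN hN]]]] :=
  cocoercive_regular_version hsep hdot htau hCsco hCsmeas.
have hCm y : is_bochner_integral D (fun z => Cs z y) (C y).
  rewrite hCmean; have [v hv] := hCsint y.
  by rewrite /bochner_integral; apply: xgetPex; exists v.
have TE := bf_meanE hsep hdot A rho hCtmeas mN DN hN hCm.
have hT := bf_random_nonexpansive hsep hdot hA hrho hC hCtco hCtmeas mN DN hN hCm.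
have hv : variance_le D (bf_op rho A Ct)
    (fun x => resolvent rho A x - rho *: C (resolvent rho A x)) p0 (rho ^+ 2 * sigma ^+ 2).
  apply: (bf_variance_le hsep hdot hCtmeas mN DN hN).
  by move: hsigma; rewrite unlock.
have v0 : 0 <= rho ^+ 2 * sigma ^+ 2 by rewrite mulr_ge0 ?sqr_ge0.
have Tp0 : resolvent rho A p0 - rho *: C (resolvent rho A p0) = p0.
  by move: hp0; rewrite TE.
have hiter := @ae_bf_iterE _ _ _ _ D A rho Cs Ct N0 mN DN hN.
move=> T x residual lam1 lam2 lam3 lam4.
have resE lam xi : iid D xi -> {ae P, forall w, forall k, residual lam xi k w =
    `|T (skm (bf_op rho A Ct) lam x0 (fun i => xi i w) k) -
      skm (bf_op rho A Ct) lam x0 (fun i => xi i w) k|}.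
  by move=> hxi; apply: filterS (hiter _ _ P lam x0 xi hxi) => w hw k; rewrite /residual /x hw.
(* The residual f for the original C_xi need not be measurable, so it is compared with its regular
   version through nonnegativity and almost sure equality. *)
have transfer (f g : Omega -> R) (a : R) : (forall w, 0 <= f w) -> (forall w, 0 <= g w) ->
    {ae P, forall w, f w = g w} -> (\int[P]_w (g w)%:E <= a%:E)%E ->
    ('E_P[f] <= a%:E)%E.
  move=> f0 g0 fg; rewrite unlock; apply: le_trans.
  apply: ge0_le_integral_ae => [w|w|]; rewrite ?lee_fin//.
  by apply: filterS fg => w /= ->.
split.
- move=> xi N h; have [M hM] := rate_constant_random hsep hdot hT x0 Tp0 v0 hv P hlbar.
  exists M; exists 1%N => // K /= K1; have [hxi hK] := h K K1.
  apply: (transfer _ _ _ _ _ _ (hM K (xi K) (N K) K1 hxi hK)) => [w|w|]; [exact: normr_ge0|exact: normr_ge0|].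
  by apply: filterS (resE (lam1 K) (xi K) hxi) => w hw; rewrite hw /T TE.
- move=> xi N hxi h; have [M hM] := rate_bertrand_random hsep hdot hT x0 Tp0 v0 hv P hlbar.
  exists M; exists 4%N => // K /= K4; have hK := h K (leq_trans _ K4).
  apply: (transfer _ _ _ _ _ _ (hM K xi (N K) K4 hxi (hK isT))) => [w|w|]; [exact: normr_ge0|exact: normr_ge0|].
  by apply: filterS (resE lam2 xi hxi) => w hw; rewrite hw /T TE.
- move=> xi h; have [M hM] := rate_constant_last hsep hdot hT x0 Tp0 v0 hv P hlbar.
  exists M; exists 1%N => // K /= K1; have hxi := h K K1.
  apply: (transfer _ _ _ _ _ _ (hM K (xi K) K1 hxi)) => [w|w|]; [exact: normr_ge0|exact: normr_ge0|].
  by apply: filterS (resE (lam3 K) (xi K) hxi) => w hw; rewrite hw /T TE.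
- move=> xi hxi; have [M hM] := rate_power_last hsep hdot hT x0 Tp0 v0 hv P hlbar.
  exists M; exists 8%N => // K /= K8.
  apply: (transfer _ _ _ _ _ _ (hM K xi K8 hxi)) => [w|w|]; [exact: normr_ge0|exact: normr_ge0|].
  by apply: filterS (resE lam4 xi hxi) => w hw; rewrite hw /T TE.
move=> lam hlam xi hxi.
have [c0 [c00 [hl hb hc2 hc4 hdiv]]] : exists c0 : R, 0 < c0 /\
    [/\ forall k, 0 < lam k < 1, forall k, lam k <= lbar,
        forall k, c0 <= discount lam 2 k, forall k, c0 <= discount lam 4 k &
        forall c : R, exists n, c <= \sum_(k < n) lam k].
  case: hlam => ->.
    by exists (expR (- (4 * 5))); split; [exact: expR_gt0|exact: bertrand_bounds].
  by exists (expR (- (4 * 4))); split; [exact: expR_gt0|exact: power_bounds].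
have lb1 : lbar < 1 by case/andP: hlbar.
have [h1 h2] := skm_almost_sure hsep hdot hT hl x0 hxi Tp0 v0 hv lb1 hb c00 hc2 hc4 hdiv.
split; last first.
  apply: filterS2 (resE lam xi hxi) h2 => w hw.
  rewrite (_ : (fun k => residual lam xi k w) = (fun k =>
    `|T (skm (bf_op rho A Ct) lam x0 (fun i => xi i w) k) -
      skm (bf_op rho A Ct) lam x0 (fun i => xi i w) k|)).
    by rewrite /T TE.
  by apply/funext => k; rewrite hw.
apply: filterS2 (hiter _ _ P lam x0 xi hxi) h1 => w hw [p [Tp wp]]; exists p; split.
- by rewrite /T TE.
- exact: (fix_backward_forward hdot hA rho0 Tp).
- rewrite (_ : (fun k => x lam xi k w) =
    skm (bf_op rho A Ct) lam x0 (fun i => xi i w))//.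
  by apply/funext => k; rewrite /x hw.
Qed.
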